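(* There are $\alpha>0$ and $C>0$ such that for all even integers $R\ge 2$ one has $E_{\frac{R^2}{2},R^2}(N_R^0)\ge C R^{\alpha}$, and, with these same $\alpha$ and $C$, for all even integers $R\ge 2$, $$\frac{P_{\frac{R^2}{2}+1,\,R^2}(A_R)-P_{\frac{R^2}{2},\,R^2}(A_R)}{1/R^2}\ \ge\ 2C R^{\alpha}.$$
   Context: The $R\times R$ box in the triangular lattice is the graph with vertex set $V_R=\{x+y\exp(i\pi/3): x,y\in\mathbb{Z},\ 0\le x,y\le R-1\}\subset\mathbb{C}$, in which two vertices $v,w$ share an edge iff $|v-w|=1$. A configuration is an element $\omega\in\{0,1\}^{V_R}$; a vertex $v$ is occupied if $\omega_v=1$ and vacant if $\omega_v=0$. $A_R$ is the event that there is an occupied path which crosses the box horizontally, i.e. a path in this graph, all of whose vertices are occupied, from the left side $\{x=0\}$ to the right side $\{x=R-1\}$ of the box. For $0\le k\le R^2$, $P_{k,R^2}=P_{k,V_R}$ is the distribution on $\{0,1\}^{V_R}$ giving probability $1/\binom{R^2}{k}$ to each $\omega$ with $\sum_v\omega_v=k$, and $0$ to all other $\omega$; $E_{k,R^2}$ denotes the corresponding expectation. A vertex $v$ is $0$-pivotal for an event $A$ in the configuration $\omega$ if $\omega_v=0$ and exactly one of $\omega$ and $\omega^{(v)}$ is in $A$, where $\omega^{(v)}$ is obtained from $\omega$ by replacing $\omega_v$ by $1-\omega_v$. $N_R^0$ is the number of vertices of $V_R$ that are $0$-pivotal for $A_R$. *)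

(* Defs.v *)
From mathcomp Require Import all_boot all_order all_algebra.
From mathcomp Require Import all_classical all_reals all_analysis.
From mathcomp Require Export complex.

Set Implicit Arguments.
Unset Strict Implicit.
Unset Printing Implicit Defensive.

Import Order.TTheory GRing.Theory Num.Theory.

Local Open Scope ring_scope.

Definition config (V : finType) := {ffun V -> bool}.

Section FixedOccupation.
Variables (R : realType) (V : finType).
Implicit Types (k : nat) (w : config V) (A : {set config V}) (v : V).

Definition unif_pmf k w : R :=
  if (\sum_(v : V) w v == k)%N then ('C(#|V|, k)%:R)^-1 else 0.

Definition unif_prob k A : R := \sum_(w in A) unif_pmf k w.

Definition unif_expect k (X : config V -> R) : R :=
  \sum_(w : config V) unif_pmf k w * X w.

End FixedOccupation.

Section Pivotal.
Variable V : finType.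

Definition flip (w : config V) (v : V) : config V :=
  [ffun u => if u == v then ~~ w u else w u].

Definition pivotal0 (A : {set config V}) (w : config V) (v : V) : bool :=
  ~~ w v && ((w \in A) (+) (flip w v \in A)).

End Pivotal.

(* The vertex x + y exp(i pi / 3) of the n x n box is encoded by the pair of  *)
(* its lattice coordinates (x, y); tri_embed gives its position in the plane. *)
Definition box (n : nat) : finType := ('I_n * 'I_n)%type.

Section TriangularBox.
Variables (R : realType) (n : nat).
Implicit Types (u v : box n) (w : config (box n)).

Definition tri_embed v : R[i] :=
  (v.1)%:R + (v.2)%:R * (cos (pi / 3) +i* sin (pi / 3))%C.

Definition tri_adj : rel (box n) :=
  [rel u v | `|tri_embed u - tri_embed v| == 1].

Definition has_crossing w : Prop :=
  exists (u : box n) (p : seq (box n)),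
    [/\ path tri_adj u p,
        all w (u :: p),
        u.1 = 0%N :> nat &
        (last u p).1 = n.-1 :> nat].

Definition crossing_event : {set config (box n)} :=
  [set w | `[< has_crossing w >]].

Definition num_pivotal0 w : nat :=
  #|[set v | pivotal0 crossing_event w v]|.

End TriangularBox.

(* Main.v *)
(* Opening a uniform closed site of a uniform configuration with m = R^2/2
   open sites gives a uniform configuration with m + 1 open sites, so that
   P_(m+1)(A_R) - P_m(A_R) is E_m(N^0) divided by the number R^2/2 of closed
   sites, and both bounds amount to polynomial growth of E_m(N^0).

   Let f be the crossing indicator under fair coin flips and let g(w) be f
   evaluated at a configuration with m open sites obtained from w by closing
   or opening as few sites as possible in a fixed order. Averaged over all
   relabelings of the order, the total influence of g is at most 4 E_m(N^0),
   since changing one flip changes the adjusted configuration by moving one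
   open site. The two-function OSSS inequality bounds Cov(f, g) by the sum
   over the sites of the probability that an algorithm computing f queries the
   site, times its influence on g. The algorithm explores the open clusters
   that meet a random lattice line; a site is queried only if its cluster
   reaches the line, which has polynomially small probability. The covariance
   is bounded below by a constant: if f = 1 and the number of open sites is at
   most m, then g = 1, and flipping the unqueried sites shows that this
   happens for about half of the configurations with f = 1. Since f has
   probability 1/2 by duality, E_m(N^0) exceeds a power of R.

   The one-arm decay comes from Russo-Seymour-Welsh crossings. Duality is the
   game of Y. A rectangle that is crossed in both directions with probability
   bounded below is lengthened by folding: a crossing of a tall strip is
   folded onto a vertically crossed one, beyond its leftmost vertical
   crossing, so that it attaches to that crossing inside one of boundedly many
   strips. *)
Require Import Defs.
From mathcomp Require Import all_boot all_order all_algebra fingroup perm.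
From mathcomp Require Import all_classical all_reals all_analysis.
From mathcomp Require Import fintype finset zify lra ring.

Set Implicit Arguments.
Unset Strict Implicit.
Unset Printing Implicit Defensive.

Import Order.TTheory GRing.Theory Num.Theory.

Local Open Scope ring_scope.

(** * Connectivity and the game of Y *)

(** Conditioning on exactly half of the sites destroys independence, so Harris, OSSS and the
    explorations are all run with fair flips, and the adjusted indicator is the only bridge to the
    fixed level. A fixed order of adjustment would favour some sites; relabelings act transitively
    on pairs of a half-open configuration and a closed site, so averaging over them turns any single
    pair into a uniform one, whatever the geometry of the box. The line must be random because sites
    on a fixed line are always queried; over all lines this costs each site only a small fraction.
    The box is a rhombus: exchanging the coordinates makes it exactly self-dual, both for fair flips
    and at level $R^2/2$, but it lacks the mirror symmetry that lengthening needs. Rectangles have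
    the mirror, yet duality only says there that the two crossing probabilities sum to 1. So a width
    balanced between the two is selected by an intermediate value argument, and comparison with
    rhombi keeps its aspect ratio bounded. The bound grows only for large boxes; small ones need
    just one pivotal site, at the price of a smaller constant. *)

Definition site := (int * int)%type.

(** The six unit vectors of the triangular lattice in the basis 1, exp(i pi/3). *)
Definition adj (u v : site) : bool :=
  let a := v.1 - u.1 in let b := v.2 - u.2 in
  [|| (a == 1) && (b == 0), (a == -1) && (b == 0), (a == 0) && (b == 1),
      (a == 0) && (b == -1), (a == 1) && (b == -1) | (a == -1) && (b == 1)].

Inductive conn (G : site -> Prop) (u : site) : site -> Prop :=
| conn0 : G u -> conn G u u
| connS v w : conn G u v -> adj v w -> G w -> conn G u w.

Lemma site_eq (u v : site) : u.1 = v.1 -> u.2 = v.2 -> u = v.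
Proof. by case: u v => [a b] [c d] /= -> ->. Qed.

Lemma adj_sym u v : adj u v = adj v u.
Proof. rewrite /adj; lia. Qed.

Section Conn.
Implicit Types (G P : site -> Prop) (u v w : site).

Lemma conn_r G u v : conn G u v -> G v.
Proof. by case. Qed.

Lemma conn_l G u v : conn G u v -> G u.
Proof. by elim. Qed.

Lemma conn_trans G u v w : conn G u v -> conn G v w -> conn G u w.
Proof. by move=> uv; elim=> // a b _ ua ab Gb; apply: connS ua ab Gb. Qed.

Lemma conn_sym G u v : conn G u v -> conn G v u.
Proof.
elim=> [Gu|a b ua au ab Gb]; first exact: conn0.
apply: conn_trans au.
by apply: (connS (conn0 Gb)); [rewrite adj_sym|exact: conn_r ua].
Qed.

Lemma conn_map G G' (F : site -> site) :
  (forall p q, adj p q -> F p = F q \/ adj (F p) (F q)) ->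
  (forall p, G p -> G' (F p)) ->
  forall u v, conn G u v -> conn G' (F u) (F v).
Proof.
move=> Fadj FG u v; elim=> [Gu|a b _ ua ab Gb]; first exact: conn0 (FG _ Gu).
by case: (Fadj _ _ ab) => [<- //|fab]; apply: connS ua fab (FG _ Gb).
Qed.

Lemma conn_mono G G' u v :
  (forall p, G p -> G' p) -> conn G u v -> conn G' u v.
Proof.
move=> GG'; elim=> [Gu|a b _ ua ab Gb]; first exact: conn0 (GG' _ Gu).
exact: connS ua ab (GG' _ Gb).
Qed.

Lemma conn_cluster G u v : conn G u v -> conn (conn G u) u v.
Proof.
elim=> [Gu|a b ua cua ab Gb]; first by apply: conn0; apply: conn0.
by apply: (connS cua ab); apply: connS ua ab Gb.
Qed.

(** Cuts a path at its first step out of [P]. All trimming of paths to regions and all discrete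
    intermediate value arguments go through this. *)
Lemma conn_exit G P u v : conn G u v -> P u ->
  conn (fun p => G p /\ P p) u v \/
  exists a b, [/\ conn (fun p => G p /\ P p) u a, adj a b, G b, ~ P b & conn G b v].
Proof.
move=> uv Pu; elim: uv => [Gu|v' w uv IH vw Gw]; first by left; apply: conn0.
case: IH => [IH|[a [b [ua ab Gb nPb bv]]]]; last first.
  by right; exists a, b; split=> //; apply: connS bv vw Gw.
case: (pselect (P w)) => Pw; first by left; apply: (connS IH vw).
by right; exists v', w; split=> //; apply: conn0.
Qed.

Lemma conn_bounded G u v : conn G u v ->
  exists M : int, conn (fun p => G p /\ `|p.1| <= M) u v.
Proof.
elim=> [Gu|a b _ [M ua] ab Gb]; first by exists `|u.1|; apply: conn0.
exists (M + `|b.1|).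
apply: (connS (v := a)) => //; last by split=> //; have [_ ] := conn_r ua; lia.
apply: conn_mono ua => p [Gp pM]; split=> //; lia.
Qed.

End Conn.

Definition adjeq (u v : site) := (u.1 == v.1) && (u.2 == v.2) || adj u v.

Lemma conn_adjeq (G : site -> Prop) u v w : conn G u v -> adjeq v w -> G w -> conn G u w.
Proof.
move=> uv /orP[/andP[/eqP e1 /eqP e2] _|]; last exact: connS.
by rewrite -(site_eq e1 e2).
Qed.

(* The game of Y on the triangle x, y >= 0, x + y <= n: replacing every small
   upward triangle by a single cell carrying its majority colour yields a
   triangle of size n - 1 with the same winner, so exactly one colour has a
   cluster touching all three sides. *)
Section GameOfY.
Implicit Types (c : site -> bool) (t p q : site) (n : nat).

Definition board n p := [&& 0 <= p.1, 0 <= p.2 & p.1 + p.2 <= n%:Z].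

Definition Ywin n c := exists u0 u1 u2,
  let G p := board n p && c p in
  [/\ conn G u0 u1, conn G u0 u2, u0.1 = 0, u1.2 = 0 & u2.1 + u2.2 = n%:Z].

Definition upright t p :=
  [|| (p.1 == t.1) && (p.2 == t.2), (p.1 == t.1 + 1) && (p.2 == t.2)
    | (p.1 == t.1) && (p.2 == t.2 + 1)].

Definition maj c t :=
  let a := c t in let b := c (t.1 + 1, t.2) in let d := c (t.1, t.2 + 1) in
  [|| a && b, a && d | b && d].

Lemma maj_negb c t : maj (fun p => ~~ c p) t = ~~ maj c t.
Proof. by rewrite /maj; case: (c t); case: (c _); case: (c _). Qed.

Lemma upright_adjeq t p q : upright t p -> upright t q -> adjeq p q.
Proof. rewrite /upright /adjeq /adj; lia. Qed.

(** Adjacent upward triangles share a corner. Either it has the colour and serves for both, or the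
    two majorities force the remaining corners, among which there is an adjacent pair. *)
Lemma maj_adj c t t' : adj t t' -> maj c t -> maj c t' ->
  exists p q, [/\ upright t p, upright t' q, c p, c q & adjeq p q].
Proof.
have main (x y x' y' : int) : (x' == x + 1) && (y' == y) || (x' == x) && (y' == y + 1)
      || (x' == x + 1) && (y' == y - 1) ->
    maj c (x, y) -> maj c (x', y') ->
    exists p q, [/\ upright (x, y) p, upright (x', y') q, c p, c q & adjeq p q].
  rewrite /maj /=.
  move=> /orP[/orP[]|] /andP[/eqP -> /eqP ->].
  - case cs: (c (x + 1, y)) => /=.
      by exists (x + 1, y), (x + 1, y); split=> //; rewrite /upright /adjeq /=; lia.
    rewrite andbF /= orbF => /andP[_ cp] /andP[_ cq].
    by exists (x, y + 1), (x + 1, y + 1); split=> //; rewrite /upright /adjeq /adj /=; lia.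
  - case cs: (c (x, y + 1)) => /=.
      by exists (x, y + 1), (x, y + 1); split=> //; rewrite /upright /adjeq /=; lia.
    rewrite !andbF /= !orbF => /andP[_ cp] /andP[cq _].
    by exists (x + 1, y), (x + 1, y + 1); split=> //; rewrite /upright /adjeq /adj /=; lia.
  - rewrite subrK; case cs: (c (x + 1, y)) => /=.
      by exists (x + 1, y), (x + 1, y); split=> //; rewrite /upright /adjeq /=; lia.
    rewrite !andbF /= !orbF => /andP[cp _] /andP[cq _].
    by exists (x, y), (x + 1, y - 1); split=> //; rewrite /upright /adjeq /adj /=; lia.
case: t t' => [x y] [x' y'] tt' mt mt'.
have [h|h] : ((x' == x + 1) && (y' == y) || (x' == x) && (y' == y + 1)
      || (x' == x + 1) && (y' == y - 1)) \/ ((x == x' + 1) && (y == y') || (x == x') && (y == y' + 1)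
      || (x == x' + 1) && (y == y' - 1)) by move: tt'; rewrite /adj /=; lia.
  exact: main h mt mt'.
have [p [q [? ? ? ? pq]]] := main _ _ _ _ h mt' mt.
by exists q, p; split=> //; move: pq; rewrite /adjeq /adj; lia.
Qed.

Lemma upright_val c t p : upright t p -> c p ->
  [|| (p == t) && c t, (p == (t.1 + 1, t.2)) && c (t.1 + 1, t.2)
    | (p == (t.1, t.2 + 1)) && c (t.1, t.2 + 1)].
Proof.
case: t p => [a b] [x y]; rewrite /upright /=.
by case/or3P => /andP[/eqP -> /eqP ->] ->; rewrite !eqxx ?orbT.
Qed.

Lemma upright_maj c t p q : upright t p -> upright t q ->
  ~~ ((p.1 == q.1) && (p.2 == q.2)) -> c p -> c q -> maj c t.
Proof.
move=> tp tq npq cp cq; move: (upright_val tp cp) (upright_val tq cq) npq; rewrite /maj.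
by case/or3P => /andP[/eqP -> c1]; case/or3P => /andP[/eqP -> c2];
  rewrite ?eqxx //= ?c1 ?c2 ?orbT.
Qed.

Lemma adj_upright n p q : adj p q -> board n.+1 p -> board n.+1 q ->
  exists t, [/\ upright t p, upright t q & board n t].
Proof.
wlog pq : p q / [|| (q.1 == p.1 + 1) && (q.2 == p.2), (q.1 == p.1) && (q.2 == p.2 + 1)
    | (q.1 == p.1 + 1) && (q.2 == p.2 - 1)].
  move=> H pq bp bq.
  have [h|h] : ([|| (q.1 == p.1 + 1) && (q.2 == p.2), (q.1 == p.1) && (q.2 == p.2 + 1)
    | (q.1 == p.1 + 1) && (q.2 == p.2 - 1)]) \/ ([|| (p.1 == q.1 + 1) && (p.2 == q.2),
    (p.1 == q.1) && (p.2 == q.2 + 1) | (p.1 == q.1 + 1) && (p.2 == q.2 - 1)]).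
    by move: pq; rewrite /adj /=; lia.
  - exact: H.
  - by have [t [? ? ?]] := H _ _ h (etrans (adj_sym _ _) pq) bq bp; exists t.
case: p q pq => [x y] [x' y'] /= pq _; rewrite /board /= => /and3P[b1 b2 b3] /and3P[b4 b5 b6].
case/or3P: pq => /andP[/eqP e1 /eqP e2]; subst x' y'.
- exists (x, y); split; rewrite /upright /= ?eqxx ?orbT //; lia.
- exists (x, y); split; rewrite /upright /= ?eqxx ?orbT //; lia.
- exists (x, y - 1); split; rewrite /upright /= ?subrK ?eqxx ?orbT //; lia.
Qed.

Lemma Ywin_lift n c : Ywin n (maj c) -> Ywin n.+1 c.
Proof.
move=> [u0 [u1 [u2 [u01 u02 e0 e1 e2]]]].
pose G p := board n.+1 p && c p.
have boardS t p : board n t -> upright t p -> board n.+1 p.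
  rewrite /board /upright; lia.
have lift p v : upright u0 p -> c p -> conn (fun t => board n t && maj c t) u0 v ->
    forall q, upright v q -> c q -> conn G p q.
  move=> up cp; elim=> [/andP[b0 m0]|v1 v2 v01 IH v12 /andP[b2 m2]] q uq cq.
    apply: (@conn_adjeq _ _ p); last by rewrite /G cq (boardS _ _ b0).
      by apply: conn0; rewrite /G cp (boardS _ _ b0).
    exact: upright_adjeq up uq.
  have /andP[_ m1] := conn_r v01.
  have [q1 [q2 [uq1 uq2 cq1 cq2 q12]]] := maj_adj v12 m1 m2.
  apply: (@conn_adjeq _ _ q2); last by rewrite /G cq (boardS _ _ b2).
    by apply: (conn_adjeq (IH _ uq1 cq1) q12); rewrite /G cq2 (boardS _ _ b2).
  exact: upright_adjeq uq2 uq.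
have /andP[_ m0] := conn_l u01.
have /andP[_ m1] := conn_r u01; have /andP[_ m2] := conn_r u02.
have [p0 [up0 cp0 p00]] : exists p, [/\ upright u0 p, c p & p.1 = 0].
  move: m0; rewrite /maj; case c0: (c u0).
    by exists u0; rewrite c0 /upright !eqxx.
  move=> /= /andP[_ cd]; exists (u0.1, u0.2 + 1).
  by rewrite cd /upright /= !eqxx !orbT.
have [p1 [up1 cp1 p10]] : exists p, [/\ upright u1 p, c p & p.2 = 0].
  move: m1; rewrite /maj; case c0: (c u1).
    by exists u1; rewrite c0 /upright !eqxx.
  move=> /= /andP[cd _]; exists (u1.1 + 1, u1.2).
  by rewrite cd /upright /= !eqxx !orbT.
have [p2 [up2 cp2 p20]] : exists p, [/\ upright u2 p, c p & p.1 + p.2 = n.+1%:Z].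
  move: m2; rewrite /maj; case c0: (c (u2.1 + 1, u2.2)).
    exists (u2.1 + 1, u2.2); rewrite c0 /upright /= !eqxx !orbT; split=> //; lia.
  rewrite andbF /= orbF => /andP[_ cd]; exists (u2.1, u2.2 + 1).
  rewrite cd /upright /= !eqxx !orbT; split=> //; lia.
exists p0, p1, p2; split=> //; first exact: lift u01 _ up1 cp1.
exact: lift u02 _ up2 cp2.
Qed.

Lemma Ywin_reduce n c : Ywin n.+1 c -> Ywin n (maj c).
Proof.
move=> [u0 [u1 [u2 [u01 u02 e0 e1 e2]]]].
pose G' t := board n t && maj c t.
pose G p := board n.+1 p && c p.
have edge p q : G p -> G q -> adj p q -> exists t, [/\ G' t, upright t p & upright t q].
  move=> /andP[bp cp] /andP[bq cq] pq.
  have [t [tp tq bt]] := adj_upright pq bp bq.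
  exists t; split=> //; rewrite /G' bt /=; apply: (upright_maj tp tq _ cp cq).
  by apply/negP => e; move: pq; rewrite /adj; lia.
have cover u v : conn G u v -> forall t, G' t -> upright t u ->
    exists t', [/\ G' t', upright t' v & conn G' t t'].
  elim=> [Gu|v1 v2 uv1 IH v12 Gv2] t Gt tu; first by exists t; split=> //; apply: conn0.
  have [t1 [Gt1 t1v cc]] := IH _ Gt tu.
  have [t2 [Gt2 t2v1 t2v2]] := edge _ _ (conn_r uv1) Gv2 v12.
  exists t2; split=> //; apply: (conn_adjeq cc) => //.
  move: t1v t2v1; rewrite /upright /adjeq /adj; lia.
(* A single site cannot touch all three sides of a board of size [n.+1], so the cluster has an edge
   at [u0], and an edge yields a majority cell. *)
have [t0 [Gt0 t0u]] : exists t, G' t /\ upright t u0.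
  have start v : conn G u0 v -> u0 = v \/ exists t, G' t /\ upright t u0.
    elim=> [_|v1 v2 uv1 [e|//] v12 Gv2]; first by left.
      right; rewrite -e in v12.
      by have [t [Gt t1 t2]] := edge _ _ (conn_l u01) Gv2 v12; exists t.
    by right.
  case: (start _ u01) => // e; case: (start _ u02) => // e'.
  by subst u1 u2; exfalso; lia.
have [t1 [Gt1 t1u c1]] := cover _ _ u01 _ Gt0 t0u.
have [t2 [Gt2 t2u c2]] := cover _ _ u02 _ Gt0 t0u.
exists t0, t1, t2; split=> //; move/andP: Gt0 => [+ _]; move/andP: Gt1 => [+ _];
  move/andP: Gt2 => [+ _]; move: t0u t1u t2u; rewrite /upright /board; lia.
Qed.

Lemma Ywin_dual n c : Ywin n c <-> ~ Ywin n (fun p => ~~ c p).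
Proof.
elim: n c => [|n IH] c; last first.
  have -> : Ywin n.+1 c <-> Ywin n (maj c).
    by split; [exact: Ywin_reduce|exact: Ywin_lift].
  have -> : Ywin n.+1 (fun p => ~~ c p) <-> Ywin n (fun t => ~~ maj c t).
    have <- : maj (fun p => ~~ c p) = fun t => ~~ maj c t.
      by apply: funext => t; exact: maj_negb.
    by split; [exact: Ywin_reduce|exact: Ywin_lift].
  exact: IH.
have Y0 (d : site -> bool) : Ywin 0 d <-> d (0, 0).
  split=> [[u0 [u1 [u2 [u01 u02 e0 e1 e2]]]]|d0].
    have /andP[b dd] := conn_l u01.
    suff -> : (0, 0) = u0 by [].
    by apply: site_eq => /=; move: b; rewrite /board; lia.
  by exists (0, 0), (0, 0), (0, 0); split=> //; apply: conn0; rewrite d0.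
by rewrite !Y0; case: (c _); split.
Qed.

Lemma Ywin_or n c : Ywin n c \/ Ywin n (fun p => ~~ c p).
Proof.
have [H|H] := pselect (Ywin n (fun p => ~~ c p)); first by right.
by left; apply/Ywin_dual.
Qed.

Lemma Ywin_exclusive n c : Ywin n c -> Ywin n (fun p => ~~ c p) -> False.
Proof. by move=> /Ywin_dual. Qed.

End GameOfY.

Lemma conn_line (G : site -> Prop) (p d : site) (m : nat) : adj (0, 0) d ->
  (forall k : nat, (k <= m)%N -> G (p.1 + k%:Z * d.1, p.2 + k%:Z * d.2)) ->
  conn G p (p.1 + m%:Z * d.1, p.2 + m%:Z * d.2).
Proof.
move=> ad; elim: m => [|m IH] Gk.
  have -> : (p.1 + 0%:Z * d.1, p.2 + 0%:Z * d.2) = p by apply: site_eq => /=; lia.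
  by have := Gk 0%N isT; rewrite (_ : (_, _) = p);
    [exact: conn0|apply: site_eq => /=; lia].
apply: connS (IH _) _ (Gk m.+1 _) => //; first by move=> k km; apply: Gk; lia.
by move: ad; rewrite /adj /=; lia.
Qed.

Lemma conn_hline (G : site -> Prop) (x1 x2 y : int) : x1 <= x2 ->
  (forall x, x1 <= x -> x <= x2 -> G (x, y)) -> conn G (x1, y) (x2, y).
Proof.
move=> le12 Gx.
have -> : (x2, y) = ((x1, y).1 + (absz (x2 - x1)%R)%:Z * ((1, 0) : site).1,
                    (x1, y).2 + (absz (x2 - x1)%R)%:Z * ((1, 0) : site).2).
  by apply: site_eq => /=; lia.
by apply: conn_line => // k kle /=; rewrite mulr0 addr0; apply: Gx; lia.
Qed.

Definition rows (lo hi : int) (p : site) : Prop := lo <= p.2 <= hi.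

(** * Duality for strips and rectangles *)

Section Strip.
Variables (G : site -> Prop) (lo hi B : int).
Hypotheses (lohi : lo <= hi) (B0 : 0 <= B).
Hypothesis GB : forall p, rows lo hi p -> B < `|p.1| -> G p.

(** The strip fills the bottom rows of a Y board and all rows above it count as closed. An open win
    joins the left side to the hypotenuse inside the strip. A closed win meets the left side above
    the strip, because the end of the strip is free, and crosses the strip on its way to the
    bottom. *)
Lemma strip_cross :
  (exists u v, [/\ conn (fun p => rows lo hi p /\ G p) u v, u.1 < - B & B < v.1]) \/
  (exists u v, [/\ conn (fun p => rows lo hi p /\ ~ G p) u v, u.2 = lo & v.2 = hi]).
Proof.
pose F (q : site) : site := (q.1 - B - 1, q.2 + lo).
pose n := absz (2 * B + 2 + hi - lo)%R.
pose c (q : site) := (q.2 <= hi - lo) && `[< G (F q) >].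
have Fadj p q : adj p q -> F p = F q \/ adj (F p) (F q).
  by right; move: H; rewrite /adj /=; lia.
case: (Ywin_or n c).
  move=> [u0 [u1 [u2 [u01 u02 e0 e1 e2]]]]; left; exists (F u0), (F u2).
  split; last 2 first.
  - by rewrite /F /= e0; lia.
  - have /andP[_ /andP[u2h _]] := conn_r u02.
    by rewrite /F /=; move: e2; rewrite /n; lia.
  apply: conn_map u02 => // p /andP[/and3P[_ p2 _] /andP[ph /asboolP Gp]].
  by split=> //; rewrite /rows /=; lia.
move=> H; right.
have [u0 [u1 [u2 [u01 u02 e0 e1 e2]]]] := H.
have nc p : ~~ c p -> p.2 <= hi - lo -> ~ G (F p).
  by rewrite /c => + ph; rewrite ph /= => /asboolPn.
have u0h : hi - lo < u0.2.
  rewrite ltNge; apply/negP => u0h; have /andP[b0 c0] := conn_l u01.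
  apply: (nc _ c0 u0h); apply: GB; first by move: b0; rewrite /board /rows /=; lia.
  by rewrite /F /= e0; lia.
have := conn_exit (P := fun p : site => p.2 <= hi - lo) (conn_sym u01).
rewrite e1 => /(_ ltac:(lia)) [/conn_r[_]|]; first lia.
move=> [a [b [u1a ab Gb bh _]]].
exists (F u1), (F a); split; last 2 first.
- by rewrite /F /= e1; lia.
- by have [_ +] := conn_r u1a; move: ab bh; rewrite /F /adj /=; lia.
apply: conn_map u1a => // p [/andP[/and3P[_ p2 _] cp] ph]; split; last exact: nc.
by rewrite /rows /=; lia.
Qed.

(** Both crossings would extend to wins on one board: the horizontal one through the free ends and
    down the hypotenuse to a corner on the bottom side, the vertical one through the closed row just
    above the strip. *)
Lemma strip_exclusive u v w z :
  conn (fun p => rows lo hi p /\ G p) u v -> u.1 < - B -> B < v.1 ->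
  conn (fun p => rows lo hi p /\ ~ G p) w z -> w.2 = lo -> z.2 = hi -> False.
Proof.
move=> uv uB vB wz wlo zhi.
have [M uvM] := conn_bounded uv.
(* The board has to contain the whole horizontal path, which may wander far into the free ends. *)
pose C := B + `|M|.
pose F (q : site) : site := (q.1 + C + 1, q.2 - lo).
pose F' (q : site) : site := (q.1 - C - 1, q.2 + lo).
pose n := absz (2 * C + 2 + hi - lo)%R.
pose c (q : site) := (q.2 <= hi - lo) && `[< G (F' q) >].
have FK p : F' (F p) = p by apply: site_eq; rewrite /= ; lia.
have Fadj p q : adj p q -> F p = F q \/ adj (F p) (F q).
  by right; move: H; rewrite /adj /=; lia.
have cout x y : 0 <= y -> y <= hi - lo -> (x < C + 1 - B) || (C + B + 1 < x) -> c (x, y).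
  move=> y0 yh xB; rewrite /c /= yh /=; apply/asboolP; apply: GB.
    by rewrite /rows /=; lia.
  by rewrite /F' /=; lia.
have [[ru Gu] uM] := conn_l uvM; have [[rv Gv] vM] := conn_r uvM.
apply: (@Ywin_exclusive n c).
  pose K (p : site) := board n p && c p.
  have Kuv : conn K (F u) (F v).
    apply: conn_map uvM => // p [[rp Gp] pM].
    rewrite /K /c FK asboolT // andbT /board /F /=; move: rp; rewrite /rows /n /C; lia.
  have Ku : conn K (0, u.2 - lo) (F u).
    apply: conn_hline; first by rewrite /C; lia.
    move=> x x0 xu; rewrite /K /board /= cout ?andbT; move: ru; rewrite /rows /n /C; lia.
  have Kv : conn K (F v) (n%:Z - (v.2 - lo), v.2 - lo).
    apply: conn_hline; first by move: rv; rewrite /rows /n /C; lia.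
    move=> x x0 xu; rewrite /K /board /= cout ?andbT; move: rv; rewrite /rows /n /C; lia.
  have Kn : conn K (n%:Z - (v.2 - lo), v.2 - lo) (n%:Z, 0).
    have -> : (n%:Z, 0) = ((n%:Z - (v.2 - lo), v.2 - lo).1 + (absz (v.2 - lo)%R)%:Z * ((1, -1) : site).1,
       (n%:Z - (v.2 - lo), v.2 - lo).2 + (absz (v.2 - lo)%R)%:Z * ((1, -1) : site).2) :> site.
      by apply: site_eq => /=; move: rv; rewrite /rows; lia.
    apply: conn_line => // k kle /=.
    rewrite /K /board /= cout ?andbT; move: rv; rewrite /rows /n /C; lia.
  have Kall : conn K (0, u.2 - lo) (n%:Z, 0).
    exact: conn_trans (conn_trans Ku Kuv) (conn_trans Kv Kn).
  by exists (0, u.2 - lo), (n%:Z, 0), (n%:Z, 0); split=> //=; lia.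
pose K (p : site) := board n p && ~~ c p.
have Bp p : rows lo hi p -> ~ G p -> `|p.1| <= B.
  by move=> rp nGp; rewrite leNgt; apply/negP => pB; apply: nGp; apply: GB.
have Kwz : conn K (F w) (F z).
  apply: conn_map wz => // p [rp nGp]; have := Bp _ rp nGp.
  rewrite /K /c FK asboolF // andbF andbT /board /F /=; move: rp; rewrite /rows /n /C; lia.
have [rz nGz] := conn_r wz; have zB := Bp _ rz nGz.
have top x : 0 <= x -> x + (hi - lo + 1) <= n%:Z -> K (x, hi - lo + 1).
  move=> x0 xn; rewrite /K /board /c /= (_ : (_ <= hi - lo) = false) //=; lia.
pose t : site := ((F z).1, hi - lo + 1).
have Kt : K t by apply: top; rewrite /F /n /C /=; lia.
have Kwt : conn K (F w) t.
  by apply: (connS Kwz) => //; rewrite /adj /t /F /= zhi; lia.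
have Kl : conn K (0, hi - lo + 1) t.
  apply: conn_hline; first by rewrite /F /C /=; lia.
  move=> x x0 xu; apply: top => //; move: xu; rewrite /F /n /C /=; lia.
have Kr : conn K t (n%:Z - (hi - lo + 1), hi - lo + 1).
  apply: conn_hline; first by rewrite /F /n /C /=; lia.
  move=> x x0 xu; apply: top; move: x0 xu; rewrite /F /n /C /=; lia.
exists (0, hi - lo + 1), (F w), (n%:Z - (hi - lo + 1), hi - lo + 1).
split=> //=; last lia.
- by apply: conn_trans Kl (conn_sym Kwt).
- exact: conn_trans Kl Kr.
- by rewrite wlo; lia.
Qed.

End Strip.

(* [sh true] is twice the horizontal coordinate of a site in the plane; level
   sets of [sh false] are the lattice lines parallel to exp(i pi/3). *)
Definition sh (e : bool) (p : site) : int := 2 * p.1 + (if e then p.2 else 0).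

(* The sites beyond [a] and [b] are free in [HC]: this makes the crossing
   events monotone in the region without any trimming of paths. *)
Definition HCz (e : bool) (a b lo hi : int) (G : site -> Prop) (p : site) : Prop :=
  rows lo hi p /\ (G p \/ sh e p < a \/ b < sh e p).

Definition HC e a b lo hi (G : site -> Prop) : Prop :=
  exists u v, [/\ conn (HCz e a b lo hi G) u v, sh e u < a & b < sh e v].

Definition VCz (e : bool) (a b lo hi : int) (G : site -> Prop) (p : site) : Prop :=
  [/\ rows lo hi p, a <= sh e p <= b & G p].

Definition VC e a b lo hi (G : site -> Prop) : Prop :=
  exists u v, [/\ conn (VCz e a b lo hi G) u v, u.2 = lo & v.2 = hi].

Section Crossings.
Implicit Types (e : bool) (a b lo hi : int) (G : site -> Prop).

Lemma HC_sub e a b lo hi G G' : (forall p, VCz e a b lo hi G p -> G' p) ->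
  HC e a b lo hi G -> HC e a b lo hi G'.
Proof.
move=> GG' [u [v [uv ua vb]]]; exists u, v; split=> //.
apply: conn_mono uv => p [rp H]; split=> //.
case: (ltP (sh e p) a) => pa; first by right; left.
case: (ltP b (sh e p)) => pb; first by right; right.
by case: H => [Gp|]; [left; apply: GG'; split=> //; lia|lia].
Qed.

Lemma VC_sub e a b lo hi G G' : (forall p, VCz e a b lo hi G p -> G' p) ->
  VC e a b lo hi G -> VC e a b lo hi G'.
Proof.
move=> GG' [u [v [uv ua vb]]]; exists u, v; split=> //.
by apply: conn_mono uv => p Vp; split; [by case: Vp|by case: Vp|exact: GG'].
Qed.

Lemma VC_widen e a b a' b' lo hi G : a' <= a -> b <= b' ->
  VC e a b lo hi G -> VC e a' b' lo hi G.
Proof.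
move=> aa bb [u [v [uv ua vb]]]; exists u, v; split=> //.
by apply: conn_mono uv => p [rp pab Gp]; split=> //; lia.
Qed.

Lemma HC_or_VC e a b lo hi G : lo <= hi ->
  HC e a b lo hi G \/ VC e a b lo hi (fun p => ~ G p).
Proof.
move=> lohi; pose B := `|a| + `|b| + `|lo| + `|hi|.
pose G' p := G p \/ sh e p < a \/ b < sh e p.
have B0 : 0 <= B by rewrite /B; lia.
have GB p : rows lo hi p -> B < `|p.1| -> G' p.
  by rewrite /rows /G' /B /sh; case: (e) => ? ?; right; lia.
case: (strip_cross lohi B0 GB) => [[u [v [uv uB vB]]]|[u [v [uv uB vB]]]].
  left; exists u, v; have [ru _] := conn_l uv; have [rv _] := conn_r uv.
  by split; [exact: uv|move: ru uB|move: rv vB]; rewrite /rows /B /sh; case: (e); lia.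
right; exists u, v; split=> //; apply: conn_mono uv => p [rp nG'].
split=> //; last by move=> Gp; apply: nG'; left.
apply/andP; split; rewrite leNgt; apply/negP => h; apply: nG'; right; by [left|right].
Qed.

Lemma HC_VC_exclusive e a b lo hi G : lo <= hi ->
  HC e a b lo hi G -> VC e a b lo hi (fun p => ~ G p) -> False.
Proof.
move=> lohi [u [v [uv ua vb]]] [w [z [wz wlo zhi]]].
pose B := `|a| + `|b| + `|lo| + `|hi|.
pose G' p := G p \/ sh e p < a \/ b < sh e p.
have B0 : 0 <= B by rewrite /B; lia.
have GB p : rows lo hi p -> B < `|p.1| -> G' p.
  by rewrite /rows /G' /B /sh; case: (e) => ? ?; right; lia.
have [ru _] := conn_l uv; have [rv _] := conn_r uv.
pose x1 := Num.min u.1 (- B - 1); pose x2 := Num.max v.1 (B + 1).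
have C1 : conn (fun p => rows lo hi p /\ G' p) (x1, u.2) u.
  rewrite (_ : u = (u.1, u.2)); last by case: (u).
  apply: conn_hline => [|x xl xr /=]; first by rewrite /x1; lia.
  by split=> //; right; left; move: ua; rewrite /sh /=; case: (e); lia.
have C2 : conn (fun p => rows lo hi p /\ G' p) v (x2, v.2).
  rewrite (_ : v = (v.1, v.2)); last by case: (v).
  apply: conn_hline => [|x xl xr /=]; first by rewrite /x2; lia.
  by split=> //; right; right; move: vb xl; rewrite /sh /=; case: (e); lia.
apply: (strip_exclusive lohi B0 GB (conn_trans C1 (conn_trans uv C2)) _ _ _ wlo zhi).
- by rewrite /= /x1; lia.
- by rewrite /= /x2; lia.
- apply: conn_mono wz => p [rp pab nGp]; split=> // -[//|]; lia.
Qed.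

Lemma sh_adj e p q : adj p q -> `|sh e p - sh e q| <= 2.
Proof. by rewrite /adj /sh; case: e; lia. Qed.

(** The slack of one unit at both ends is there because a step may change [sh] by 2. *)
Lemma HC_trim e a b lo hi G : a < b -> HC e a b lo hi G ->
  exists u v, [/\ conn (VCz e a b lo hi G) u v, sh e u <= a + 1 & b - 1 <= sh e v].
Proof.
move=> ab [u [v [uv ua vb]]].
have [/conn_r[_ /=]|[a1 [b1 [ua1 a1b1 _ /= nb _]]]] :=
  conn_exit (P := fun p => sh e p <= b) uv ltac:(lia); first lia.
have la1 := sh_adj e a1b1.
have [/conn_r[_ /=]|[a2 [b2 [a12 a2b2 _ /= na _]]]] :=
  conn_exit (P := fun p => a <= sh e p) (conn_sym ua1) ltac:(lia); first lia.
have la2 := sh_adj e a2b2.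
exists a2, a1; split; [|lia|lia].
apply: conn_mono (conn_sym a12) => p [[[rp H] pb] pa].
by split=> //; [lia|case: H => //; lia].
Qed.

(** Otherwise the cluster of [u], prolonged by one free site at each end, would be a horizontal
    crossing that avoids [C], which duality forbids. *)
Lemma cross_meet e a b lo hi G C u v : lo <= hi ->
  conn (VCz e a b lo hi G) u v -> sh e u <= a + 1 -> b - 1 <= sh e v ->
  VC e a b lo hi C -> exists p, conn (VCz e a b lo hi G) u p /\ C p.
Proof.
move=> lohi uv ua vb VCC; apply: contrapT => nex.
have [ru _ _] := conn_l uv; have [rv _ _] := conn_r uv.
apply: (@HC_VC_exclusive e a b lo hi (fun p => ~ C p)) => //; last first.
  by apply: VC_sub VCC => p [_ _ Cp] nC.
exists (u.1 - 1, u.2), (v.1 + 1, v.2).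
have su : sh e (u.1 - 1, u.2) < a by move: ua; rewrite /sh /=; case: (e); lia.
have sv : b < sh e (v.1 + 1, v.2) by move: vb; rewrite /sh /=; case: (e); lia.
split=> //.
have mid : conn (HCz e a b lo hi (fun p => ~ C p)) u v.
  apply: conn_mono (conn_cluster uv) => p up; have [rp pab Gp] := conn_r up.
  by split=> //; left => Cp; apply: nex; exists p.
apply: (@connS _ _ v); last by split; [|right; right].
  apply: conn_trans (mid); apply: connS (conn0 _) _ (conn_l mid).
    by split; [|right; left].
  by rewrite /adj /=; lia.
by rewrite /adj /=; lia.
Qed.

End Crossings.

(** * Fair coin flips *)

Section CoinFlips.
Variables (R : realType) (T : eqType).
Implicit Types (w : T -> bool) (D : seq T) (F G : (T -> bool) -> R) (v : T).

Definition upd w v b : T -> bool := fun u => if u == v then b else w u.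

Definition avg1 v F : (T -> bool) -> R :=
  fun w => (F (upd w v true) + F (upd w v false)) / 2.

Definition Avg D F := foldr avg1 F D.

Definition supp D F := forall w w', {in D, w =1 w'} -> F w = F w'.

Lemma upd_comm w u v a b : u != v -> upd (upd w u a) v b = upd (upd w v b) u a.
Proof.
move=> uv; apply: funext => x; rewrite /upd.
by case: (eqVneq x v) => [->|//]; rewrite eq_sym (negbTE uv).
Qed.

Lemma upd_upd w v a b : upd (upd w v a) v b = upd w v b.
Proof. by apply: funext => x; rewrite /upd; case: eqP. Qed.

Lemma avg1_comm u v F : avg1 u (avg1 v F) = avg1 v (avg1 u F).
Proof.
case: (eqVneq u v) => [->//|uv]; apply: funext => w.
rewrite /avg1 !(@upd_comm w u v) //; lra.
Qed.

Lemma Avg_avg1 D v F : Avg D (avg1 v F) = avg1 v (Avg D F).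
Proof. by elim: D => //= u D ->; rewrite avg1_comm. Qed.

Lemma Avg_comm D D' F : Avg D (Avg D' F) = Avg D' (Avg D F).
Proof. by elim: D' => //= v D' <-; rewrite Avg_avg1. Qed.

Lemma Avg_cat D D' F : Avg (D ++ D') F = Avg D (Avg D' F).
Proof. by rewrite /Avg foldr_cat. Qed.

Lemma Avg_cst D (c : R) : Avg D (fun=> c) = fun=> c.
Proof. by elim: D => //= v D ->; apply: funext => w; rewrite /avg1; lra. Qed.

Lemma supp_sub D D' F : {subset D <= D'} -> supp D F -> supp D' F.
Proof. by move=> DD' sF w w' ww'; apply: sF => v /DD'; exact: ww'. Qed.

Lemma supp_avg1 D v F : supp (v :: D) F -> supp D (avg1 v F).
Proof.
move=> sF w w' ww'; rewrite /avg1; congr ((_ + _) / _); apply: sF => u;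
by rewrite inE /upd; case: eqP => //= _; exact: ww'.
Qed.

Lemma supp_Avg D E F : supp (D ++ E) F -> supp E (Avg D F).
Proof.
elim: D E => //= v D IH E sF; apply: supp_avg1; apply: IH; apply: supp_sub sF => u.
by rewrite !(inE, mem_cat) => /or3P[|->|->]; rewrite ?orbT // => ->; rewrite orbT.
Qed.

Lemma Avg_supp_cst D F w w' : supp D F -> Avg D F w = Avg D F w'.
Proof. by move=> sF; apply: (@supp_Avg D [::]); rewrite ?cats0. Qed.

Lemma Avg_indep D D' F w w' : supp D F -> supp D' F -> Avg D F w = Avg D' F w'.
Proof.
move=> sD sD'.
have e1 : Avg D F = fun=> Avg D F w by apply: funext => x; apply: Avg_supp_cst.
have e2 : Avg D' F = fun=> Avg D' F w' by apply: funext => x; apply: Avg_supp_cst.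
have := Avg_comm D D' F; rewrite e1 e2 !Avg_cst => /(congr1 (fun f => f w)) /= ->.
by [].
Qed.

Definition fsupp F := exists D, supp D F.

(** Successive averaging over a finite support gives the expectation under independent fair flips of
    an infinite set of sites without constructing a product measure. By [Avg_indep] the choice of
    the support is irrelevant; functions without one get the default 0. *)
Definition Ex F : R :=
  if pselect (fsupp F) is left H then Avg (projT1 (cid H)) F (fun=> false) else 0.

Lemma ExE D F w : supp D F -> Ex F = Avg D F w.
Proof.
move=> sD; rewrite /Ex; case: pselect => [H|nH]; last by exfalso; apply: nH; exists D.
by apply: Avg_indep => //; exact: projT2 (cid H).
Qed.

Lemma fsupp2 F G : fsupp F -> fsupp G -> exists D, supp D F /\ supp D G.
Proof.
move=> [D sD] [D' sD']; exists (D ++ D').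
by split; [apply: supp_sub sD|apply: supp_sub sD'] => v; rewrite mem_cat => ->; rewrite ?orbT.
Qed.

Lemma fsupp_op (op : R -> R -> R) F G : fsupp F -> fsupp G -> fsupp (fun w => op (F w) (G w)).
Proof.
move=> fF fG; have [D [sF sG]] := fsupp2 fF fG; exists D => w w' ww'.
by rewrite (sF _ _ ww') (sG _ _ ww').
Qed.

Lemma fsupp_cst (c : R) : fsupp (fun=> c).
Proof. by exists [::]. Qed.

Lemma Ex_cst (c : R) : Ex (fun=> c) = c.
Proof. by rewrite (@ExE [::] _ (fun=> false)). Qed.

Lemma Avg_le D F G : (forall w, F w <= G w) -> forall w, Avg D F w <= Avg D G w.
Proof.
move=> FG; elim: D => //= v D IH w; rewrite /avg1.
by have := IH (upd w v true); have := IH (upd w v false); lra.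
Qed.

Lemma Ex_le F G : fsupp F -> fsupp G -> (forall w, F w <= G w) -> Ex F <= Ex G.
Proof.
move=> fF fG FG; have [D [sF sG]] := fsupp2 fF fG.
by rewrite !(@ExE D _ (fun=> false)) //; apply: Avg_le.
Qed.

Lemma Avg_lin D F G (a b : R) w :
  Avg D (fun w => a * F w + b * G w) w = a * Avg D F w + b * Avg D G w.
Proof. by elim: D w => //= v D IH w; rewrite /avg1 !IH; lra. Qed.

Lemma Ex_lin F G (a b : R) : fsupp F -> fsupp G ->
  Ex (fun w => a * F w + b * G w) = a * Ex F + b * Ex G.
Proof.
move=> fF fG; have [D [sF sG]] := fsupp2 fF fG.
rewrite !(@ExE D _ (fun=> false)) ?Avg_lin // => w w' ww'.
by rewrite (sF _ _ ww') (sG _ _ ww').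
Qed.

Lemma Ex_sum (I : Type) (r : seq I) (F : I -> (T -> bool) -> R) :
  (forall i, fsupp (F i)) ->
  fsupp (fun w => \sum_(i <- r) F i w) /\
  Ex (fun w => \sum_(i <- r) F i w) = \sum_(i <- r) Ex (F i).
Proof.
move=> fF; elim: r => [|i r [f IH]].
  have -> : (fun w => \sum_(i <- [::]) F i w) = fun=> 0 :> R.
    by apply: funext => w; rewrite big_nil.
  by rewrite big_nil Ex_cst; split=> //; apply: fsupp_cst.
have -> : (fun w => \sum_(j <- i :: r) F j w) = fun w => 1 * F i w + 1 * \sum_(j <- r) F j w.
  by apply: funext => w; rewrite big_cons !mul1r.
by rewrite Ex_lin // IH big_cons !mul1r; split=> //; apply: (fsupp_op (fun a b => _ * a + _ * b)).
Qed.

Definition incr F := forall w w', (forall v, w v -> w' v) -> F w <= F w'.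

Lemma incr_avg1 v F : incr F -> incr (avg1 v F).
Proof.
move=> iF w w' ww'; rewrite /avg1.
have h b : F (upd w v b) <= F (upd w' v b).
  by apply: iF => u; rewrite /upd; case: eqP => // _; exact: ww'.
by have := h true; have := h false; lra.
Qed.

Lemma incr_Avg D F : incr F -> incr (Avg D F).
Proof. by move=> iF; elim: D => //= v D; apply: incr_avg1. Qed.

Lemma Avg_harris D F G w : incr F -> incr G ->
  Avg D F w * Avg D G w <= Avg D (fun w => F w * G w) w.
Proof.
move=> iF iG; elim: D w => //= v D IH w; rewrite /avg1.
have h F' : incr F' -> Avg D F' (upd w v false) <= Avg D F' (upd w v true).
  by move=> iF'; apply: incr_Avg => // u; rewrite /upd; case: eqP.
have h1 := h _ iF; have h2 := h _ iG.
have := IH (upd w v true); have := IH (upd w v false).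
set a := Avg D F _ in h1 *; set b := Avg D F _ in h1 *.
set c := Avg D G _ in h2 *; set d := Avg D G _ in h2 *.
set x := Avg D _ _; set y := Avg D _ _ => h3 h4.
(* The correlation inequality for a single flip; induction on the list of sites does the rest. *)
have : 0 <= (b - a) * (d - c) by apply: mulr_ge0; lra.
lra.
Qed.

Lemma Ex_harris F G : fsupp F -> fsupp G -> incr F -> incr G ->
  Ex F * Ex G <= Ex (fun w => F w * G w).
Proof.
move=> fF fG iF iG; have [D [sF sG]] := fsupp2 fF fG.
rewrite !(@ExE D _ (fun=> false)) //; first exact: Avg_harris.
by move=> w w' ww'; rewrite (sF _ _ ww') (sG _ _ ww').
Qed.

Lemma Avg_out D D' F G w : supp D' G -> (forall v, v \in D -> v \notin D') ->
  Avg D (fun w => F w * G w) w = Avg D F w * G w.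
Proof.
move=> sG; elim: D w => //= v D IH w DD'; rewrite /avg1 !IH; last 2 first.
- by move=> u uD; apply: DD'; rewrite inE uD orbT.
- by move=> u uD; apply: DD'; rewrite inE uD orbT.
have G_ b : G (upd w v b) = G w.
  apply: sG => u uD'; rewrite /upd; case: eqP => // uv.
  by have := DD' v (mem_head _ _); rewrite -uv uD'.
by rewrite !G_; lra.
Qed.

Lemma Ex_indep D D' F G : supp D F -> supp D' G -> (forall v, v \in D -> v \notin D') ->
  Ex (fun w => F w * G w) = Ex F * Ex G.
Proof.
move=> sF sG DD'.
rewrite (@ExE (D' ++ D) _ (fun=> false)); last first.
  move=> w w' ww'; congr (_ * _); [apply: sF|apply: sG] => v vD; apply: ww';
  by rewrite mem_cat vD ?orbT.
rewrite Avg_cat (_ : Avg D _ = fun w => Avg D F w * G w); last first.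
  by apply: funext => w; apply: Avg_out sG DD'.
rewrite (_ : (fun w => _) = fun w => Ex F * G w + 0 * G w); last first.
  by apply: funext => w; rewrite mul0r addr0 -(ExE _ sF).
by rewrite Avg_lin mul0r addr0 -(ExE _ sG).
Qed.

Lemma Avg_neg D F w : Avg D (fun w => F (fun v => ~~ w v)) w = Avg D F (fun v => ~~ w v).
Proof.
elim: D w => //= v D IH w; rewrite /avg1 !IH addrC; congr ((_ + _) / _);
by congr (Avg D F _); apply: funext => u; rewrite /upd; case: eqP.
Qed.

Lemma Ex_neg F : fsupp F -> Ex (fun w => F (fun v => ~~ w v)) = Ex F.
Proof.
move=> [D sF]; rewrite (@ExE D _ (fun=> true)); last first.
  by move=> w w' ww'; apply: sF => v vD; rewrite ww'.
by rewrite Avg_neg -(ExE _ sF).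
Qed.

End CoinFlips.

Section Transport.
Variables (R : realType) (T T' : eqType) (g : T -> T').
Hypothesis g_inj : injective g.

Lemma Avg_map D (F : (T -> bool) -> R) w :
  Avg (map g D) (fun w => F (w \o g)) w = Avg D F (w \o g).
Proof.
elim: D w => //= v D IH w; rewrite /avg1 !IH; congr ((_ + _) / _);
by congr (Avg D F _); apply: funext => u; rewrite /upd /= (inj_eq g_inj).
Qed.

Lemma supp_map D (F : (T -> bool) -> R) :
  supp D F -> supp (map g D) (fun w => F (w \o g)).
Proof. by move=> sF w w' ww'; apply: sF => v vD /=; apply: ww'; apply: map_f. Qed.

Lemma fsupp_map (F : (T -> bool) -> R) : fsupp F -> fsupp (fun w => F (w \o g)).
Proof. by move=> [D sF]; exists (map g D); apply: supp_map. Qed.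

Lemma Ex_map (F : (T -> bool) -> R) : fsupp F -> Ex (fun w => F (w \o g)) = Ex F.
Proof.
move=> [D sF].
by rewrite (ExE (fun=> false) (supp_map sF)) Avg_map -(ExE _ sF).
Qed.

End Transport.

Section FiniteCoinFlips.
Variables (R : realType) (V : finType).
Implicit Types (F : (V -> bool) -> R).

Lemma supp_fin F : supp (enum V) F.
Proof. by move=> w w' ww'; congr F; apply: funext => v; apply: ww'; rewrite mem_enum. Qed.

Lemma fsupp_fin F : fsupp F.
Proof. by exists (enum V); exact: supp_fin. Qed.

Definition fupd (w : {ffun V -> bool}) v b : {ffun V -> bool} :=
  [ffun u => if u == v then b else w u].

Lemma fupdE w v b : fupd w v b = upd w v b :> (V -> bool).
Proof. by apply: funext => u; rewrite ffunE. Qed.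

Lemma sum_avg1 F v : \sum_(w : {ffun V -> bool}) avg1 v F w = \sum_(w : {ffun V -> bool}) F w.
Proof.
pose fl (w : {ffun V -> bool}) := fupd w v (~~ w v).
have flK : involutive fl.
  move=> w; apply/ffunP => u; rewrite !ffunE; case: eqP => [->|//].
  by rewrite !eqxx negbK.
have e (w : {ffun V -> bool}) : F (upd w v true) + F (upd w v false) = F w + F (fl w).
  have id b : w v = b -> upd w v b = w :> (V -> bool).
    by move=> <-; apply: funext => u; rewrite /upd; case: eqP => // ->.
  rewrite /fl fupdE; case wv: (w v); first by rewrite (id _ wv).
  by rewrite (id _ wv) addrC.
rewrite (eq_bigr (fun w : {ffun V -> bool} => (F w + F (fl w)) / 2)); last first.
  by move=> w _; rewrite /avg1 e.
rewrite -mulr_suml big_split /= [X in _ + X](_ : _ = \sum_(w : {ffun V -> bool}) F w).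
  by set S := \sum_w _; lra.
by rewrite [RHS](reindex_inj (inv_inj flK)).
Qed.

Lemma Ex_fin F : Ex F = (\sum_(w : {ffun V -> bool}) F w) / 2 ^+ #|V|.
Proof.
have S D : \sum_(w : {ffun V -> bool}) Avg D F w = \sum_(w : {ffun V -> bool}) F w.
  by elim: D => //= v D <-; rewrite sum_avg1.
rewrite -(S (enum V)) (eq_bigr (fun=> Ex F)); last first.
  by move=> w _; rewrite (ExE w (supp_fin F)).
by rewrite sumr_const card_ffun card_bool -[X in X / _]mulr_natr natrX mulfK ?expf_neq0 ?pnatr_eq0 //.
Qed.

End FiniteCoinFlips.

Section Events.
Variables (R : realType) (T : eqType).
Local Notation event := ((T -> bool) -> Prop).
Implicit Types (A B : event) (D : seq T).

Definition ind A (w : T -> bool) : R := (`[< A w >])%:R.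

Definition Pr A : R := Ex (ind A).

Lemma PrE A : Pr A = Ex (ind A). Proof. by []. Qed.

Lemma Pr_ext A B : (forall w, A w <-> B w) -> Pr A = Pr B.
Proof. by move=> AB; congr Pr; apply: funext => w; apply: propext. Qed.

Definition esupp D A := forall w w' : T -> bool, {in D, w =1 w'} -> A w -> A w'.

Definition fes A := exists D, esupp D A.

Definition einc A := forall w w' : T -> bool, (forall v, w v -> w' v) -> A w -> A w'.

Lemma esuppP D A : esupp D A -> supp D (ind A).
Proof.
move=> sA w w' ww'; rewrite /ind; congr (nat_of_bool _)%:R.
by apply: asbool_equiv_eq; split; apply: sA => // v vD; rewrite ww'.
Qed.

Lemma fesP A : fes A -> fsupp (ind A).
Proof. by move=> [D sA]; exists D; apply: esuppP. Qed.

Lemma fes_not A : fes A -> fes (fun w => ~ A w).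
Proof.
move=> [D sA]; exists D => w w' ww' nA A'; apply: nA.
by apply: sA A' => v vD; rewrite ww'.
Qed.

Lemma fes_and A B : fes A -> fes B -> fes (fun w => A w /\ B w).
Proof.
move=> [D sA] [D' sB]; exists (D ++ D') => w w' ww' [Aw Bw]; split.
- by apply: sA Aw => v vD; apply: ww'; rewrite mem_cat vD.
- by apply: sB Bw => v vD; apply: ww'; rewrite mem_cat vD orbT.
Qed.

Lemma fes_neg A : fes A -> fes (fun w => A (fun v => ~~ w v)).
Proof. by move=> [D sA]; exists D => w w' ww'; apply: sA => v vD; rewrite ww'. Qed.

Lemma ind_and A B w : ind (fun w => A w /\ B w) w = ind A w * ind B w.
Proof.
rewrite /ind; case: (pselect (A w)) => a; case: (pselect (B w)) => b.
- by rewrite !asboolT ?mulr1.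
- by rewrite (@asboolT (A w)) // !asboolF ?mulr0 // => -[].
- by rewrite (@asboolT (B w)) // !asboolF ?mul0r // => -[].
- by rewrite !asboolF ?mul0r // => -[].
Qed.

Lemma ind_not A w : ind (fun w => ~ A w) w = 1 - ind A w.
Proof.
rewrite /ind; case: (pselect (A w)) => a.
- by rewrite asboolF ?asboolT ?subrr // => /(_ a).
- by rewrite asboolT // asboolF ?subr0.
Qed.

Lemma ind_ge0 A w : 0 <= ind A w.
Proof. by rewrite /ind ler0n. Qed.

Lemma ind_le A B w : (A w -> B w) -> ind A w <= ind B w.
Proof.
rewrite /ind ler_nat => AB; case: (pselect (A w)) => a; last by rewrite asboolF.
by rewrite !asboolT //; exact: AB.
Qed.

Lemma Pr_le A B : fes A -> fes B -> (forall w, A w -> B w) -> Pr A <= Pr B.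
Proof. by move=> fA fB AB; apply: Ex_le; [exact: fesP|exact: fesP|move=> w; apply/ind_le/AB]. Qed.

Lemma Pr_ge0 A : fes A -> 0 <= Pr A.
Proof.
move=> fA; rewrite -[0](@Ex_cst R T); apply: Ex_le; [exact: fsupp_cst|exact: fesP|].
by move=> w; apply: ind_ge0.
Qed.

Lemma Pr_not A : fes A -> Pr (fun w => ~ A w) = 1 - Pr A.
Proof.
move=> fA; rewrite /Pr (_ : ind _ = fun w => 1 * (fun=> 1) w + (-1) * ind A w).
  by rewrite Ex_lin ?Ex_cst ?mul1r ?mulN1r //; [exact: fsupp_cst|exact: fesP].
by apply: funext => w; rewrite ind_not mul1r mulN1r.
Qed.

Lemma Pr_le1 A : fes A -> Pr A <= 1.
Proof. by move=> fA; have := Pr_ge0 (fes_not fA); rewrite Pr_not // subr_ge0. Qed.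

Lemma Pr_neg A : fes A -> Pr (fun w => A (fun v => ~~ w v)) = Pr A.
Proof. by move=> fA; rewrite /Pr -(Ex_neg (fesP fA)). Qed.

Lemma Pr_harris A B : fes A -> fes B -> einc A -> einc B ->
  Pr A * Pr B <= Pr (fun w => A w /\ B w).
Proof.
move=> fA fB iA iB; rewrite /Pr.
rewrite (_ : ind (fun w => A w /\ B w) = fun w => ind A w * ind B w).
  apply: Ex_harris; [exact: fesP|exact: fesP| |].
  - by move=> w w' ww'; rewrite /ind ler_nat; have := iA _ _ ww';
    case: (pselect (A w)) => a; [rewrite !asboolT //; exact: (iA _ _ ww')|rewrite asboolF].
  - by move=> w w' ww'; rewrite /ind ler_nat; have := iB _ _ ww';
    case: (pselect (B w)) => a; [rewrite !asboolT //; exact: (iB _ _ ww')|rewrite asboolF].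
by apply: funext => w; rewrite ind_and.
Qed.

Lemma Pr_indep D D' A B : esupp D A -> esupp D' B -> (forall v, v \in D -> v \notin D') ->
  Pr (fun w => A w /\ B w) = Pr A * Pr B.
Proof.
move=> sA sB DD'; rewrite /Pr -(Ex_indep (esuppP sA) (esuppP sB) DD').
by congr Ex; apply: funext => w; rewrite ind_and.
Qed.

End Events.

Section EventsTransport.
Variables (R : realType) (T T' : eqType) (g : T -> T').
Hypothesis g_inj : injective g.

Lemma fes_map (A : (T -> bool) -> Prop) : fes A -> fes (fun w => A (w \o g)).
Proof.
move=> [D sA]; exists (map g D) => w w' ww'; apply: sA => v vD /=.
by apply: ww'; apply: map_f.
Qed.

Lemma Pr_map (A : (T -> bool) -> Prop) : fes A -> Pr R (fun w => A (w \o g)) = Pr R A.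
Proof. by move=> fA; rewrite /Pr -(Ex_map g_inj (fesP R fA)). Qed.

End EventsTransport.

Section Exploration.
Variables (R : realType) (T : choiceType).
Implicit Types (w : T -> bool) (D : seq T).

Definition mix (K : T -> bool) (w w' : T -> bool) : T -> bool :=
  fun v => if K v then w v else w' v.

Definition ext D (x : seq_sub D -> bool) : T -> bool :=
  fun t => if insub t is Some v then x v else false.

Lemma Ex_ext D (F : (T -> bool) -> R) : supp D F -> Ex F = Ex (fun x => F (@ext D x)).
Proof.
move=> sF; rewrite -(@Ex_map _ _ _ (val : seq_sub D -> T) val_inj); last exact: fsupp_fin.
congr Ex; apply: funext => w; apply: sF => v vD; rewrite /ext.
by case: insubP => [u _ <-//|]; rewrite vD.
Qed.

Variables (K : (T -> bool) -> T -> bool) (DK : seq T).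
Hypothesis K_supp : forall w w', {in DK, w =1 w'} -> K w = K w'.
Hypothesis K_stop : forall w w', (forall v, K w v -> w v = w' v) -> K w' = K w.

(* Refreshing the flips outside a stopping set: exchanging the two
   configurations outside [K w] is an involution of the set of pairs. *)
Lemma Ex_mix (F : (T -> bool) -> R) : fsupp F ->
  fsupp (fun w => Ex (fun w' => F (mix (K w) w w'))) /\
  Ex (fun w => Ex (fun w' => F (mix (K w) w w'))) = Ex F.
Proof.
move=> [D0 sF0]; pose D := D0 ++ DK.
have sF : supp D F by apply: supp_sub sF0 => v; rewrite mem_cat => ->.
have sin w : supp D (fun w' => F (mix (K w) w w')).
  by move=> x x' xx'; apply: sF => v vD; rewrite /mix; case: ifP => // _; apply: xx'.
have sout : supp D (fun w => Ex (fun w' => F (mix (K w) w w'))).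
  move=> x x' xx'; rewrite (@K_supp x x'); last first.
    by move=> v vD; apply: xx'; rewrite mem_cat vD orbT.
  congr Ex; apply: funext => w'; apply: sF => v vD; rewrite /mix.
  by case: ifP => // _; apply: xx'.
split; first by exists D.
rewrite (Ex_ext sout) (Ex_ext sF) !Ex_fin.
pose V := seq_sub D; pose X := {ffun V -> bool}.
pose k (x : X) (v : V) := K (ext x) (val v).
pose t (p : X * X) : X * X :=
  ([ffun v => if k p.1 v then p.1 v else p.2 v], [ffun v => if k p.1 v then p.2 v else p.1 v]).
have tE p : ext (t p).1 = mix (K (ext p.1)) (ext p.1) (ext p.2).
  apply: funext => v; rewrite /ext /mix; case: insubP => [u _ <-|_]; last by case: ifP.
  by rewrite /= ffunE /k.
have kt p : k (t p).1 = k p.1.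
  apply: funext => v; rewrite /k (@K_stop (ext p.1)) // => u Ku.
  by rewrite tE /mix Ku.
have tK : involutive t.
  move=> [x y]; rewrite {1}/t kt /=; congr pair; apply/ffunP => v; rewrite !ffunE /=.
    by case: (k x v).
  by case: (k x v).
rewrite (eq_bigr (fun x : X => (\sum_(y : X) F (ext (t (x, y)).1)) / 2 ^+ #|{:V}|)); last first.
  move=> x _; rewrite (Ex_ext (sin _)) Ex_fin; congr (_ / _); apply: eq_bigr => y _.
  by rewrite tE.
rewrite -mulr_suml pair_big /= (eq_bigr (fun p : X * X => F (ext (t p).1))); last by case.
have -> : \sum_(p : X * X) F (ext (t p).1) = \sum_(p : X * X) F (ext p.1).
  by rewrite [RHS](reindex_inj (inv_inj tK)).
rewrite -(pair_big xpredT xpredT (fun (x y : X) => F (ext x))) /=.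
rewrite (eq_bigr (fun x : X => F (ext x) * 2 ^+ #|{:V}|)); last first.
  by move=> x _; rewrite sumr_const card_ffun card_bool -[LHS]mulr_natr natrX.
by rewrite -mulr_suml mulfK ?expf_neq0 ?pnatr_eq0 //.
Qed.

(** The product is the probability that independent [w] and [w'] satisfy [A] and [B]. Every mixture
    is again distributed as fair flips, since [K] is a stopping set and [g i] preserves the law of
    [w'], so a union bound over [i] suffices. *)
Lemma mix_le (A B : (T -> bool) -> Prop) (r : nat) (C : 'I_r -> (T -> bool) -> Prop)
    (g : 'I_r -> T -> T) :
  fes A -> fes B -> (forall i, fes (C i)) -> (forall i, injective (g i)) ->
  (forall w w', A w -> B w' -> exists i, C i (mix (K w) w (w' \o g i))) ->
  Pr R A * Pr R B <= \sum_(i < r) Pr R (C i).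
Proof.
move=> fA fB fC gI H.
have fA' := fesP R fA; have fB' := fesP R fB.
have fC' i := fesP R (fC i).
have fin w i : fsupp (fun w' => ind R (C i) (mix (K w) w w')).
  have [D sD] := fC' i; exists D => x x' xx'; apply: sD => v vD; rewrite /mix.
  by case: ifP => // _; apply: xx'.
have -> : Pr R A * Pr R B = Ex (fun w => Pr R B * ind R A w + 0 * ind R A w).
  by rewrite Ex_lin // mul0r addr0 mulrC.
have [fS ES] := Ex_sum (index_enum 'I_r) (fun i => (Ex_mix (fC' i)).1).
rewrite (eq_bigr _ (fun i _ => esym (Ex_mix (fC' i)).2)) -ES.
apply: Ex_le => //.
  exact: (fsupp_op (fun a b => _ * a + _ * b)).
move=> w; rewrite mul0r addr0 [ind _ A w]/ind; case: (pselect (A w)) => Aw; last first.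
  rewrite asboolF // mulr0; apply: sumr_ge0 => i _.
  rewrite -[0](@Ex_cst R T); apply: Ex_le => [|//|w']; first exact: fsupp_cst.
  exact: ind_ge0.
rewrite asboolT // mulr1.
rewrite (eq_bigr (fun i => Ex (fun w' => ind R (C i) (mix (K w) w (w' \o g i))))); last first.
  by move=> i _; rewrite -(Ex_map (gI i) (fin w i)).
have fin' i := fsupp_map (g i) (fin w i).
have [fS' ES'] := Ex_sum (index_enum 'I_r) fin'.
rewrite -ES'; apply: Ex_le => // w'.
case: (pselect (B w')) => Bw'; last first.
  by rewrite /ind asboolF //; apply: sumr_ge0 => i _; apply: ind_ge0.
have [i Ci] := H _ _ Aw Bw'.
rewrite (bigD1 i) //= [ind _ B w']/ind [ind _ (C i) _]/ind !asboolT // lerDl.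
by apply: sumr_ge0 => j _; apply: ind_ge0.
Qed.

End Exploration.

(** * Russo-Seymour-Welsh crossings *)

(* [refl j] carries the strip of rows [0, 2q] onto the strip of rows
   [2jq, 2(j+1)q], by a translation or a reflection that preserves [sh true]; the
   inverse maps glue to the folding of a taller strip onto [0, 2q]. *)
Section Folding.
Variable q : int.

Definition refl (j : nat) (p : site) : site :=
  let I := j%:Z * q in
  if odd j then (p.1 + p.2 - I - q, 2 * I + 2 * q - p.2) else (p.1 - I, p.2 + 2 * I).

Definition unrefl (j : nat) (p : site) : site :=
  let I := j%:Z * q in
  if odd j then (p.1 + p.2 - I - q, 2 * I + 2 * q - p.2) else (p.1 + I, p.2 - 2 * I).

Lemma reflK j : cancel (refl j) (unrefl j).
Proof. by move=> p; apply: site_eq; rewrite /refl /unrefl; case: (odd j) => /=; lia. Qed.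

Lemma unreflK j : cancel (unrefl j) (refl j).
Proof. by move=> p; apply: site_eq; rewrite /refl /unrefl; case: (odd j) => /=; lia. Qed.

Lemma unrefl_adj j p p' : adj p p' -> adj (unrefl j p) (unrefl j p').
Proof. by rewrite /unrefl /adj; case: (odd j) => /=; lia. Qed.

Lemma sh_unrefl j p : sh true (unrefl j p) = sh true p.
Proof. by rewrite /unrefl /sh; case: (odd j) => /=; lia. Qed.

Lemma sh_refl j p : sh true (refl j p) = sh true p.
Proof. by rewrite -{2}(reflK j p) sh_unrefl. Qed.

(** The bottom row of the image of the tall strip under [unrefl j]. *)
Definition rlo (r j : nat) : int :=
  if odd j then 2 * (j%:Z * q) + 2 * q - 2 * (r%:Z * q) else - 2 * (j%:Z * q).

Lemma rows_unrefl (r j : nat) p : rows 0 (2 * (r%:Z * q)) p ->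
  rows (rlo r j) (rlo r j + 2 * (r%:Z * q)) (unrefl j p).
Proof. by rewrite /rows /rlo /unrefl; case: (odd j) => /=; lia. Qed.

Hypothesis q0 : 1 <= q.

Lemma rlo_le (r j : nat) : (j < r)%N ->
  rlo r j <= 0 /\ 2 * q <= rlo r j + 2 * (r%:Z * q).
Proof.
move=> jr; have : (j%:Z + 1) * q <= r%:Z * q by rewrite ler_pM2r; lia.
have : 0 <= j%:Z * q by apply: mulr_ge0; lia.
by rewrite /rlo; case: (odd j); lia.
Qed.

Lemma refl_cover (r : nat) p : (0 < r)%N -> rows 0 (2 * (r%:Z * q)) p ->
  exists j p', [/\ (j < r)%N, rows 0 (2 * q) p' & p = refl j p'].
Proof.
elim: r => // r IH _ rp.
case: (ltP p.2 (2 * (r%:Z * q))) => h.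
  case: r IH rp h => [|r] IH rp h; first by move: rp; rewrite /rows; lia.
  have [|j [p' [jr rp' e]]] := IH isT; first by move: rp; rewrite /rows; lia.
  by exists j, p'; split=> //; lia.
exists r, (unrefl r p); split=> //; last by rewrite unreflK.
by move: rp h; rewrite /rows /unrefl; case: (odd r) => /=; lia.
Qed.

(** Folding separates no neighbours: consecutive strips meet along a line on which both maps agree,
    and strips further apart contain no adjacent sites. *)
Lemma fold_adj (i j : nat) p p' :
  rows 0 (2 * q) p -> rows 0 (2 * q) p' -> adjeq (refl i p) (refl j p') -> adjeq p p'.
Proof.
wlog ij : i j p p' / (i <= j)%N.
  move=> H rp rp' a; have [ij|ji] := leqP i j; first exact: H ij rp rp' a.
  have := H _ _ _ _ (ltnW ji) rp' rp; rewrite /adjeq !(adj_sym p') !(adj_sym (refl j p')).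
  by rewrite ![p'.1 == _]eq_sym ![p'.2 == _]eq_sym ![(refl j p').1 == _]eq_sym
    ![(refl j p').2 == _]eq_sym; apply.
move=> rp rp' a.
have [e|[e|h]] : j = i \/ j = i.+1 \/ (i.+2 <= j)%N by lia.
- by move: a; rewrite e /refl /adjeq /adj; case: (odd i) => /=; lia.
- have eI : j%:Z * q = i%:Z * q + q by rewrite e; lia.
  move: a rp rp'; rewrite /refl eI e /= /rows /adjeq /adj; case: (odd i) => /=; lia.
- exfalso; have : (i%:Z + 2) * q <= j%:Z * q by rewrite ler_pM2r; lia.
  move: a rp rp'; rewrite /refl /rows /adjeq /adj; case: (odd i); case: (odd j) => /=; lia.
Qed.

Lemma fold_eq (i j : nat) p p' :
  rows 0 (2 * q) p -> rows 0 (2 * q) p' -> refl i p = refl j p' -> p = p'.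
Proof.
move=> rp rp' e.
have := congr1 (sh true) e; rewrite !sh_refl => es.
have : adjeq (refl i p) (refl j p') by rewrite e /adjeq !eqxx.
move=> /(fold_adj rp rp'); move: es; rewrite /adjeq /adj /sh => es a.
have e2 : p.2 = p'.2.
  apply/eqP; apply: contrapT => /eqP ne.
  have [d|d] : `|p.2 - p'.2| = 1 \/ 2 <= `|p.2 - p'.2| by lia.
    by lia.
  by lia.
by apply: site_eq => //; lia.
Qed.

End Folding.

Section Mirror.
Variable t : int.

Definition mirror (p : site) : site := (t - p.1 - p.2, p.2).

Lemma mirrorK : involutive mirror.
Proof. by move=> p; apply: site_eq; rewrite /mirror /=; lia. Qed.

Lemma sh_mirror p : sh true (mirror p) = 2 * t - sh true p.
Proof. by rewrite /sh /mirror /=; lia. Qed.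

Lemma mirror_adj p p' : adj p p' -> adj (mirror p) (mirror p').
Proof. by rewrite /adj /mirror /=; lia. Qed.

End Mirror.

(** * The leftmost vertical crossing and arms attached to it *)

Section LeftExploration.
Variables (q t : int).
Hypotheses (q0 : 1 <= q).
Implicit Types (w : site -> bool) (p : site).

(** Everything left of 0 is free, which gives the exploration a seed whatever [w] is. *)
Definition leftz w p : Prop :=
  [/\ rows 0 (2 * q) p, sh true p <= 2 * t & sh true p < 0 \/ ~ w p].

Definition leftc w p : Prop := exists u, sh true u < 0 /\ conn (leftz w) u p.

(** The boundary sites belong to the set because a site must be inspected before it is known to be
    open; this is what makes it a stopping set. *)
Definition explored w p : Prop := leftc w p \/
  [/\ rows 0 (2 * q) p, sh true p <= 2 * t & exists p', leftc w p' /\ adj p' p].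

Lemma leftc_sub w w' : (forall p, explored w p -> w p = w' p) ->
  forall p, leftc w p -> leftc w' p.
Proof.
move=> ww' p [u [u0 up]]; exists u; split=> //.
apply: conn_mono (conn_cluster up) => v uv.
have [rv sv wv] := conn_r uv; split=> //; rewrite -ww' //.
by left; exists u.
Qed.

Lemma leftc_sub' w w' : (forall p, explored w p -> w p = w' p) ->
  forall p, leftc w' p -> leftc w p.
Proof.
move=> ww' p [u [u0 up]]; elim: up => [[ru su _]|v v' _ IH vv' [rv sv wv]].
  by exists u; split=> //; apply: conn0; split=> //; left.
have [a [a0 av]] := IH; exists a; split=> //; apply: (connS av (vv')); split=> //.
by rewrite ww' //; right; split=> //; exists v.
Qed.

Lemma explored_stop w w' : (forall p, explored w p -> w p = w' p) ->
  explored w' = explored w.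
Proof.
move=> ww'.
have e p : leftc w' p <-> leftc w p by split; [exact: leftc_sub'|exact: leftc_sub].
apply: funext => p; apply: propext; rewrite /explored.
by split=> -[/e lp|[rp sp [p' [/e lp' a]]]];
  [left|right; split=> //; exists p'|left|right; split=> //; exists p'].
Qed.

Lemma explored_supp w w' :
  (forall p, rows 0 (2 * q) p -> 0 <= sh true p <= 2 * t -> w p = w' p) ->
  explored w = explored w'.
Proof.
move=> ww'.
have ez : leftz w = leftz w'.
  apply: funext => p; apply: propext; split=> -[rp sp h]; split=> //.
    by case: (ltP (sh true p) 0) => sp0; [left|rewrite -ww' ?sp0 //; right; case: h => //; lia].
  by case: (ltP (sh true p) 0) => sp0; [left|rewrite ww' ?sp0 //; right; case: h => //; lia].
by rewrite /explored /leftc ez.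
Qed.

Lemma explored_le w p : explored w p -> rows 0 (2 * q) p /\ sh true p <= 2 * t.
Proof. by case=> [[u [_ /conn_r[]]]|[]]. Qed.

Lemma left_explored w p : rows 0 (2 * q) p -> sh true p < 0 -> 0 <= t -> explored w p.
Proof.
move=> rp sp t0; left; exists p; split=> //; apply: conn0; split=> //; [lia|by left].
Qed.

Section Boundary.
Variable w : site -> bool.
Hypotheses (t0 : 0 <= t) (Vw : VC true 0 (2 * t) 0 (2 * q) w).

Definition rightc p : Prop := exists r, 2 * t < sh true r /\
  conn (fun p => rows 0 (2 * q) p /\ ~ explored w p) r p.

(** The explored sites visible from the right. They play the role of the leftmost vertical crossing
    without any ordering of paths. *)
Definition frontier p : Prop := explored w p /\ exists r, rightc r /\ adj r p.

Lemma rightcP p : rightc p -> rows 0 (2 * q) p /\ ~ explored w p.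
Proof. by case=> r [_ /conn_r]. Qed.

Lemma rightc_step p p' : rightc p -> adj p p' -> rows 0 (2 * q) p' -> ~ explored w p' ->
  rightc p'.
Proof. by move=> [r [sr rp]] a rp' np'; exists r; split=> //; apply: connS rp a _. Qed.

Lemma right_rightc p : rows 0 (2 * q) p -> 2 * t < sh true p -> rightc p.
Proof.
move=> rp sp; exists p; split=> //; apply: conn0; split=> // /explored_le[_]; lia.
Qed.

Lemma leftc_bdry p r : leftc w p -> adj p r -> rows 0 (2 * q) r -> 2 * t < sh true r -> False.
Proof.
move=> [u [u0 up]] pr rr sr.
apply: (@HC_VC_exclusive true 0 (2 * t) 0 (2 * q) (fun p => ~ w p)); first lia; last first.
  by apply: VC_sub Vw => v [_ _ wv] /(_ wv).
exists u, r; split=> //; apply: (@connS _ _ p) => //; last by split=> //; right; right.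
by apply: conn_mono up => v [rv sv [|]]; split=> //; [right; left|left].
Qed.

Lemma frontierP p : frontier p ->
  [/\ rows 0 (2 * q) p, 0 <= sh true p <= 2 * t, w p, ~ leftc w p
    & exists k, leftc w k /\ adj k p].
Proof.
move=> [Kp [r [Ur rp]]]; have [rr nKr] := rightcP Ur.
have nl : ~ leftc w p.
  move=> lp; case: (leP (sh true r) (2 * t)) => sr.
    by apply: nKr; right; split=> //; exists p; rewrite adj_sym.
  by apply: leftc_bdry lp _ rr sr; rewrite adj_sym.
case: Kp => [//|[rp' sp [k [lk kp]]]].
have nz : ~ leftz w p.
  by move=> zp; apply: nl; have [u [u0 uk]] := lk; exists u; split=> //; apply: connS uk kp zp.
split=> //.
- by rewrite sp andbT leNgt; apply/negP => sp0; apply: nz; split=> //; left.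
- by apply: contrapT => nw; apply: nz; split=> //; right.
- by exists k.
Qed.

(** Otherwise duality gives a path from the right that avoids the frontier. Such a path never leaves
    the unexplored right component, yet it ends left of 0, where every site is explored. *)
Lemma frontier_cross : VC true 0 (2 * t) 0 (2 * q) frontier.
Proof.
have [|[u [v [uv su sv]]]|H] := @HC_or_VC true 0 (2 * t) 0 (2 * q) (fun p => ~ frontier p);
  first lia; last by apply: VC_sub H => p [_ _ /contrapT].
exfalso.
have all p : conn (HCz true 0 (2 * t) 0 (2 * q) (fun p => ~ frontier p)) v p -> rightc p.
  elim=> [[rv _]|p1 p2 _ Up1 a [rp2 H]]; first exact: right_rightc.
  apply: (rightc_step Up1 a rp2) => Kp2.
  have Bp2 : frontier p2 by split=> //; exists p1.
  by have [_ sp2 _ _ _] := frontierP Bp2; case: H => //; lia.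
have [ru nu] := rightcP (all _ (conn_sym uv)).
by apply: nu; apply: left_explored.
Qed.

(* A vertical crossing inside the frontier contains every frontier site [z]:
   otherwise it would miss the horizontal crossing that reaches [z] through the
   left cluster and leaves it through unexplored sites. *)
Lemma frontier_conn u v z : conn (VCz true 0 (2 * t) 0 (2 * q) frontier) u v ->
  u.2 = 0 -> v.2 = 2 * q -> frontier z ->
  conn (VCz true 0 (2 * t) 0 (2 * q) frontier) u z.
Proof.
move=> uv u0 v0 Bz; pose C p := conn (VCz true 0 (2 * t) 0 (2 * q) frontier) u p.
apply: contrapT => nCz.
have CB p : C p -> frontier p by case/conn_r.
have [rz sz wz nlz [k [[s [s0 sk]] kz]]] := frontierP Bz.
have [_ [r [[r' [sr' rr']] rz']]] := Bz.
apply: (@HC_VC_exclusive true 0 (2 * t) 0 (2 * q) (fun p => ~ C p)); first lia; last first.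
  exists u, v; split=> //; apply: conn_mono (conn_cluster uv) => p Cp.
  by have [rp sp _] := conn_r Cp; split=> // nC; apply: nC.
exists s, r'; split=> //.
have sz' : conn (HCz true 0 (2 * t) 0 (2 * q) (fun p => ~ C p)) s z.
  apply: (@connS _ _ k) => //; last by split=> //; left.
  apply: conn_mono (conn_cluster sk) => p sp; have [rp ? ?] := conn_r sp; split=> //.
  by left=> /CB/frontierP[_ _ _ + _]; apply; exists s.
apply: conn_trans sz' _; apply: conn_sym.
apply: (@connS _ _ r) => //; last by split=> //; left.
apply: conn_mono rr' => p [rp nKp]; split=> //; left=> /CB [Kp _]; exact: nKp.
Qed.

End Boundary.

(** A vertical crossing with an arm reaching beyond [m]. Keeping the arm at [0 <= sh true] makes the
    event depend on a bounded set of sites. *)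
Definition hooked (m lo hi : int) (w : site -> bool) : Prop := exists u v r,
  [/\ conn (VCz true 0 (2 * t) 0 (2 * q) w) u v, u.2 = 0, v.2 = 2 * q,
      conn (fun p => [/\ rows lo hi p, 0 <= sh true p & w p \/ m < sh true p]) u r & m < sh true r].

(** Follow the tall crossing from its right end while its folded image stays in the right component.
    It cannot do so up to the left end, and the first site that leaves folds onto the frontier. The
    isometry [unrefl j] of the strip of that site, applied to the whole arm, attaches it there. *)
Lemma fold_hooked (r : nat) (m : int) w w' : (0 < r)%N -> 0 <= t -> 2 * t <= m ->
  VC true 0 (2 * t) 0 (2 * q) w -> HC true 0 m 0 (2 * (r%:Z * q)) w' ->
  exists2 j, (j < r)%N &
    hooked m (rlo q r j) (rlo q r j + 2 * (r%:Z * q))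
      (mix (fun p => `[< explored w p >]) w (w' \o refl q j)).
Proof.
move=> r0 t0 tm Vw [u [v [uv su sv]]].
pose Q p := exists j p',
  [/\ (j < r)%N, rows 0 (2 * q) p', p = refl q j p' & rightc w p'].
have Qv : Q v.
  have [rv _] := conn_r uv; have [j [p' [jr rp' e]]] := refl_cover q0 r0 rv.
  exists j, p'; split=> //; apply: right_rightc => //.
  by rewrite -(sh_refl q j) -e; lia.
case: (conn_exit (conn_sym uv) Qv) => [/conn_r[_ [j [p' [jr rp' e Up']]]]|].
  exfalso; have [_ nK] := rightcP Up'; apply: nK; apply: left_explored => //.
  by rewrite -(sh_refl q j) -e.
move=> [a [b [va ab [rb Hb] nQb _]]].
have [_ [i [a' [ir ra' ea Ua']]]] := conn_r va.
have [j [b' [jr rb' eb]]] := refl_cover q0 r0 rb.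
have nUb' : ~ rightc w b' by move=> Ub'; apply: nQb; exists j, b'.
have ab' : adj a' b'.
  have := fold_adj q0 (i := i) (j := j) ra' rb'.
  rewrite -ea -eb /adjeq ab orbT => /(_ isT) /orP[/andP[/eqP e1 /eqP e2]|//].
  by exfalso; apply: nUb'; rewrite -(site_eq e1 e2).
have Bb' : frontier w b'.
  split; last by exists a'.
  by apply: contrapT => nK; apply: nUb'; apply: rightc_step Ua' ab' rb' nK.
have [x [y [xy x0 y0]]] := frontier_cross t0 Vw.
exists j => //; set M := mix _ _ _; exists x, y, (unrefl q j v).
have [lo0 hi0] := rlo_le q0 jr.
have BM p : frontier w p -> M p.
  move=> Bp; have [_ _ wp _ _] := frontierP t0 Vw Bp; case: Bp => Kp _.
  by rewrite /M /mix asboolT.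
split=> //.
- by apply: conn_mono xy => p [rp sp Bp]; split=> //; apply: BM.
- have xb := frontier_conn t0 Vw xy x0 y0 Bb'.
  have xb' : conn (fun p => [/\ rows (rlo q r j) (rlo q r j + 2 * (r%:Z * q)) p, 0 <= sh true p
      & M p \/ m < sh true p]) x b'.
    apply: conn_mono xb => p [rp sp Bp]; split; [|lia|by left; apply: BM].
    by move: rp; rewrite /rows; lia.
  have va' : conn (fun p => [/\ rows (rlo q r j) (rlo q r j + 2 * (r%:Z * q)) p, 0 <= sh true p
      & M p \/ m < sh true p]) (unrefl q j v) (unrefl q j a).
    apply: conn_map va => [p p' pp'|p [[rp Hp] [k [p' [kr rp' e Up']]]]].
      by right; apply: unrefl_adj.
    have [_ nKp'] := rightcP Up'.
    have sp0 : 0 <= sh true p.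
      rewrite leNgt; apply/negP => sp; apply: nKp'; apply: left_explored => //.
      by rewrite -(sh_refl q k) -e.
    split; [exact: rows_unrefl|by rewrite sh_unrefl|].
    rewrite sh_unrefl; case: Hp => [w'p|[sp|sp]]; [left|lia|by right].
    (* On the moved arm the mixture reads [w']: an explored site of it would lie in the base strip
       and hence coincide with its folded image, which is unexplored. *)
    rewrite /M /mix asboolF /= ?unreflK // => Kh; apply: nKp'.
    have [rh _] := explored_le Kh.
    suff -> : p' = unrefl q j p by [].
    by apply: (fold_eq q0 (i := k) (j := j)); rewrite ?unreflK.
  apply: conn_trans (xb') _; apply: conn_sym; apply: connS va' _ (conn_r xb').
  by rewrite -(reflK q j b') -eb; apply: unrefl_adj.
- by rewrite sh_unrefl.
Qed.

(** The short horizontal crossing meets the vertical crossings of both hooks, and so joins the arm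
    on the right to the mirrored arm on the left. *)
Lemma hooked_glue m lo hi w : 0 < t -> lo <= 0 -> 2 * q <= hi ->
  hooked m lo hi w -> hooked m lo hi (w \o mirror t) ->
  HC true 0 (2 * t) 0 (2 * q) w -> HC true (2 * t - m) m lo hi w.
Proof.
move=> t0 lo0 hi0 [u [v [r [uv u0 v0 ur sr]]]] [u' [v' [r' [uv' u0' v0' ur' sr']]]] H.
have [x [y [xy sx sy]]] := HC_trim (ltac:(lia) : 0 < 2 * t) H.
have qq : (0 : int) <= 2 * q by lia.
pose Z := HCz true (2 * t - m) m lo hi (fun p => w p).
have VZ p : VCz true 0 (2 * t) 0 (2 * q) (fun p => w p) p -> Z p.
  by move=> [rp _ wp]; split; [move: rp; rewrite /rows; lia|left].
have C1 : VC true 0 (2 * t) 0 (2 * q) (conn (VCz true 0 (2 * t) 0 (2 * q) w) u).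
  exists u, v; split=> //; apply: conn_mono (conn_cluster uv) => p up.
  by have [rp sp _] := conn_r up.
have uv'' : conn (VCz true 0 (2 * t) 0 (2 * q) w) (mirror t u') (mirror t v').
  apply: conn_map uv' => [p p' pp'|p [rp sp wp]]; first by right; apply: mirror_adj.
  by split=> //; rewrite sh_mirror; lia.
have C2 : VC true 0 (2 * t) 0 (2 * q) (conn (VCz true 0 (2 * t) 0 (2 * q) w) (mirror t u')).
  exists (mirror t u'), (mirror t v'); split=> //.
  apply: conn_mono (conn_cluster uv'') => p up.
  by have [rp sp _] := conn_r up.
have [p1 [xp1 up1]] := cross_meet qq xy sx sy C1.
have [p2 [xp2 up2]] := cross_meet qq xy sx sy C2.
have ur'' : conn Z (mirror t u') (mirror t r').
  apply: conn_map ur' => [p p' pp'|p [rp _ H']]; first by right; apply: mirror_adj.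
  split=> //; rewrite sh_mirror; case: H' => [wp|sp]; [by left|right; left; lia].
have urZ : conn Z u r.
  apply: conn_mono ur => p [rp _ [wp|sp]]; split=> //; [by left|by right; right].
exists (mirror t r'), r; split=> //; last by rewrite sh_mirror; lia.
apply: conn_trans (conn_sym ur'') _; apply: conn_trans _ urZ.
apply: conn_trans (conn_mono VZ up2) _.
apply: conn_trans (conn_sym (conn_mono VZ xp2)) _.
exact: conn_trans (conn_mono VZ xp1) (conn_sym (conn_mono VZ up1)).
Qed.

End LeftExploration.

(** * Locality, monotonicity and translation of crossing events *)

Definition zrange (M : nat) : seq int := [seq i%:Z - M%:Z | i <- iota 0 (2 * M).+1].

Lemma mem_zrange M x : (x \in zrange M) = (`|x| <= M%:Z).
Proof.
apply/mapP/idP => [[j]|h]; first by rewrite mem_iota => h ->; lia.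
by exists (absz (x + M%:Z)); [rewrite mem_iota|]; lia.
Qed.

Definition region (Q : site -> Prop) (M : nat) : seq site :=
  [seq p <- [seq (x, y) | x <- zrange M, y <- zrange M] | `[< Q p >]].

Lemma mem_region (Q : site -> Prop) (M : nat) p :
  (forall p, Q p -> `|p.1| <= M%:Z /\ `|p.2| <= M%:Z) ->
  (p \in region Q M) = `[< Q p >].
Proof.
move=> QM; rewrite mem_filter; case: asboolP => // /QM [p1 p2]; rewrite andTb.
by apply/allpairsPdep; exists p.1, p.2; rewrite !mem_zrange; split=> //; case: (p).
Qed.

Lemma esupp_region (Q : site -> Prop) (M : nat) (A : (site -> bool) -> Prop) :
  (forall p, Q p -> `|p.1| <= M%:Z /\ `|p.2| <= M%:Z) ->
  (forall w w' : site -> bool, (forall p, Q p -> w p = w' p) -> A w -> A w') ->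
  esupp (region Q M) A.
Proof.
move=> QM AQ w w' ww'; apply: AQ => p Qp; apply: ww'.
by rewrite mem_region //; apply/asboolP.
Qed.

Definition rect e (a b lo hi : int) (p : site) : Prop := rows lo hi p /\ a <= sh e p <= b.

Definition rectM (a b lo hi : int) : nat := absz (`|a| + `|b| + `|lo| + `|hi|)%R.

Lemma rect_bound e a b lo hi p : rect e a b lo hi p ->
  `|p.1| <= (rectM a b lo hi)%:Z /\ `|p.2| <= (rectM a b lo hi)%:Z.
Proof. by rewrite /rect /rows /sh /rectM; case: e => -[]; lia. Qed.

Lemma HC_loc e a b lo hi (w w' : site -> bool) :
  (forall p, rect e a b lo hi p -> w p = w' p) ->
  HC e a b lo hi (fun p => w p) -> HC e a b lo hi (fun p => w' p).
Proof. by move=> ww'; apply: HC_sub => p [rp sp wp]; rewrite -ww'. Qed.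

Lemma VC_loc e a b lo hi (w w' : site -> bool) :
  (forall p, rect e a b lo hi p -> w p = w' p) ->
  VC e a b lo hi (fun p => w p) -> VC e a b lo hi (fun p => w' p).
Proof. by move=> ww'; apply: VC_sub => p [rp sp wp]; rewrite -ww'. Qed.

Lemma fes_HC e a b lo hi : fes (fun w : site -> bool => HC e a b lo hi (fun p => w p)).
Proof. by exists (region (rect e a b lo hi) (rectM a b lo hi)); apply: esupp_region (@rect_bound _ _ _ _ _) (@HC_loc _ _ _ _ _). Qed.

Lemma fes_VC e a b lo hi : fes (fun w : site -> bool => VC e a b lo hi (fun p => w p)).
Proof. by exists (region (rect e a b lo hi) (rectM a b lo hi)); apply: esupp_region (@rect_bound _ _ _ _ _) (@VC_loc _ _ _ _ _). Qed.

Lemma einc_HC e a b lo hi : einc (fun w : site -> bool => HC e a b lo hi (fun p => w p)).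
Proof. by move=> w w' ww'; apply: HC_sub => p [_ _ /ww']. Qed.

Lemma einc_VC e a b lo hi : einc (fun w : site -> bool => VC e a b lo hi (fun p => w p)).
Proof. by move=> w w' ww'; apply: VC_sub => p [_ _ /ww']. Qed.

Definition shift (al be : int) (p : site) : site := (p.1 + al, p.2 + be).

Lemma shift_inj al be : injective (shift al be).
Proof. by move=> [x y] [x' y'] [/addIr -> /addIr ->]. Qed.

Lemma HC_shift al be a b lo hi (w : site -> bool) :
  HC true a b lo hi (fun p => w p) ->
  HC true (a - 2 * al - be) (b - 2 * al - be) (lo - be) (hi - be)
    (fun p => (w \o shift al be) p).
Proof.
move=> [u [v [uv su sv]]]; exists (shift (- al) (- be) u), (shift (- al) (- be) v).
split; [|by rewrite /sh /shift /= in su *; lia|by rewrite /sh /shift /= in sv *; lia].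
apply: conn_map uv => [p p'|p [rp H]].
  by right; rewrite /adj /shift /= in H *; lia.
have e : (w \o shift al be) (shift (- al) (- be) p) = w p.
  by rewrite /=; congr w; apply: site_eq; rewrite /shift /=; lia.
split; first by move: rp; rewrite /rows /shift /=; lia.
by case: H => [|H]; [rewrite -e; left|right; move: H; rewrite /sh /shift /=; lia].
Qed.

Lemma VC_shift al be a b lo hi (w : site -> bool) :
  VC true a b lo hi (fun p => w p) ->
  VC true (a - 2 * al - be) (b - 2 * al - be) (lo - be) (hi - be)
    (fun p => (w \o shift al be) p).
Proof.
move=> [u [v [uv su sv]]]; exists (shift (- al) (- be) u), (shift (- al) (- be) v).
split; [|by rewrite /shift /=; lia|by rewrite /shift /=; lia].
apply: conn_map uv => [p p'|p [rp sp wp]].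
  by right; rewrite /adj /shift /= in H *; lia.
split; first by move: rp; rewrite /rows /shift /=; lia.
  by move: sp; rewrite /sh /shift /=; lia.
suff e : (w \o shift al be) (shift (- al) (- be) p) = w p by move: wp; rewrite -e.
by rewrite /=; congr w; apply: site_eq; rewrite /shift /=; lia.
Qed.

(** * Crossing probabilities of long rectangles *)

Section RSW.
Variable R : realType.
Local Notation Pr := (Pr R).

(** The width [k] is measured by [sh true], in half units of length; the height [N] counts rows. *)
Definition ph (k N : int) : R := Pr (fun w : site -> bool => HC true 0 k 0 N (fun p => w p)).
Definition pv (k N : int) : R := Pr (fun w : site -> bool => VC true 0 k 0 N (fun p => w p)).

Lemma Pr_HC_VC e (a b lo hi : int) : lo <= hi ->
  Pr (fun w : site -> bool => HC e a b lo hi (fun p => w p)) =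
  1 - Pr (fun w : site -> bool => VC e a b lo hi (fun p => w p)).
Proof.
move=> lohi; rewrite -(Pr_neg R (fes_VC e a b lo hi)) -Pr_not; last exact: (fes_neg (fes_VC e a b lo hi)).
apply: (Pr_ext R) => w; split=> [H V|nV].
  by apply: (HC_VC_exclusive lohi H); apply: VC_sub V => p [_ _ /negP].
case: (HC_or_VC e a b (fun p => w p) lohi) => // V; exfalso; apply: nV.
by apply: VC_sub V => p [_ _ /negP].
Qed.

Lemma ph_pv (k N : int) : 0 <= N -> ph k N = 1 - pv k N.
Proof. exact: Pr_HC_VC. Qed.

Lemma ph_ge k N : 0 <= ph k N.
Proof. exact: (Pr_ge0 R (fes_HC _ _ _ _ _)). Qed.

Lemma Pr_HC_shift (al be k N a b lo hi : int) : a = 2 * al + be -> b = k + 2 * al + be ->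
  lo = be -> hi = N + be ->
  Pr (fun w : site -> bool => HC true a b lo hi (fun p => w p)) = ph k N.
Proof.
move=> -> -> -> ->.
rewrite -[LHS](Pr_map R (@shift_inj (- al) (- be)) (fes_HC _ _ _ _ _)).
apply: (Pr_ext R) => w; split=> H.
- have := HC_shift al be H.
  have -> : (w \o shift (- al) (- be)) \o shift al be = w.
    by apply: funext => p /=; congr w; apply: site_eq; rewrite /shift /=; lia.
  by congr (HC true _ _ _ _ _); lia.
- have := HC_shift (- al) (- be) H; by congr (HC true _ _ _ _ _); lia.
Qed.

Lemma Pr_VC_shift (al k N a b : int) : a = 2 * al -> b = k + 2 * al ->
  Pr (fun w : site -> bool => VC true a b 0 N (fun p => w p)) = pv k N.
Proof.
move=> -> ->.
rewrite -[LHS](Pr_map R (@shift_inj (- al) 0) (fes_VC _ _ _ _ _)).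
apply: (Pr_ext R) => w; split=> H.
- have := VC_shift al 0 H.
  have -> : (w \o shift (- al) 0) \o shift al 0 = w.
    by apply: funext => p /=; congr w; apply: site_eq; rewrite /shift /=; lia.
  by congr (VC true _ _ _ _ _); lia.
- have := VC_shift (- al) 0 H; by congr (VC true _ _ _ _ _); lia.
Qed.

Lemma ph_mono (k k' N : int) : k <= k' -> ph k' N <= ph k N.
Proof.
move=> kk'; apply: Pr_le; [exact: fes_HC|exact: fes_HC|].
move=> w [u [v [uv su sv]]]; exists u, v; split=> //; last lia.
by apply: conn_mono uv => p [rp [?|[?|?]]]; split=> //;
  [left|right; left|right; right; lia].
Qed.

Lemma pv_mono (k k' N : int) : k <= k' -> pv k N <= pv k' N.
Proof.
move=> kk'; apply: Pr_le; [exact: fes_VC|exact: fes_VC|] => w.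
by apply: VC_widen.
Qed.

Section Rhombus.
Variable N : int.
Hypothesis N0 : 0 < N.

Let swap (p : site) : site := (p.2, p.1).

(** Exchanging the coordinates preserves the rhombus and turns one kind of crossing into the other,
    while duality makes the two probabilities sum to 1. *)
Lemma rhombus_half :
  Pr (fun w : site -> bool => HC false 0 (2 * N) 0 N (fun p => w p)) = 1 / 2 /\
  Pr (fun w : site -> bool => VC false 0 (2 * N) 0 N (fun p => w p)) = 1 / 2.
Proof.
have swap_inj : injective swap by move=> [x y] [x' y'] [-> ->].
have swap_adj p p' : adj p p' -> adj (swap p) (swap p').
  by rewrite /adj /swap /=; lia.
have := Pr_HC_VC false 0 (2 * N) (ltW N0).
suff -> : Pr (fun w : site -> bool => HC false 0 (2 * N) 0 N (fun p => w p)) =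
  Pr (fun w : site -> bool => VC false 0 (2 * N) 0 N (fun p => w p)) by lra.
rewrite -[RHS](Pr_map R swap_inj (fes_VC _ _ _ _ _)).
apply: (Pr_ext R) => w; split=> [/HC_trim|].
  case=> [|u [v [uv su sv]]]; first lia.
  have [ru su' _] := conn_l uv; have [rv sv' _] := conn_r uv.
  exists (swap u), (swap v); split.
  - apply: conn_map uv => [p p' a|[x y] [rp sp wp]]; first by right; apply: swap_adj.
    by split=> //; move: rp sp; rewrite /rows /sh /=; lia.
  - by move: su su'; rewrite /sh /=; lia.
  - by move: sv sv'; rewrite /sh /=; lia.
move=> [u [v [uv u0 vN]]].
have uv' : conn (HCz false 0 (2 * N) 0 N (fun p => w p)) (swap u) (swap v).
  apply: conn_map uv => [p p' a|[x y] [rp sp wp]]; first by right; apply: swap_adj.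
  by split; [move: rp sp; rewrite /rows /sh /=; lia|left].
have [ru _] := conn_l uv'; have [rv _] := conn_r uv'.
exists (-1, u.1), (N + 1, v.1); split; last 2 first.
- by rewrite /sh /=; lia.
- by rewrite /sh /=; lia.
apply: (@connS _ _ (swap v)); last 2 first.
- by rewrite /adj /swap /=; lia.
- by split=> //; right; right; rewrite /sh /=; lia.
apply: conn_trans uv'; apply: connS (conn0 _) _ _.
- by split=> //; right; left; rewrite /sh /=; lia.
- by rewrite /adj /swap /=; lia.
- by split=> //; left; case: (conn_l uv).
Qed.

(** On the rhombus [sh true] runs from 0 to [3 * N]. It is at most [N] on the left side and at least
    [2 * N] on the right side, which gives the companion bound for horizontal crossings. *)
Lemma pv_rhombus : 1 / 2 <= pv (3 * N) N.
Proof.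
rewrite -rhombus_half.2; apply: Pr_le; [exact: fes_VC|exact: fes_VC|].
move=> w [u [v [uv u0 v0]]]; exists u, v; split=> //.
apply: conn_mono uv => p [rp sp wp]; split=> //.
by move: rp sp; rewrite /rows /sh; lia.
Qed.

Lemma ph_rhombus : 1 / 2 <= Pr (fun w : site -> bool => HC true N (2 * N) 0 N (fun p => w p)).
Proof.
rewrite -rhombus_half.1; apply: Pr_le; [exact: fes_HC|exact: fes_HC|].
move=> w [u [v [uv su sv]]].
have [ru _] := conn_l uv; have [rv _] := conn_r uv.
exists u, v; split; last 2 first.
- by move: ru su; rewrite /rows /sh; lia.
- by move: rv sv; rewrite /rows /sh; lia.
apply: conn_mono uv => p [rp [wp|H]]; split=> //; first by left.
by right; move: rp H; rewrite /rows /sh; lia.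
Qed.

End Rhombus.

Lemma Avg_coin (D : seq site) c w :
  Avg D (fun w : site -> bool => (w c)%:R : R) w = if c \in D then 1 / 2 else (w c)%:R.
Proof.
elim: D w => //= v D IH w; rewrite /avg1 !IH inE; case: (boolP (c \in D)) => cD.
  by rewrite orbT; lra.
by rewrite orbF /upd; case: eqP => _; rewrite ?mulr1n ?mulr0n; lra.
Qed.

Lemma Avg_agree (D : seq site) (F G : (site -> bool) -> R) w :
  (forall w', (forall p, p \notin D -> w' p = w p) -> F w' = G w') ->
  Avg D F w = Avg D G w.
Proof.
elim: D w => [|v D IH] w H /=; first exact: H.
rewrite /avg1; congr ((_ + _) / _); apply: IH => w' ww'; apply: H => p;
by rewrite inE negb_or => /andP[pv pD]; rewrite ww' // /upd (negbTE pv).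
Qed.

(** A crossing has an end [c w] chosen from the sites with [sh true <= k] alone. Its right neighbour
    lies beyond them, so it is an independent flip, and opening it gains two units of width. *)
Lemma ph_step (k N : int) : 0 <= k -> 0 <= N -> ph k N / 2 <= ph (k + 2) N.
Proof.
move=> k0 N0.
pose Z (w : site -> bool) p := [/\ rows 0 N p, sh true p <= k & w p \/ sh true p < 0].
pose L (w : site -> bool) p := k - 1 <= sh true p /\ exists u, sh true u < 0 /\ conn (Z w) u p.
pose c (w : site -> bool) : site :=
  if pselect (exists p, L w p) is left H then projT1 (cid H) else (0, 0).
pose e1 (p : site) : site := (p.1 + 1, p.2).
pose A (w : site -> bool) := HC true 0 k 0 N (fun p => w p).
have cL w : A w -> L w (c w).
  move=> [u [v [uv su sv]]]; rewrite /c; case: pselect => [H|nL].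
    exact: (projT2 (cid H)).
  exfalso; apply: nL.
  have [/conn_r[_ /=]|[a [b [ua ab _ /= nb _]]]] :=
    conn_exit (P := fun p => sh true p <= k) uv ltac:(lia); first lia.
  exists a; split; first by have := sh_adj true ab; lia.
  exists u; split=> //; apply: conn_mono ua => p [[rp H] sp]; split=> //.
  by case: H => [wp|[sp0|]]; [left|right|lia].
pose Q := rect true 0 k 0 N; pose Q' := rect true (k + 1) (k + 2) 0 N.
pose D := region Q (rectM 0 k 0 N); pose D' := region Q' (rectM (k + 1) (k + 2) 0 N).
have mD p : (p \in D) = `[< Q p >] by apply: mem_region => x; apply: rect_bound.
have mD' p : (p \in D') = `[< Q' p >] by apply: mem_region => x; apply: rect_bound.
have sA : esupp D A by apply: esupp_region (@rect_bound _ _ _ _ _) (@HC_loc _ _ _ _ _).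
have cloc w w' : (forall p, Q p -> w p = w' p) -> c w = c w'.
  move=> ww'; suff eL : L w = L w' by rewrite /c eL.
  have eZ : Z w = Z w'.
    apply: funext => p; apply: propext; split=> -[rp sp H]; split=> //.
      by case: H => [wp|]; [case: (ltP (sh true p) 0) => s0; [right|left; rewrite -ww' //; split=> //; rewrite s0]|right].
    by case: H => [wp|]; [case: (ltP (sh true p) 0) => s0; [right|left; rewrite ww' //; split=> //; rewrite s0]|right].
  by rewrite /L eZ.
have dis p : p \in D -> p \notin D'.
  by rewrite mD mD' => /asboolP[_ sp]; apply/asboolP => -[_ sp']; lia.
have rc w : A w -> Q' (e1 (c w)).
  move=> /cL [sc [u [su /conn_r[rc sck _]]]]; split; first exact: rc.
  by move: sc sck; rewrite /sh /e1 /=; lia.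
have sA' : esupp (D ++ D') (fun w => A w /\ w (e1 (c w))).
  move=> w w' ww' [Aw wc].
  have QD p : Q p -> w p = w' p.
    by move=> Qp; apply: ww'; rewrite mem_cat mD asboolT.
  split; first by apply: sA Aw => p pD; apply: ww'; rewrite mem_cat pD.
  rewrite -(cloc _ _ QD) -ww' // mem_cat mD' orbC asboolT //; exact: rc.
have key : Pr (fun w => A w /\ w (e1 (c w))) = ph k N / 2.
  rewrite PrE (ExE (fun=> false) (esuppP R sA')) Avg_cat.
  rewrite /ph PrE (ExE (fun=> false) (esuppP R sA)).
  rewrite (_ : Avg D' _ = fun w => (1 / 2) * ind R A w + 0 * ind R A w).
    by rewrite Avg_lin mul0r addr0; lra.
  apply: funext => w; rewrite mul0r addr0.
  have same (w' : site -> bool) : (forall p, p \notin D' -> w' p = w p) ->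
      (A w' <-> A w) /\ c w' = c w.
    move=> ww'; split.
      by split; apply: sA => p /dis/ww' ->.
    by apply: cloc => p Qp; apply: ww'; apply: dis; rewrite mD asboolT.
  case: (pselect (A w)) => Aw.
    rewrite (@Avg_agree D' _ (fun w' => (w' (e1 (c w)))%:R)).
      by rewrite Avg_coin mD' asboolT ?[ind R A w]/ind ?asboolT ?mulr1 //; apply: rc.
    move=> w' /same [eA ec]; rewrite /ind; case wc: (w' (e1 (c w))).
      by rewrite asboolT //; split; [apply/eA|rewrite ec].
    by rewrite asboolF //; rewrite ec wc => -[].
  rewrite (@Avg_agree D' _ (fun=> 0)).
    by rewrite Avg_cst [ind R A w]/ind asboolF ?mulr0.
  by move=> w' /same [eA ec]; rewrite /ind asboolF // => -[/eA].
rewrite -key; apply: Pr_le; [by exists (D ++ D')|exact: fes_HC|].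
move=> w [Aw wc]; have [sc [u [su uc]]] := cL _ Aw.
have [rc' sck _] := conn_r uc.
have se1 p : sh true (e1 p) = sh true p + 2 by rewrite /sh /e1 /=; lia.
have ae1 p : adj p (e1 p) by rewrite /adj /e1 /=; lia.
exists u, (e1 (e1 (c w))); split=> //; last by rewrite !se1; lia.
apply: connS (ae1 _) _; last by split=> //; right; right; rewrite !se1; lia.
apply: connS (ae1 _) _; last by split=> //; left.
apply: conn_mono uc => p [rp sp [wp|sp0]]; split=> //; [by left|by right; left].
Qed.

(** Take the least [T] from [Q] on for which vertical crossings have probability at least 1/2. One
    step earlier the horizontal ones exceed 1/2 by duality, and one step at most halves this; if
    [T = Q], a rhombus gives the horizontal bound. *)
Lemma exists_balanced_width (Q : int) : 1 <= Q ->
  exists T : int, [/\ Q <= T <= 3 * Q, 1 / 2 <= pv (2 * T) (2 * Q) & 1 / 4 <= ph (2 * T) (2 * Q)].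
Proof.
move=> Q1.
pose good (i : nat) := 1 / 2 <= pv (2 * (Q + i%:Z)) (2 * Q).
have [|i gi mi] := @ex_minnP good.
  exists (absz (2 * Q)); rewrite /good.
  apply: le_trans (pv_rhombus (ltac:(lia) : 0 < 2 * Q)) _; apply: pv_mono; lia.
have iQ : i%:Z <= 2 * Q.
  have : good (absz (2 * Q)).
    rewrite /good; apply: le_trans (pv_rhombus (ltac:(lia) : 0 < 2 * Q)) _.
    apply: pv_mono; lia.
  by move/mi; lia.
exists (Q + i%:Z); split=> //; first lia.
case: i gi mi iQ => [|i] gi mi iQ.
  rewrite addr0; have := ph_rhombus (ltac:(lia) : 0 < 2 * Q).
  rewrite (@Pr_HC_shift Q 0 (2 * Q) (2 * Q)); [lra|lia|lia|lia|lia].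
have nb : ~~ good i by apply/negP => /mi; lia.
have := @ph_step (2 * (Q + i%:Z)) (2 * Q) ltac:(lia) ltac:(lia).
have -> : 2 * (Q + i%:Z) + 2 = 2 * (Q + i.+1%:Z) by lia.
rewrite [ph (2 * (Q + i%:Z)) _]ph_pv; last lia.
by move: nb; rewrite /good -ltNge; lra.
Qed.

Lemma hooked_loc (q t m lo hi : int) (w w' : site -> bool) : lo <= 0 -> 2 * q <= hi ->
  2 * t <= m -> (forall p, rect true 0 m lo hi p -> w p = w' p) ->
  hooked q t m lo hi w -> hooked q t m lo hi w'.
Proof.
move=> lo0 hi0 tm ww' [u [v [r [uv u0 v0 ur sr]]]]; exists u, v, r; split=> //.
  apply: conn_mono uv => p [rp sp wp]; split=> //; rewrite -ww' //.
  by split; [move: rp; rewrite /rows|]; lia.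
apply: conn_mono ur => p [rp sp wp]; split=> //.
case: (ltP m (sh true p)) => spm; [by right|left; rewrite -ww'; first by case: wp => //; lia].
by split=> //; rewrite sp spm.
Qed.

Lemma fes_hooked (q t m lo hi : int) : lo <= 0 -> 2 * q <= hi -> 2 * t <= m ->
  fes (hooked q t m lo hi).
Proof.
move=> lo0 hi0 tm; exists (region (rect true 0 m lo hi) (rectM 0 m lo hi)).
by apply: esupp_region => [p|w w']; [exact: rect_bound|exact: hooked_loc].
Qed.

Lemma einc_hooked (q t m lo hi : int) : einc (hooked q t m lo hi).
Proof.
move=> w w' ww' [u [v [r [uv u0 v0 ur sr]]]]; exists u, v, r; split=> //.
  by apply: conn_mono uv => p [rp sp wp]; split=> //; apply: ww'.
by apply: conn_mono ur => p [rp sp [wp|?]]; split=> //; [left; apply: ww'|right].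
Qed.

Lemma einc_and (A B : (site -> bool) -> Prop) : einc A -> einc B -> einc (fun w => A w /\ B w).
Proof. by move=> iA iB w w' ww' [Aw Bw]; split; [exact: iA Aw|exact: iB Bw]. Qed.

(** Some strip [j] carries an average share of the probability of a hook. The hook, its mirror image
    and the short horizontal crossing are increasing, so Harris combines them, and gluing lengthens
    the width [2 * mu] to [4 * mu - 2 * t]. *)
Lemma ph_extend (q t mu : int) (r : nat) : 1 <= q -> 0 < t -> t <= mu -> (0 < r)%N ->
  (pv (2 * t) (2 * q) * ph (2 * mu) (2 * (r%:Z * q)) / r%:R) ^+ 2 * ph (2 * t) (2 * q) <=
  ph (4 * mu - 2 * t) (2 * (r%:Z * q)).
Proof.
move=> q1 t0 tmu r0; set N := 2 * (r%:Z * q).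
pose X (j : 'I_r) := hooked q t (2 * mu) (rlo q r j) (rlo q r j + N).
have lohi (j : 'I_r) := rlo_le q1 (ltn_ord j).
have fX j : fes (X j) by have [? ?] := lohi j; apply: fes_hooked; lia.
have sum_le : pv (2 * t) (2 * q) * ph (2 * mu) N <= \sum_(j < r) Pr (X j).
  apply: (@mix_le R _ (fun w p => `[< explored q t w p >])
    (region (rect true 0 (2 * t) 0 (2 * q)) (rectM 0 (2 * t) 0 (2 * q)))
    _ _ _ _ _ _ (fun j : 'I_r => refl q j)).
  - move=> w w' ww'; apply: funext => p; rewrite (@explored_supp q t q1 w w') // => v rv sv.
    by apply: ww'; rewrite mem_region; [apply/asboolP|exact: rect_bound].
  - move=> w w' ww'; apply: funext => p; rewrite (@explored_stop q t w w') // => v ev.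
    by apply: ww'; apply/asboolP.
  - exact: fes_VC.
  - exact: fes_HC.
  - exact: fX.
  - by move=> j; apply: can_inj (reflK q j).
  - move=> w w' Vw Hw'.
    have [j jr Xj] := fold_hooked q1 r0 (ltW t0) (ltac:(lia) : 2 * t <= 2 * mu) Vw Hw'.
    by exists (Ordinal jr).
set x := pv _ _ * _ in sum_le *.
have [j xj] : exists j, x / r%:R <= Pr (X j).
  apply: contrapT => nex.
  have : \sum_(j < r) Pr (X j) < \sum_(j < r) x / r%:R.
    apply: ltr_sum => [|j _]; first by apply/hasP; exists (Ordinal r0); rewrite ?mem_index_enum.
    by rewrite ltNge; apply/negP => xj; apply: nex; exists j.
  rewrite sumr_const card_ord -[_ *+ r]mulr_natr mulfVK ?pnatr_eq0 -?lt0n //.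
  by rewrite ltNge sum_le.
have x0 : 0 <= x / r%:R.
  apply: divr_ge0; last exact: ler0n.
  by apply: mulr_ge0; [apply: Pr_ge0; exact: fes_VC|exact: ph_ge].
have fm : fes (fun w => X j (w \o mirror t)) by apply: fes_map.
have iX : einc (X j) by apply: einc_hooked.
have im : einc (fun w => X j (w \o mirror t)) by move=> w w' ww'; apply: iX => v; exact: ww'.
have Pm : Pr (fun w => X j (w \o mirror t)) = Pr (X j).
  by apply: Pr_map => //; apply: inv_inj (mirrorK t).
have fH := fes_HC true 0 (2 * t) 0 (2 * q).
have h1 := Pr_harris R (fX j) fm iX im.
have h2 := Pr_harris R (fes_and (fX j) fm) fH (einc_and iX im) (@einc_HC _ _ _ _ _).
rewrite Pm in h1.
have [lo0 hi0] := lohi j.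
(* A lattice translation by [be] rows shifts [sh true] by [be] modulo 2, so moving the rectangle to
   the origin requires an even bottom row. *)
have [L eL] : exists L, rlo q r j = 2 * L.
  by rewrite /rlo; case: (odd j); eexists; [rewrite -!mulrDr -mulrBr|rewrite mulNr -mulrN].
rewrite -(@Pr_HC_shift (t - mu - L) (2 * L) (4 * mu - 2 * t) N (2 * t - 2 * mu) (2 * mu) (rlo q r j)
  (rlo q r j + N)); [|lia|lia|lia|lia].
apply: le_trans (le_trans h2 _); last first.
  apply: Pr_le; [exact: fes_and (fes_and _ _) _|exact: fes_HC|].
  move=> w [[X1 X2] H]; exact: (hooked_glue (q := q) (t := t)).
apply: ler_wpM2r; first exact: ph_ge.
apply: le_trans h1; rewrite expr2; exact: ler_pM.
Qed.

(** A closed vertical crossing of the union either stays inside one of the two rectangles, or has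
    sites on both sides of the overlap and then crosses it horizontally, against the open vertical
    crossing [V]. *)
Lemma HC_glue (a a' b b' N : int) (w : site -> bool) : 0 <= N -> a <= a' -> b <= b' ->
  HC true a b 0 N (fun p => w p) -> HC true a' b' 0 N (fun p => w p) ->
  VC true a' b 0 N (fun p => w p) -> HC true a b' 0 N (fun p => w p).
Proof.
move=> N0 aa bb H1 H2 V; have [//|[u [v [uv u0 v0]]]] := HC_or_VC true a b' (fun p => w p) N0.
exfalso; pose Z := VCz true a b' 0 N (fun p => ~ w p).
have [A1|/existsNP[p1 /not_implyP[up1 s1]]] := pselect (forall p, conn Z u p -> sh true p <= b).
  apply: (HC_VC_exclusive N0 H1); exists u, v; split=> //.
  apply: conn_mono (conn_cluster uv) => p up; have [rp sp np] := conn_r up.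
  by split=> //; have := A1 _ up; lia.
have [A2|/existsNP[p2 /not_implyP[up2 s2]]] := pselect (forall p, conn Z u p -> a' <= sh true p).
  apply: (HC_VC_exclusive N0 H2); exists u, v; split=> //.
  apply: conn_mono (conn_cluster uv) => p up; have [rp sp np] := conn_r up.
  by split=> //; have := A2 _ up; lia.
apply: (@HC_VC_exclusive true a' b 0 N (fun p => ~ w p)) => //; last first.
  by apply: VC_sub V => p [_ _ wp] /(_ wp).
exists p2, p1; split; [|lia|lia].
apply: conn_mono (conn_trans (conn_sym up2) up1) => p [rp _ np]; split=> //; by left.
Qed.

(** Balanced half-widths [t] at height [2 * q] and [T] at height [14 * q] satisfy [t <= 3 * q] and
    [7 * q <= T], so one extension with [r = 7] gains at least [8 * q]. Each further gluing overlaps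
    the previous rectangle in width [2 * T], where vertical crossings have probability at least 1/2,
    and gains [8 * q] again. *)
Theorem rsw (J : nat) : exists2 c : R, 0 < c & forall q : int, 1 <= q ->
  c <= ph (8 * q * J%:Z) (14 * q).
Proof.
pose c1 : R := (1 / 2 * (1 / 4) / 7%:R) ^+ 2 * (1 / 4).
have c1_gt0 : 0 < c1 by rewrite /c1 mulr_gt0 // ?exprn_gt0 //; lra.
pose c := fix f n : R := if n is n'.+1 then f n' * c1 * (1 / 2) else 1 / 4.
have cpos n : 0 < c n by elim: n => [|n IH] /=; rewrite ?mulr_gt0 //; lra.
exists (c J) => // q q1.
have [t [tq Vt Ht]] := exists_balanced_width q1.
have [T [TQ VT HT]] := @exists_balanced_width (7 * q) ltac:(lia).
have e14 : 2 * (7 * q) = 14 * q by lia.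
rewrite e14 in VT HT.
have base : c1 <= ph (2 * T + 8 * q) (14 * q).
  apply: le_trans (le_trans (@ph_extend q t T 7 q1 _ _ _) _); [|lia|lia|by []|].
    have -> : 2 * (7%:Z * q) = 14 * q by lia.
    rewrite /c1; apply: ler_pM; [by apply: exprn_ge0; lra|lra| |by []].
    rewrite ler_pXn2r ?nnegrE //; last first.
    - by apply: divr_ge0; rewrite ?ler0n // mulr_ge0 //; [apply: Pr_ge0; exact: fes_VC|exact: ph_ge].
    - by apply: ler_wpM2r; [rewrite invr_ge0 ler0n|apply: ler_pM => //; lra].
  have -> : 2 * (7%:Z * q) = 14 * q by lia.
  by apply: ph_mono; lia.
suff main : c J <= ph (2 * T + 8 * q * J%:Z) (14 * q).
  by apply: le_trans main _; apply: ph_mono; lia.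
elim: J => [|J IH]; first by rewrite mulr0 addr0; exact: HT.
set a := 8 * q * J%:Z in IH *.
have e1 : 8 * q * J.+1%:Z = a + 8 * q by rewrite /a; lia.
rewrite e1 [c _]/=.
have N0 : 0 <= 14 * q by lia.
have a0 : 0 <= a by apply: mulr_ge0; lia.
have PB : c1 <= Pr (fun w : site -> bool => HC true a (2 * T + (a + 8 * q)) 0 (14 * q) (fun p => w p)).
  rewrite (@Pr_HC_shift (4 * q * J%:Z) 0 (2 * T + 8 * q) (14 * q)) //; rewrite /a; lia.
have PV : 1 / 2 <= Pr (fun w : site -> bool => VC true a (2 * T + a) 0 (14 * q) (fun p => w p)).
  rewrite (@Pr_VC_shift (4 * q * J%:Z) (2 * T)) //; rewrite /a; lia.
have h1 := Pr_harris R (fes_HC true 0 (2 * T + a) 0 (14 * q))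
  (fes_HC true a (2 * T + (a + 8 * q)) 0 (14 * q)) (@einc_HC _ _ _ _ _) (@einc_HC _ _ _ _ _).
have f2 := fes_and (fes_HC true 0 (2 * T + a) 0 (14 * q))
  (fes_HC true a (2 * T + (a + 8 * q)) 0 (14 * q)).
have h2 := Pr_harris R f2 (fes_VC true a (2 * T + a) 0 (14 * q))
  (einc_and (@einc_HC _ _ _ _ _) (@einc_HC _ _ _ _ _)) (@einc_VC _ _ _ _ _).
apply: le_trans (le_trans h2 _); last first.
  apply: Pr_le; [exact: fes_and f2 (fes_VC _ _ _ _ _)|exact: fes_HC|].
  move=> w [[H1 H2] V]; apply: HC_glue H1 H2 V => //; clear -a0 q1 TQ; lia.
have cJ := cpos J.
apply: ler_pM; [by rewrite mulr_ge0 //; lra|lra| |exact: PV].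
by apply: le_trans h1; apply: ler_pM => //; lra.
Qed.

End RSW.

(** * One-arm decay *)

Definition rot (p : site) : site := (p.2, - p.1 - p.2).

(** Its sublevel sets are triangles invariant under [rot], a rotation of order 3, so three rotated
    copies of one crossing surround them. *)
Definition lev (p : site) : int := Num.max p.1 (Num.max p.2 (- p.1 - p.2)).

Lemma rot3 p : rot (rot (rot p)) = p.
Proof. by apply: site_eq; rewrite /rot /=; lia. Qed.

Lemma rot_inj : injective rot.
Proof. by move=> p p' e; rewrite -(rot3 p) e rot3. Qed.

Lemma rot_adj p p' : adj p p' -> adj (rot p) (rot p').
Proof. by rewrite /adj /rot /=; lia. Qed.

Lemma lev_rot p : lev (rot p) = lev p.
Proof. by rewrite /lev /rot /=; lia. Qed.

Lemma lev_adj p p' : adj p p' -> lev p' <= lev p + 1.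
Proof. by rewrite /adj /lev; lia. Qed.

(* The three rotated images of the crossing form a closed triangle that
   separates [lev <= N] from [2N <= lev]. *)
Definition fence (N : int) (w : site -> bool) : Prop :=
  [/\ HC true (- (6 * N)) (6 * N) N (2 * N) (fun p => w p),
      HC true (- (6 * N)) (6 * N) N (2 * N) (fun p => w (rot p)) &
      HC true (- (6 * N)) (6 * N) N (2 * N) (fun p => w (rot (rot p)))].

Lemma arm_VC (N : int) (w : site -> bool) p0 b : 0 < N -> lev p0 <= N ->
  conn (fun p => w p /\ lev p <= 2 * N) p0 b -> b.2 = 2 * N ->
  VC true (- (6 * N)) (6 * N) N (2 * N) (fun p => w p).
Proof.
move=> N0 l0 p0b b2.
have [/conn_r[_]|[c [d [bc cd [wd ld] nd _]]]] :=
  conn_exit (P := fun p : site => N < p.2) (conn_sym p0b) ltac:(lia).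
  by move: l0; rewrite /lev; lia.
have [[wc lc] c2] := conn_r bc.
have d2 : d.2 = N by move: cd; rewrite /adj; lia.
exists d, b; split=> //; apply: conn_sym; apply: (@connS _ _ c) => //; last first.
  by split=> //; move: ld; rewrite /rows /lev /sh d2; lia.
apply: conn_mono bc => p [[wp lp] p2]; split=> //; move: lp; rewrite /rows /lev /sh; lia.
Qed.

(** When the arm first reaches level [2 * N], one of the three linear forms in [lev] equals [2 * N].
    A rotation makes this form the row, and the arm then contradicts the corresponding closed
    crossing. *)
Lemma fence_block (N : int) (w : site -> bool) p0 p1 : 0 < N -> lev p0 <= N ->
  2 * N <= lev p1 -> conn (fun p => w p) p0 p1 -> ~ fence N (fun p => ~~ w p).
Proof.
move=> N0 l0 l1 p01 [F1 F2 F3].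
have [/conn_r[_ /=]|[a [b [p0a ab wb nb _]]]] :=
  conn_exit (P := fun p => lev p < 2 * N) p01 ltac:(lia); first lia.
have [_ la] := conn_r p0a; have lb := lev_adj ab.
have p0b : conn (fun p => w p /\ lev p <= 2 * N) p0 b.
  apply: (@connS _ _ a) => //; last by split=> //; lia.
  by apply: conn_mono p0a => p [wp lp]; split=> //; lia.
have NN : N <= 2 * N by lia.
have contra (w' : site -> bool) : HC true (- (6 * N)) (6 * N) N (2 * N) (fun p => ~~ w' p) ->
    VC true (- (6 * N)) (6 * N) N (2 * N) (fun p => w' p) -> False.
  move=> F V; apply: (HC_VC_exclusive NN F).
  by apply: VC_sub V => p [_ _ wp]; rewrite wp.
have r1 p : conn (fun p => w p /\ lev p <= 2 * N) p0 p ->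
    conn (fun p => w (rot (rot p)) /\ lev p <= 2 * N) (rot p0) (rot p).
  apply: (@conn_map _ _ rot) => [x y xy|x [wx lx]]; first by right; apply: rot_adj.
  by rewrite rot3 lev_rot.
have r2 p : conn (fun p => w p /\ lev p <= 2 * N) p0 p ->
    conn (fun p => w (rot p) /\ lev p <= 2 * N) (rot (rot p0)) (rot (rot p)).
  apply: (@conn_map _ _ (fun p => rot (rot p))) => [x y xy|x [wx lx]]; first by right; apply/rot_adj/rot_adj.
  by rewrite rot3 !lev_rot.
have [b2|[b2|b2]] : b.2 = 2 * N \/ - b.1 - b.2 = 2 * N \/ b.1 = 2 * N.
  by move: nb lb la; rewrite /lev; lia.
- exact: contra F1 (arm_VC N0 l0 p0b b2).
- apply: (contra (fun p => w (rot (rot p)))) => //.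
  by apply: (arm_VC N0 _ (r1 _ p0b)); rewrite ?lev_rot.
- apply: (contra (fun p => w (rot p))) => //.
  apply: (arm_VC N0 _ (r2 _ p0b)); rewrite ?lev_rot //.
  by rewrite /rot /=; lia.
Qed.

Definition annulus (N : int) (p : site) : Prop := N <= lev p <= 3 * N.

Lemma fence_loc (N : int) (w w' : site -> bool) : 0 < N ->
  (forall p, annulus N p -> w p = w' p) -> fence N w -> fence N w'.
Proof.
move=> N0 ww'.
have ann p : rect true (- (6 * N)) (6 * N) N (2 * N) p -> annulus N p.
  by rewrite /rect /rows /sh /annulus /lev => -[]; lia.
by move=> [F1 F2 F3]; split; [apply: HC_loc F1|apply: (HC_loc (w := fun p => w (rot p))) F2|
  apply: (HC_loc (w := fun p => w (rot (rot p)))) F3] => p /ann ap; apply: ww';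
  rewrite /annulus ?lev_rot.
Qed.

Lemma annulus_bound (N : int) p : lev p <= 3 * N ->
  `|p.1| <= (absz (6 * N)%R)%:Z /\ `|p.2| <= (absz (6 * N)%R)%:Z.
Proof. by rewrite /lev; lia. Qed.

Section ArmDecay.
Variable R : realType.
Local Notation Pr := (Pr R).

(** For [N = 14 * q] the width [12 * N] is [8 * q * 21], hence the 21. The cube comes from Harris
    for three rotated crossings of equal probability. *)
Lemma Pr_fence : exists2 c : R, 0 < c & forall q : int, 1 <= q ->
  c <= Pr (fun w => fence (14 * q) (fun p => ~~ w p)).
Proof.
have [c c0 Hc] := rsw R 21; exists (c ^+ 3); first exact: exprn_gt0.
move=> q q1; pose N := 14 * q.
have fF : fes (fence N).
  exists (region (annulus N) (absz (6 * N)%R)); apply: esupp_region => [p /andP[_]|w w' ww'].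
    exact: annulus_bound.
  by apply: fence_loc => //; rewrite /N; lia.
rewrite (Pr_neg R fF).
pose H (w : site -> bool) := HC true (- (6 * N)) (6 * N) N (2 * N) (fun p => w p).
have fH : fes H by apply: fes_HC.
have iH : einc H by apply: einc_HC.
have cH : c <= Pr H.
  rewrite /H (@Pr_HC_shift R (- (49 * q)) N (8 * q * 21) N); [exact: Hc| | | |]; rewrite /N; lia.
have f1 : fes (fun w => H (w \o rot)) by apply: fes_map.
have f2 : fes (fun w => H ((w \o rot) \o rot)) by apply: (fes_map rot f1).
have i1 : einc (fun w : site -> bool => H (w \o rot)) by move=> w w' ww'; apply: iH => v; exact: ww'.
have i2 : einc (fun w : site -> bool => H ((w \o rot) \o rot)) by move=> w w' ww'; apply: iH => v; exact: ww'.
have P1 : Pr (fun w => H (w \o rot)) = Pr H by apply: (Pr_map R rot_inj).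
have P2 : Pr (fun w => H ((w \o rot) \o rot)) = Pr H.
  by rewrite -P1 -[RHS](Pr_map R rot_inj).
have h1 := Pr_harris R fH f1 iH i1.
have h2 := Pr_harris R (fes_and fH f1) f2 (einc_and iH i1) i2.
apply: le_trans (le_trans h2 _); last first.
  by apply: Pr_le; [exact: fes_and (fes_and _ _) _|exact: fF|move=> w [[]]; split].
rewrite P2; rewrite P1 in h1.
have -> : c ^+ 3 = c * c * c by ring.
apply: ler_pM => //; [by rewrite mulr_ge0 // ltW|exact: ltW|].
by apply: le_trans h1; apply: ler_pM => //; apply: ltW.
Qed.

(** The factor 14 is the height in [rsw]; the ratio 4 makes the annuli, which end at [3 * N],
    disjoint and the fences independent. *)
Definition scale (k : nat) : int := 14 * (4 ^ k)%N%:Z.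

Lemma scaleS k : scale k.+1 = 4 * scale k.
Proof. by rewrite /scale expnS; lia. Qed.

Lemma scale_gt0 k : 0 < scale k.
Proof. by rewrite /scale; have := expn_gt0 4 k; lia. Qed.

Lemma scale_mono k k' : (k <= k')%N -> scale k <= scale k'.
Proof. by move=> kk'; have := leq_pexp2l (isT : (0 < 4)%N) kk'; rewrite /scale; lia. Qed.

Definition unfenced (K : nat) (w : site -> bool) : Prop :=
  forall k, (k < K)%N -> ~ fence (scale k) (fun p => ~~ w p).

Lemma unfenced_supp K :
  esupp (region (fun p => lev p < scale K) (absz (6 * scale K)%R)) (unfenced K).
Proof.
have s0 := scale_gt0 K.
apply: esupp_region => [p lp|w w' ww' U k kK F].
  by apply: annulus_bound; lia.
apply: (U k kK); apply: fence_loc F; first exact: scale_gt0.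
move=> p /andP[_ lp]; rewrite ww' //.
by have := scale_mono kK; have := scale_gt0 k; rewrite scaleS; lia.
Qed.

Lemma fes_unfenced K : fes (unfenced K).
Proof. by exists (region (fun p => lev p < scale K) (absz (6 * scale K)%R)); exact: unfenced_supp. Qed.

Lemma Pr_unfenced : exists rho : R, [/\ 0 < rho, rho < 1 & forall K, Pr (unfenced K) <= rho ^+ K].
Proof.
have [c c0 Hc] := Pr_fence.
have fF k : esupp (region (annulus (scale k)) (absz (6 * scale k)%R))
    (fun w => ~ fence (scale k) (fun p => ~~ w p)).
  apply: esupp_region => [p /andP[_]|w w' ww' nF F]; first exact: annulus_bound.
  by apply: nF; apply: fence_loc F; [exact: scale_gt0|move=> p ap; rewrite ww'].
have fFs k : fes (fun w => ~ fence (scale k) (fun p => ~~ w p)) by eexists; exact: fF.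
have fFp k : fes (fun w => fence (scale k) (fun p => ~~ w p)).
  have [D sD] := fFs k; exists D => w w' ww' F; apply: contrapT => nF.
  by apply: (sD w' w) F => // p pD; rewrite ww'.
have Hk k : Pr (fun w => ~ fence (scale k) (fun p => ~~ w p)) <= 1 - c.
  rewrite Pr_not // lerD2l lerN2; apply: Hc.
  by have := expn_gt0 4 k; lia.
have c1 : c <= 1 by have := Hk 0%N; have := Pr_ge0 R (fFs 0%N); lra.
(* Halving [c] keeps the base positive even if [c = 1]. *)
exists (1 - c / 2); split; [lra|lra|].
elim=> [|K IH]; first by rewrite expr0; apply: Pr_le1; exact: fes_unfenced.
rewrite (Pr_ext R (B := fun w => unfenced K w /\ ~ fence (scale K) (fun p => ~~ w p))); last first.
  move=> w; split=> [U|[U nF] k kK]; first by split=> [k kK|]; apply: U => //; lia.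
  have [e|h] : k = K \/ (k < K)%N by lia.
    by rewrite e.
  exact: U.
rewrite (Pr_indep R (@unfenced_supp K) (fF K)); last first.
  move=> p; rewrite !mem_region.
  - by move=> /asboolP lp; apply/asboolP => /andP[]; lia.
  - by move=> x /andP[_]; exact: annulus_bound.
  - by move=> x lx; apply: annulus_bound; have := scale_gt0 K; lia.
rewrite exprSr; apply: ler_pM => //; [exact/Pr_ge0/fes_unfenced|exact: Pr_ge0|].
by apply: le_trans (Hk K) _; lra.
Qed.

(** Sites outside the image of [iota] count as closed, which only hinders the arm, so the bound on
    the whole lattice holds uniformly near the boundary of any finite region. *)
Lemma arm_decay : exists rho : R, [/\ 0 < rho, rho < 1 &
  forall (V : finType) (iota : V -> site) (u : V) (K : nat), injective iota ->
  Pr (fun w : V -> bool => exists v,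
    conn (fun p => exists x, p = iota x /\ w x) (iota u) (iota v) /\
    2 * scale K <= `|(iota v).1 - (iota u).1|) <= rho ^+ K].
Proof.
have [rho [r0 r1 H]] := Pr_unfenced; exists rho; split=> // V iota u K iI.
set E := fun w : V -> bool => _.
have fE : fes E.
  exists (enum V) => w w' ww'; suff -> : w = w' by [].
  by apply: funext => x; rewrite ww' ?mem_enum.
apply: le_trans (H K).
have sI := @shift_inj (iota u).1 (iota u).2.
rewrite -(Pr_map R iI fE) -(Pr_map R sI (fes_unfenced K)).
apply: Pr_le; [exact: (fes_map iota fE)|exact: (fes_map _ (fes_unfenced K))|].
move=> w [v [uv d]] k kK.
apply: (@fence_block (scale k) _ (0, 0) (shift (- (iota u).1) (- (iota u).2) (iota v))).
- exact: scale_gt0.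
- by rewrite /lev /=; have := scale_gt0 k; lia.
(* A displacement to the left guarantees only half of its length as [lev], attained midway between
   the other two forms; hence the factor 2 in the distance. *)
- have := scale_mono kK; rewrite scaleS; have := scale_gt0 k.
  by rewrite /lev /shift /=; lia.
have -> : (0, 0) = shift (- (iota u).1) (- (iota u).2) (iota u).
  by apply: site_eq; rewrite /shift /=; lia.
apply: conn_map uv => [p p' a|p [x [-> wx]]].
  by right; move: a; rewrite /adj /shift /=; lia.
move: wx; rewrite /= => wx; rewrite (_ : shift _ _ _ = iota x) //.
by apply: site_eq; rewrite /shift /=; lia.
Qed.

End ArmDecay.

(** * The OSSS inequality *)

Section DecisionTree.
Variables (R : realType) (V : finType).
Implicit Types (w : V -> bool) (K O : {set V}) (F G : (V -> bool) -> R) (v u : V).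

Lemma ExL F G (a b : R) : Ex (fun w => a * F w + b * G w) = a * Ex F + b * Ex G.
Proof. by apply: Ex_lin; exact: fsupp_fin. Qed.

Lemma ExZ F (a : R) : Ex (fun w => a * F w) = a * Ex F.
Proof.
have := ExL F F a 0; rewrite mul0r addr0 => <-.
by congr Ex; apply: funext => w; rewrite mul0r addr0.
Qed.

Lemma ExD F G : Ex (fun w => F w + G w) = Ex F + Ex G.
Proof.
have := ExL F G 1 1; rewrite !mul1r => <-.
by congr Ex; apply: funext => w; rewrite !mul1r.
Qed.

Lemma ExB F G : Ex (fun w => F w - G w) = Ex F - Ex G.
Proof.
have := ExL F G 1 (-1); rewrite !mul1r mulN1r => <-.
by congr Ex; apply: funext => w; rewrite mul1r mulN1r.
Qed.

Lemma Ex_leF F G : (forall w, F w <= G w) -> Ex F <= Ex G.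
Proof. by apply: Ex_le; exact: fsupp_fin. Qed.

Lemma Ex_ge0 F : (forall w, 0 <= F w) -> 0 <= Ex F.
Proof. by move=> F0; rewrite -[0](@Ex_cst R V); apply: Ex_leF. Qed.

Lemma Ex_split v F :
  Ex F = (Ex (fun w => F (upd w v true)) + Ex (fun w => F (upd w v false))) / 2.
Proof.
rewrite -ExD.
transitivity (Ex (avg1 v F)).
  rewrite !(ExE (fun=> false) (supp_fin _)) Avg_avg1 /avg1.
  rewrite (Avg_supp_cst _ (fun=> false) (supp_fin F)).
  by rewrite (Avg_supp_cst (upd _ _ false) (fun=> false) (supp_fin F)); lra.
rewrite (_ : avg1 v F = fun w => 2^-1 * (F (upd w v true) + F (upd w v false))).
  by rewrite ExZ mulrC.
by apply: funext => w; rewrite /avg1 mulrC.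
Qed.

Lemma Ex_sumF (I : Type) (r : seq I) (F : I -> (V -> bool) -> R) :
  Ex (fun w => \sum_(i <- r) F i w) = \sum_(i <- r) Ex (F i).
Proof. by apply: (Ex_sum _ _).2 => i; exact: fsupp_fin. Qed.

Definition infl (g : (V -> bool) -> R) v : R :=
  Ex (fun w => `|g (upd w v true) - g (upd w v false)|).

Variable nxt : {set V} -> {set V} -> option V.
Hypothesis nxt_new : forall K O v, nxt K O = Some v -> v \notin K.

(* [run n K O w] is the set of queried sites after [n] further queries, where
   [K] has already been queried and [O] is the set of sites of [K] found open. *)
Fixpoint run (n : nat) K O w : {set V} :=
  if n is n'.+1 then
    if nxt K O is Some v then run n' (v |: K) (if w v then v |: O else O) w else K
  else K.

Lemma run_sub n K O w : K \subset run n K O w.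
Proof.
elim: n K O => //= n IH K O; case: (nxt K O) => // v.
exact: subset_trans (subsetUr _ _) (IH _ _).
Qed.

Lemma run_loc n K O w w' :
  (forall v, v \notin K -> v \in run n K O w -> w v = w' v) -> run n K O w' = run n K O w.
Proof.
elim: n K O => //= n IH K O; case e: (nxt K O) => [v|//] H.
rewrite -(H v (nxt_new e)); last by apply: (subsetP (run_sub _ _ _ _)); rewrite setU11.
apply: IH => u; rewrite in_setU1 negb_or => /andP[_ uK] ur.
by apply: H.
Qed.

Lemma run_upd n K O w v b : v \in K -> run n K O (upd w v b) = run n K O w.
Proof.
move=> vK; apply: run_loc => u uK _; rewrite /upd; case: eqP => // e.
by rewrite e vK in uK.
Qed.

Lemma run_step n K O v w b : nxt K O = Some v ->
  run n.+1 K O (upd w v b) = run n (v |: K) (if b then v |: O else O) w.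
Proof. by move=> e; rewrite /= e /upd eqxx run_upd ?setU11. Qed.

Definition reveal n K O v : R := Ex (fun w => ((v \in run n K O w) && (v \notin K))%:R).

Lemma reveal_step n K O v u : nxt K O = Some v ->
  reveal n.+1 K O u = (u == v)%:R +
    (reveal n (v |: K) (v |: O) u + reveal n (v |: K) O u) / 2.
Proof.
move=> e; rewrite /reveal (Ex_split v).
case: (eqVneq u v) => [->|uv].
  have c b : (fun w => ((v \in run n.+1 K O (upd w v b)) && (v \notin K))%:R) = (fun=> 1 : R).
    apply: funext => w; rewrite (run_step _ _ _ e) (nxt_new e) andbT.
    by rewrite (subsetP (run_sub _ _ _ _)) // setU11.
  have z O' : (fun w => ((v \in run n (v |: K) O' w) && (v \notin v |: K))%:R) = (fun=> 0 : R).
    by apply: funext => w; rewrite setU11 andbF.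
  by rewrite !c !z !Ex_cst mulr1n; lra.
have c b : (fun w => ((u \in run n.+1 K O (upd w v b)) && (u \notin K))%:R : R) =
    (fun w => ((u \in run n (v |: K) (if b then v |: O else O) w) && (u \notin v |: K))%:R).
  by apply: funext => w; rewrite (run_step _ _ _ e) in_setU1 negb_or uv.
by rewrite !c mulr0n add0r.
Qed.

(** Fixing the first queried site in [f] but not in [g] leaves the influences of [g] untouched. The
    covariance exceeds the mean of the two restricted covariances by exactly a quarter of the
    expected product of the increments of [f] and [g] at that site, which explains the factor
    1/4. *)
Lemma osss n K O (f g : (V -> bool) -> R) : (forall w, 0 <= f w <= 1) ->
  (forall w w', (forall v, v \notin K -> v \in run n K O w -> w v = w' v) -> f w = f w') ->
  Ex (fun w => f w * g w) - Ex f * Ex g <= (\sum_v reveal n K O v * infl g v) / 4.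
Proof.
have rge n' K' O' v : 0 <= reveal n' K' O' v by apply: Ex_ge0 => w; rewrite ler0n.
have ige v : 0 <= infl g v by apply: Ex_ge0.
have sge n' K' O' : 0 <= (\sum_v reveal n' K' O' v * infl g v) / 4.
  by rewrite divr_ge0 // sumr_ge0 // => v _; rewrite mulr_ge0.
have cst n' K' O' (f' : (V -> bool) -> R) : (forall w w', f' w = f' w') ->
    Ex (fun w => f' w * g w) - Ex f' * Ex g <= (\sum_v reveal n' K' O' v * infl g v) / 4.
  move=> fc; have -> : f' = fun=> f' (fun=> false) by apply: funext => w; apply: fc.
  by rewrite ExZ Ex_cst subrr.
elim: n K O f => [|n IH] K O f f01 fdet.
  by apply: cst => w w'; apply: fdet => v /= /negbTE ->.
case e: (nxt K O) => [v|]; last first.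
  by apply: cst => w w'; apply: fdet => v /=; rewrite e => /negbTE ->.
pose fb b w := f (upd w v b).
pose gb b w := g (upd w v b).
have updu b c w : upd (upd w v c) v b = upd w v b by rewrite upd_upd.
have Hb b : Ex (fun w => fb b w * g w) - Ex (fb b) * Ex g <=
    (\sum_u reveal n (v |: K) (if b then v |: O else O) u * infl g u) / 4.
  apply: IH => [w|w w' ww']; first exact: f01.
  apply: fdet => u uK; rewrite (run_step _ _ _ e) => ur; rewrite /upd.
  by case: eqP => // /eqP uv; apply: ww'; rewrite // in_setU1 negb_or uv.
have e1 : Ex f = (Ex (fb true) + Ex (fb false)) / 2 by rewrite (Ex_split v).
have e2 : Ex (fun w => f w * g w) =
    (Ex (fun w => fb true w * gb true w) + Ex (fun w => fb false w * gb false w)) / 2.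
  by rewrite (Ex_split v).
have e3 b : Ex (fun w => fb b w * g w) =
    (Ex (fun w => fb b w * gb true w) + Ex (fun w => fb b w * gb false w)) / 2.
  by rewrite (Ex_split v); congr (_ / _); congr (_ + _); congr Ex; apply: funext => w;
    rewrite /fb updu.
have e4 : Ex (fun w => fb true w * gb true w) + Ex (fun w => fb false w * gb false w)
    - Ex (fun w => fb true w * gb false w) - Ex (fun w => fb false w * gb true w) <= infl g v.
  rewrite -ExD -ExB -ExB; apply: Ex_leF => w.
  rewrite (_ : _ - _ = (fb true w - fb false w) * (gb true w - gb false w)); last by ring.
  apply: le_trans (ler_norm _) _; rewrite normrM -[leRHS]mul1r.
  apply: ler_wpM2r; first exact: normr_ge0.
  by have := f01 (upd w v true); have := f01 (upd w v false); rewrite ler_norml /fb; lra.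
have e5 : \sum_u reveal n.+1 K O u * infl g u = infl g v +
    (\sum_u reveal n (v |: K) (v |: O) u * infl g u + \sum_u reveal n (v |: K) O u * infl g u) / 2.
  rewrite -big_split /= mulr_suml.
  rewrite (bigD1 v) //= [in RHS](bigD1 v) //= (reveal_step _ _ e) eqxx mulr1n.
  rewrite (eq_bigr (fun u => (reveal n (v |: K) (v |: O) u * infl g u +
    reveal n (v |: K) O u * infl g u) / 2)); first by set S := \sum_(_ | _) _; lra.
  by move=> u uv; rewrite (reveal_step _ _ e) (negbTE uv) mulr0n add0r; lra.
have := Hb true; have := Hb false; have := e3 true; have := e3 false.
rewrite e1 e2 e5 /=.
set x1 := Ex (fun w => fb true w * g w); set x2 := Ex (fun w => fb false w * g w).
lra.
Qed.

Definition sgn w v : R := if w v then 1 else -1.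

(** The revealed signs form a martingale: each is fair given the past, so squares add up to one per
    query. *)
Lemma run_variance n K O (a : R) :
  Ex (fun w => (a + \sum_(v in run n K O w :\: K) sgn w v) ^+ 2) =
  a ^+ 2 + Ex (fun w => (#|run n K O w :\: K|)%:R).
Proof.
have base K' w (b : R) : (b + \sum_(v in K' :\: K') sgn w v) ^+ 2 = b ^+ 2 + (#|K' :\: K'|)%:R.
  by rewrite setDv big_set0 cards0 !addr0.
elim: n K O a => [|n IH] K O a.
  by rewrite /= -[a ^+ 2](@Ex_cst R V) -ExD; congr Ex; apply: funext => w; apply: base.
case e: (nxt K O) => [v|]; last first.
  rewrite /= e -[a ^+ 2](@Ex_cst R V) -ExD; congr Ex; apply: funext => w; exact: base.
have vK := nxt_new e.
have S b w : run n.+1 K O (upd w v b) :\: K =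
    v |: (run n (v |: K) (if b then v |: O else O) w :\: (v |: K)).
  rewrite (run_step _ _ _ e); apply/setP => u; rewrite !inE negb_or.
  case: (eqVneq u v) => [->|//]; rewrite vK /=.
  by apply: (subsetP (run_sub _ _ _ _)); rewrite setU11.
have nin b w : v \notin run n (v |: K) (if b then v |: O else O) w :\: (v |: K).
  by rewrite !inE eqxx.
rewrite (Ex_split v) [X in _ = _ + X](Ex_split v).
have c1 b : Ex (fun w => (a + \sum_(u in run n.+1 K O (upd w v b) :\: K) sgn (upd w v b) u) ^+ 2)
    = Ex (fun w => ((a + (if b then 1 else -1)) +
       \sum_(u in run n (v |: K) (if b then v |: O else O) w :\: (v |: K)) sgn w u) ^+ 2).
  congr Ex; apply: funext => w; rewrite S big_setU1 //= addrA /sgn /upd eqxx.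
  congr ((_ + _) ^+ 2); apply: eq_bigr => u; rewrite !inE negb_or -andbA => /andP[/negbTE uv _].
  by rewrite uv.
have c2 b : Ex (fun w => (#|run n.+1 K O (upd w v b) :\: K|)%:R : R) =
    1 + Ex (fun w => (#|run n (v |: K) (if b then v |: O else O) w :\: (v |: K)|)%:R).
  rewrite -[X in X + _](@Ex_cst R V) -ExD; congr Ex; apply: funext => w.
  by rewrite S cardsU1 nin natrD.
rewrite !c1 !c2 !IH /=.
set x := Ex _; set y := Ex _.
by rewrite !sqrrD !expr2; lra.
Qed.

End DecisionTree.

(** * Configurations with half of the sites open *)

Section FixedLevel.
Variable V : finType.
Implicit Types (x y w : V -> bool) (v u a : V) (s : {perm V}) (m : nat).

Definition cnt x : nat := #|[set v | x v]|.

Lemma cnt_ffun (x : {ffun V -> bool}) : (\sum_v x v)%N = cnt x.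
Proof. by rewrite -big_mkcond /= sum1_card /cnt cardsE. Qed.

Lemma cnt_neg x : (cnt (fun v => ~~ x v) + cnt x = #|V|)%N.
Proof.
rewrite /cnt; have -> : [set v | ~~ x v] = ~: [set v | x v] by apply/setP => v; rewrite !inE.
by rewrite addnC cardsC.
Qed.

Lemma cnt_upd x v : ~~ x v -> cnt (upd x v true) = (cnt x).+1.
Proof.
move=> xv; rewrite /cnt.
have -> : [set u | upd x v true u] = v |: [set u | x u].
  by apply/setP => u; rewrite !inE /upd; case: eqP.
by rewrite cardsU1 inE xv.
Qed.

Lemma cnt_sub_eq x y : (forall v, x v -> y v) -> cnt x = cnt y -> x = y.
Proof.
move=> xy e; apply: funext => v.
have /setP/(_ v) : [set v | x v] = [set v | y v].
  by apply/eqP; rewrite eqEcard -/(cnt x) -/(cnt y) e leqnn andbT;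
    apply/subsetP => u; rewrite !inE; exact: xy.
by rewrite !inE.
Qed.

Lemma cnt_perm x s : cnt (x \o s) = cnt x.
Proof.
rewrite /cnt -(card_imset _ (@perm_inj _ s)); congr #|pred_of_set _|; apply/setP => v.
rewrite inE; apply/imsetP/idP => [[u]|xv]; first by rewrite inE => /= xu ->.
by exists ((s^-1)%g v); rewrite ?inE /= permKV.
Qed.

Definition top m x v : bool := v \in take m [seq u <- enum V | x u].

Lemma top_sub m x v : top m x v -> x v.
Proof. by move=> /mem_take; rewrite mem_filter => /andP[]. Qed.

Lemma cnt_top m x : (m <= cnt x)%N -> cnt (top m x) = m.
Proof.
move=> mx; rewrite /cnt (_ : [set v | top m x v] = [set v in take m [seq u <- enum V | x u]]).
  rewrite cardsE; have /card_uniqP -> : uniq (take m [seq u <- enum V | x u]).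
    by rewrite take_uniq // filter_uniq // enum_uniq.
  rewrite size_takel // size_filter; move: mx; rewrite /cnt cardE.
  by rewrite -size_filter /enum_mem -filter_predI; congr (_ <= size _)%N; apply: eq_filter => u; rewrite /= !inE andbT.
by apply/setP => v; rewrite !inE.
Qed.

(** Opening [v] inserts one entry into the list of open sites, so nothing but [v] can enter its
    first [m] entries. *)
Lemma top_lip m x v u : top m (upd x v true) u -> top m x u || (u == v).
Proof.
rewrite /top; elim: (enum V) m => //= a e IH m.
rewrite {1}/upd; case: (eqVneq a v) => [->|av].
  case: m => // m /=; rewrite inE; case xv: (x v).
    by rewrite inE => /predU1P[->|/IH]; [rewrite eqxx|move=> /orP[->|->]; rewrite ?orbT].
  move=> /predU1P[->|/IH /orP[ut|->]]; rewrite ?eqxx ?orbT //.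
  suff -> : u \in take m.+1 [seq u <- e | x u] by [].
  move: ut; set l := [seq _ <- _ | _]; elim: l m {IH} => // b l IHl [|m] //=.
  by rewrite !inE => /orP[->//|/IHl ->]; rewrite orbT.
case xa: (x a); last exact: IH.
case: m => // m; rewrite !inE /= => /predU1P[->|/IH]; first by rewrite eqxx.
by move=> /orP[->|->]; rewrite ?orbT.
Qed.

(* A level-m configuration comparable with [x] that depends on [x] in a
   1-Lipschitz way: the first m open sites, or the complement of the first m
   closed ones (on a vertex set of size 2m). *)
Definition adjust m x : V -> bool :=
  if (m <= cnt x)%N then top m x else fun v => ~~ top m (fun u => ~~ x u) v.

Lemma adjust_le m x v : (m <= cnt x)%N -> adjust m x v -> x v.
Proof. by rewrite /adjust => ->; exact: top_sub. Qed.

Lemma adjust_ge m x v : (cnt x <= m)%N -> x v -> adjust m x v.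
Proof.
rewrite /adjust; case: (leqP m (cnt x)) => [mx xm|_ _] xv; last first.
  by apply/negP => /top_sub; rewrite xv.
by rewrite (@cnt_sub_eq (top m x) x) //; [exact: top_sub|rewrite cnt_top //; lia].
Qed.

Hypothesis card_even : ~~ odd #|V|.
Let m := #|V|./2.

Lemma cardV : #|V| = (m + m)%N.
Proof. by rewrite addnn /m -[LHS]odd_double_half (negbTE card_even). Qed.

Lemma cnt_adjust x : cnt (adjust m x) = m.
Proof.
rewrite /adjust; case: leqP => [/cnt_top//|xm].
have := cnt_neg (top m (fun u => ~~ x u)); rewrite cnt_top ?cardV; first exact: addIn.
by rewrite -(leq_add2r (cnt x)) cnt_neg cardV leq_add2l ltnW.
Qed.

Lemma adjust_lip x v u : ~~ x v -> adjust m (upd x v true) u -> adjust m x u || (u == v).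
Proof.
move=> xv; case: (leqP m (cnt x)) => mx.
  rewrite /adjust mx cnt_upd // (leq_trans mx (leqnSn _)); exact: top_lip.
case: (leqP m (cnt (upd x v true))) => mx'.
  move=> /(adjust_le mx'); rewrite /upd; case: eqP => // _ xu; first by rewrite orbT.
  by rewrite adjust_ge // ltnW.
rewrite /adjust [(m <= cnt x)%N]leqNgt mx [(m <= cnt (upd _ _ _))%N]leqNgt mx' /=.
have -> : (fun u => ~~ x u) = upd (fun u => ~~ upd x v true u) v true.
  by apply: funext => z; rewrite /upd; case: eqP => // ->.
by case: (boolP (u == v)); rewrite ?orbT // => uv; rewrite orbF; apply: contra;
  move=> /top_lip; rewrite (negbTE uv) orbF.
Qed.

(** List the open sites, then the marked closed site, then the other closed sites, and match
    positions. This is the transitivity behind the averaging over relabelings. *)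
Lemma exists_perm x x' v v' : cnt x = cnt x' -> ~~ x v -> ~~ x' v' ->
  exists s, s v = v' /\ x' \o s = x.
Proof.
move=> e xv xv'.
pose l y u := enum [set z | y z] ++ u :: enum [set z | ~~ y z & z != u].
have lu y u : ~~ y u -> uniq (l y u).
  move=> yu; rewrite /l cat_uniq; apply/and3P; split; first exact: enum_uniq.
    apply/hasPn => z; rewrite in_cons => /predU1P[->|]; rewrite !mem_enum !inE //.
    by case/andP.
  by rewrite /= mem_enum inE eqxx andbF enum_uniq.
have lm y u : ~~ y u -> l y u =i predT.
  move=> yu z; rewrite /l mem_cat in_cons !mem_enum !inE.
  by case: (y z) => //=; case: eqP.
have ls y u : ~~ y u -> size (l y u) = #|V|.
  by move=> yu; rewrite -(card_uniqP (lu y u yu)); apply: eq_card => z; rewrite lm.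
pose f u := nth v' (l x' v') (index u (l x v)).
have il u : (index u (l x v) < size (l x v))%N by rewrite index_mem lm.
have f_inj : injective f.
  move=> u u' /eqP; rewrite /f nth_uniq ?lu //; last 2 first.
  - by have := il u; rewrite !ls.
  - by have := il u'; rewrite !ls.
  by move=> /eqP /(congr1 (nth v (l x v))); rewrite !nth_index ?lm.
exists (perm f_inj); split.
  rewrite permE /f /l index_cat mem_enum inE (negbTE xv) /= eqxx addn0.
  by rewrite nth_cat -!cardE -/(cnt x) -/(cnt x') e ltnn subnn.
apply: funext => u; rewrite /= permE /f {1}/l index_cat mem_enum inE /l nth_cat.
rewrite -!cardE -/(cnt x) -/(cnt x') -e.
set i := index u (v :: _).
case xu: (x u).
  have h : (index u (enum [set z | x z]) < cnt x)%N.
    by rewrite /cnt cardE index_mem mem_enum inE.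
  rewrite h.
  have : nth v' (enum [set z | x' z]) (index u (enum [set z | x z])) \in enum [set z | x' z].
    by apply: mem_nth; rewrite -cardE -/(cnt x') -e.
  by rewrite mem_enum inE.
rewrite ltnNge leq_addr /= addKn.
have : nth v' (v' :: enum [set z | ~~ x' z & z != v']) i \in
    v' :: enum [set z | ~~ x' z & z != v'].
  apply: mem_nth.
  have : (i < size (v :: enum [set z | ~~ x z & z != v]))%N.
    by rewrite /i index_mem in_cons mem_enum !inE xu /=; case: eqP.
  have := ls _ _ xv; have := ls _ _ xv'; rewrite /l !size_cat -!cardE -/(cnt x) -/(cnt x') e.
  by move=> <- /addnI <-.
by rewrite in_cons mem_enum !inE => /predU1P[->|/andP[/negbTE -> _]] //; apply/negbTE.
Qed.

End FixedLevel.

Lemma card_level (V : finType) (k : nat) :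
  #|[set x : {ffun V -> bool} | cnt x == k]| = 'C(#|V|, k).
Proof.
rewrite -card_draws -(card_imset _ (f := fun A : {set V} => [ffun v => v \in A])).
  congr #|pred_of_set _|; apply/setP => x; rewrite !inE; apply/idP/imsetP => [xk|[A]].
    exists [set v | x v]; first by rewrite inE.
    by apply/ffunP => v; rewrite ffunE inE.
  rewrite inE => /eqP <- ->; apply/eqP; rewrite /cnt; congr #|pred_of_set _|.
  by apply/setP => v; rewrite inE ffunE.
by move=> A B /ffunP AB; apply/setP => v; have := AB v; rewrite !ffunE.
Qed.

Section MonotoneEvent.
Variables (R : realType) (V : finType) (f : (V -> bool) -> bool).
Hypothesis card_even : ~~ odd #|V|.
Hypothesis f_mono : forall x y : V -> bool, (forall v, x v -> y v) -> f x -> f y.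
Let m := #|V|./2.
Hypothesis m_gt0 : (0 < m)%N.
Implicit Types (x y w : V -> bool) (v : V) (s : {perm V}).

Definition piv x v : bool := [&& ~~ x v, ~~ f x & f (upd x v true)].

Definition mean_piv : R :=
  (\sum_(x : {ffun V -> bool} | cnt x == m) (#|[set v | piv x v]|)%:R) / ('C(#|V|, m))%:R.

Let onO (p : {ffun V -> bool} * V) : bool := (cnt p.1 == m) && ~~ p.1 p.2.

Lemma card_zeros x : cnt x = m -> #|[set v | ~~ x v]| = m.
Proof. by move=> xm; have := cnt_neg x; rewrite xm (cardV card_even) => /addIn. Qed.

Lemma sum_level_pairs (F : (V -> bool) -> V -> R) :
  \sum_(p : {ffun V -> bool} * V | onO p) F p.1 p.2 =
  \sum_(x : {ffun V -> bool} | cnt x == m) \sum_(v | ~~ x v) F x v.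
Proof. by rewrite pair_big_dep. Qed.

Lemma card_pairs : (#|[set p | onO p]| = 'C(#|V|, m) * m)%N.
Proof.
apply/eqP; rewrite -(@eqr_nat R) natrM.
rewrite -sum1dep_card natr_sum (sum_level_pairs (fun _ _ => 1%:R)).
rewrite (eq_bigr (fun=> m%:R)); last first.
  by move=> x /eqP xm; rewrite -(card_zeros xm) -sum1dep_card natr_sum.
by rewrite sumr_const -card_level cardsE mulr_natl.
Qed.

(** By transitivity the sum over relabelings is the same from every starting pair. Summing it over
    all ['C(#|V|, m) * m] pairs and exchanging the sums gives the right-hand side, each relabeling
    being a bijection of the pairs. *)
Lemma orbit_sum (F : (V -> bool) -> V -> R) x v : cnt x = m -> ~~ x v ->
  (\sum_(s : {perm V}) F (x \o (s^-1)%g) (s v)) * ('C(#|V|, m) * m)%:R =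
  #|{perm V}|%:R * \sum_(y : {ffun V -> bool} | cnt y == m) \sum_(u | ~~ y u) F y u.
Proof.
move=> xm xv; pose S y u := \sum_(s : {perm V}) F (y \o (s^-1)%g) (s u).
have S_cst p : onO p -> S p.1 p.2 = S x v.
  case: p => y u /andP[/eqP /= ym /= yu]; have [t [tv yt]] := exists_perm (etrans xm (esym ym)) xv yu.
  rewrite /S (reindex_inj (mulgI (t^-1)%g)) /=; apply: eq_bigr => s _.
  rewrite permM -tv permK; congr F; apply: funext => z.
  by rewrite -yt /= invMg invgK permM.
have : \sum_(p | onO p) S p.1 p.2 = S x v * ('C(#|V|, m) * m)%:R.
  rewrite (eq_bigr (fun=> S x v)); last by move=> p; exact: S_cst.
  by rewrite sumr_const -card_pairs cardsE mulr_natr.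
rewrite /S => <-; rewrite exchange_big /= -sum_level_pairs mulrC mulr_natr -sumr_const.
apply: eq_bigr => s _.
pose h (p : {ffun V -> bool} * V) : {ffun V -> bool} * V := ([ffun z => p.1 ((s^-1)%g z)], s p.2).
have hE p : (h p).1 = p.1 \o (s^-1)%g :> (V -> bool) by apply: funext => z; rewrite ffunE.
have h_inj : injective h.
  move=> [y u] [y' u'] /= e; congr pair.
    apply/ffunP => z; have /= /ffunP/(_ (s z)) := congr1 fst e.
    by rewrite !ffunE permK.
  by have /= := congr1 snd e; apply: perm_inj.
rewrite [RHS](reindex_inj h_inj) /=; apply: eq_big => p.
  by rewrite /onO hE cnt_perm /= permK.
by rewrite hE.
Qed.

Let nS : R := #|{perm V}|%:R.

Lemma nS_gt0 : 0 < nS.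
Proof. by rewrite ltr0n; apply/card_gt0P; exists 1%g. Qed.

Let C : R := ('C(#|V|, m))%:R.

Lemma C_gt0 : 0 < C.
Proof. by rewrite ltr0n bin_gt0 (cardV card_even) leq_addr. Qed.

Lemma level_mean (F : (V -> bool) -> R) x : cnt x = m ->
  \sum_(s : {perm V}) F (x \o (s^-1)%g) =
  nS * ((\sum_(y : {ffun V -> bool} | cnt y == m) F y) / C).
Proof.
move=> xm.
have [v xv] : exists v, ~~ x v.
  have : (0 < #|[set v | ~~ x v]|)%N by rewrite card_zeros.
  by case/card_gt0P => v; rewrite inE; exists v.
have := orbit_sum (fun y _ => F y) xm xv.
rewrite (eq_bigr (fun y : {ffun V -> bool} => F y * m%:R) (P := fun y : {ffun V -> bool} => cnt y == m)); last first.
  move=> y /eqP ym; rewrite sumr_const -[_ *+ _]mulr_natr; congr (_ * _%:R).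
  by rewrite -(card_zeros ym) cardsE.
rewrite -mulr_suml natrM -/C -/nS => e.
have m0 : (m%:R : R) != 0 by rewrite pnatr_eq0 -lt0n.
have c0 := lt0r_neq0 C_gt0.
apply: (mulIf c0); apply: (mulIf m0); rewrite -!mulrA in e *.
by rewrite e mulKf.
Qed.

Lemma piv_mean x v : cnt x = m -> ~~ x v ->
  \sum_(s : {perm V}) (piv (x \o (s^-1)%g) (s v))%:R = nS * (mean_piv / m%:R).
Proof.
move=> xm xv; have := orbit_sum (fun y u => (piv y u)%:R) xm xv.
rewrite (eq_bigr (fun y : {ffun V -> bool} => (#|[set u | piv y u]|)%:R)
  (P := fun y : {ffun V -> bool} => cnt y == m)); last first.
  move=> y /eqP ym; rewrite -sum1dep_card natr_sum [RHS]big_mkcond /= [LHS]big_mkcond /=.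
  by apply: eq_bigr => u _; rewrite /piv; case: (y u) => //=; case: ifP.
rewrite natrM -/C -/nS /mean_piv -/C => e.
have m0 : (m%:R : R) != 0 by rewrite pnatr_eq0 -lt0n.
have c0 := lt0r_neq0 C_gt0.
apply: (mulIf c0); apply: (mulIf m0); rewrite -[LHS]mulrA e.
by set S := \sum_(_ | _) _; field; rewrite m0 c0.
Qed.

Definition lifted s w : R := (f (adjust m (w \o s) \o (s^-1)%g))%:R.

(** Moving an open site from [a] to [v] factors through a common configuration with both open. If
    [f] differs at the two ends it holds in the middle, so [v] or [a] is pivotal for the end where
    [f] fails. *)
Lemma swap_piv x y v : cnt x = m -> cnt y = m -> (forall u, y u -> x u || (u == v)) ->
  ~~ x v -> x <> y ->
  exists a, ~~ y a /\ forall s,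
   `|(f (y \o (s^-1)%g))%:R - (f (x \o (s^-1)%g))%:R| <=
   (piv (x \o (s^-1)%g) (s v))%:R + (piv (y \o (s^-1)%g) (s a))%:R :> R.
Proof.
move=> xm ym yx xv nxy.
have [a [xa ya]] : exists a, x a /\ ~~ y a.
  apply: contrapT => nex; apply: nxy; apply: cnt_sub_eq; last by rewrite xm ym.
  by move=> u xu; apply: contrapT => /negP yu; apply: nex; exists u.
exists a; split=> // s.
have e : upd x v true = upd y a true.
  apply/esym/cnt_sub_eq; last by rewrite !cnt_upd ?xm ?ym.
  move=> u; rewrite /upd; case: eqP => [->|_ yu]; first by rewrite xa; case: ifP.
  by have := yx u yu; case: eqP => //; rewrite orbF.
have updE z b : upd (z \o (s^-1)%g) (s b) true = upd z b true \o (s^-1)%g.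
  by apply: funext => u; rewrite /upd /= -(inj_eq (@perm_inj _ (s^-1)%g)) permK.
rewrite /piv !updE /= !permK xv ya e /=.
have mx : f (x \o (s^-1)%g) -> f (upd y a true \o (s^-1)%g).
  by apply: f_mono => u /=; rewrite -e /upd; case: eqP.
have my : f (y \o (s^-1)%g) -> f (upd y a true \o (s^-1)%g).
  by apply: f_mono => u /=; rewrite /upd; case: eqP.
move: mx my; case: (f (x \o _)); case: (f (y \o _)); case: (f (upd _ _ _ \o _)) => mx my;
  rewrite /= ?subrr ?normr0 ?subr0 ?sub0r ?normrN ?normr1 ?addr0 ?add0r //; try lra;
  by [have := mx isT|have := my isT].
Qed.

(** There are [2 m] sites, and a flip at each causes at most one move, charged to two pivotal events
    of averaged probability [mean_piv / m]; this gives the 4. *)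
Lemma sum_infl_lifted :
  \sum_(s : {perm V}) \sum_v infl (lifted s) v <= nS * (4 * mean_piv).
Proof.
pose h s v x : R := `|(f (adjust m (upd x v true) \o (s^-1)%g))%:R -
  (f (adjust m (upd x v false) \o (s^-1)%g))%:R|.
have e s : \sum_v infl (lifted s) v = \sum_v Ex (h s v).
  rewrite [RHS](reindex_inj (@perm_inj _ (s^-1)%g)) /=; apply: eq_bigr => v _.
  rewrite -(Ex_map (@perm_inj _ s) (fsupp_fin (h s _))); congr Ex; apply: funext => w.
  have updE b : upd w v b \o s = upd (w \o s) ((s^-1)%g v) b.
    by apply: funext => u; rewrite /upd /= -[u == _](inj_eq (@perm_inj _ s)) permKV.
  by rewrite /lifted !updE.
rewrite (eq_bigr _ (fun s _ => e s)) exchange_big /=.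
have key v : \sum_(s : {perm V}) Ex (h s v) <= nS * (2 * (mean_piv / m%:R)).
  rewrite -Ex_sumF -[leRHS](@Ex_cst R V); apply: Ex_leF => w.
  have mp0 : 0 <= mean_piv.
    by rewrite divr_ge0 ?ler0n // sumr_ge0 // => x _; rewrite ler0n.
  pose x := adjust m (upd w v false); pose y := adjust m (upd w v true).
  have xm : cnt x = m by apply: cnt_adjust.
  have ym : cnt y = m by apply: cnt_adjust.
  have yx u : y u -> x u || (u == v).
    rewrite /y (_ : upd w v true = upd (upd w v false) v true); last by rewrite upd_upd.
    by apply: adjust_lip => //; rewrite /upd eqxx.
  case: (pselect (x = y)) => [exy|nxy].
    rewrite big1 => [|s _]; last by rewrite /h -/x -/y exy subrr normr0.
    by apply: mulr_ge0; [exact: ltW nS_gt0|rewrite mulr_ge0 // divr_ge0 ?ler0n].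
  case xv : (x v).
    exfalso; apply: nxy; apply/esym/cnt_sub_eq; last by rewrite xm ym.
    by move=> u /yx /orP[//|/eqP ->]; rewrite xv.
  have [a [ya Hs]] := swap_piv xm ym yx (negbT xv) nxy.
  apply: le_trans (_ : \sum_(s : {perm V}) ((piv (x \o (s^-1)%g) (s v))%:R +
    (piv (y \o (s^-1)%g) (s a))%:R) <= _); first by apply: ler_sum => s _; apply: Hs.
  by rewrite big_split /= !piv_mean ?xv //; lra.
apply: le_trans (ler_sum _ (fun v _ => key v)) _.
rewrite sumr_const -[_ *+ _]mulr_natr (cardV card_even) -/m natrD.
have m0 : (m%:R : R) != 0 by rewrite pnatr_eq0 -lt0n.
rewrite -mulrA ler_pM2l ?nS_gt0 // le_eqVlt; apply/orP; left; apply/eqP; by field.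
Qed.

Let F w : R := (f w)%:R.
Hypothesis half_prod : Ex F = 1 / 2.
Hypothesis half_level : \sum_(x : {ffun V -> bool} | cnt x == m) F x = C / 2.

Definition low w : R := (f w && (cnt w < m)%N)%:R.

Lemma cnt_ge_half : 1 / 2 <= Ex (fun w : V -> bool => (m <= cnt w)%N%:R : R).
Proof.
have e : Ex (fun w : V -> bool => (m <= cnt w)%N%:R : R) =
    Ex (fun w : V -> bool => (cnt w <= m)%N%:R : R).
  rewrite -(Ex_neg (fsupp_fin (fun w : V -> bool => (cnt w <= m)%N%:R : R))).
  congr Ex; apply: funext => w; congr (_ %:R); congr nat_of_bool.
  have := cnt_neg w; rewrite (cardV card_even) -/m => e.
  by rewrite -(leq_add2r (cnt w) _ m) e leq_add2l.
have : 1 <= Ex (fun w : V -> bool => (m <= cnt w)%N%:R : R) +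
    Ex (fun w : V -> bool => (cnt w <= m)%N%:R : R).
  rewrite -ExD -[leLHS](@Ex_cst R V); apply: Ex_leF => w.
  have := ler0n R (cnt w <= m)%N.
  case: (leqP m (cnt w)) => [h|/ltnW ->] /=; rewrite ?mulr1n ?mulr0n; lra.
by rewrite -e; lra.
Qed.

(** Averaged over relabelings, the adjusted configuration is uniform on level [m] for each fixed
    [w], so it decouples from any invariant weight. *)
Lemma lifted_mean (H : (V -> bool) -> R) : (forall w s, H (w \o s) = H w) ->
  \sum_(s : {perm V}) Ex (fun w => lifted s w * H w) = nS * (1 / 2 * Ex H).
Proof.
move=> Hs.
rewrite (eq_bigr (fun s => Ex (fun w => (f (adjust m w \o (s^-1)%g))%:R * H w))); last first.
  move=> s _; rewrite -[RHS](Ex_map (@perm_inj _ s) (fsupp_fin _)); congr Ex.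
  by apply: funext => w; rewrite /lifted Hs.
rewrite -Ex_sumF mulrA -ExZ; congr Ex; apply: funext => w.
rewrite -mulr_suml (level_mean F (cnt_adjust card_even w)) half_level.
have c0 := lt0r_neq0 C_gt0.
by congr (_ * _); field.
Qed.

(** [F * lifted] equals [lifted] when at least [m] sites are open and [F] when fewer are. On average
    the first part is half the probability of the former case, hence at least 1/4, the product of
    the means; [low] is what remains. *)
Lemma cov_low : nS * Ex low <=
  \sum_(s : {perm V}) (Ex (fun w => F w * lifted s w) - Ex F * Ex (lifted s)).
Proof.
rewrite sumrB -mulr_sumr half_prod.
have -> : \sum_(s : {perm V}) Ex (lifted s) = nS * (1 / 2).
  rewrite -[X in _ = _ * X]mulr1 -[X in _ * (_ * X)](@Ex_cst R V) -lifted_mean //.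
  by apply: eq_bigr => s _; congr Ex; apply: funext => w; rewrite mulr1.
pose hi w : R := (m <= cnt w)%N%:R.
have point s w : lifted s w * hi w + low w <= F w * lifted s w.
  rewrite /hi /low /F /lifted.
  set y := adjust m (w \o s) \o (s^-1)%g.
  have yP : (m <= cnt w)%N -> f y -> f w.
    move=> mw; apply: f_mono => v /=; rewrite /y /= => /adjust_le; rewrite cnt_perm => /(_ mw).
    by rewrite /= permKV.
  have yP' : (cnt w < m)%N -> f w -> f y.
    move=> mw; apply: f_mono => v wv; rewrite /y /=; apply: adjust_ge.
      by rewrite cnt_perm ltnW.
    by rewrite /= permKV.
  case: (leqP m (cnt w)) => mw /=.
    rewrite andbF mulr1 addr0; have := yP mw; case: (f y) => h; last by rewrite !mulr0.
    by rewrite h // !mulr1.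
  rewrite andbT mulr0 add0r; have := yP' mw; case: (f w) => h; last by rewrite mul0r.
  by rewrite h // mulr1.
have : \sum_(s : {perm V}) (Ex (fun w => lifted s w * hi w) + Ex low) <=
    \sum_(s : {perm V}) Ex (fun w => F w * lifted s w).
  by apply: ler_sum => s _; rewrite -ExD; apply: Ex_leF => w; exact: point.
rewrite big_split /= lifted_mean; last by move=> w s; rewrite /hi cnt_perm.
rewrite sumr_const -[_ *+ _]mulr_natl -/nS.
have := cnt_ge_half; have := nS_gt0; rewrite -/hi => n0 h.
have : nS * (1 / 2 * (1 / 2)) <= nS * (1 / 2 * Ex hi) by rewrite ler_pM2l // ler_pM2l //; lra.
lra.
Qed.

Lemma low_le_mean_piv (d : V -> R) (del : R) : 0 <= del -> (forall v, d v <= del) ->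
  (forall g, Ex (fun w => F w * g w) - Ex F * Ex g <= (\sum_v d v * infl g v) / 4) ->
  Ex low <= del * mean_piv.
Proof.
move=> del0 dd H; rewrite -(ler_pM2l nS_gt0); apply: le_trans cov_low _.
have ige g v : 0 <= infl g v :> R by apply: Ex_ge0.
apply: le_trans (_ : \sum_(s : {perm V}) (del / 4) * \sum_v infl (lifted s) v <= _).
  apply: ler_sum => s _; apply: le_trans (H _) _.
  rewrite [X in _ <= X]mulrAC ler_wpM2r ?invr_ge0 // mulr_sumr; apply: ler_sum => v _.
  exact: ler_wpM2r.
rewrite -mulr_sumr; apply: le_trans (ler_wpM2l _ sum_infl_lifted) _; last by lra.
by rewrite divr_ge0.
Qed.

End MonotoneEvent.

(** * Central binomial coefficients and configurations with fewer than half of the sites open *)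

Lemma bin_decr (n k : nat) : (n <= (2 * k).+1)%N -> ('C(n, k.+1) <= 'C(n, k))%N.
Proof.
move=> nk; rewrite -(@leq_pmul2l k.+1) // mul_bin_left leq_mul2r; apply/orP; right; lia.
Qed.

Lemma bin_center (m i : nat) : ('C(m + m, m + i) <= 'C(m + m, m))%N.
Proof.
elim: i => [|i IH]; first by rewrite addn0.
by apply: leq_trans IH; rewrite addnS; apply: bin_decr; lia.
Qed.

Lemma central_bin_step (m : nat) :
  ((m.+1) * 'C(m.+1 + m.+1, m.+1) = 2 * (2 * m + 1) * 'C(m + m, m))%N.
Proof.
have e1 := mul_bin_diag (m + m).+1 m.
have e3 : 'C((m + m).+1, m.+1) = 'C((m + m).+1, m).
  by rewrite -[in RHS](bin_sub (n := (m + m).+1)); [congr 'C(_, _)|]; lia.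
have e4 : ('C((m + m).+2, m.+1) = 2 * 'C((m + m).+1, m.+1))%N.
  by rewrite binS e3; lia.
rewrite addSn addnS e4 mulnCA -e1 /= mulnA; congr (_ * _)%N; lia.
Qed.

(** The bound of order $4^m/\sqrt{m}$, squared to stay in the naturals; the induction step reduces
    to $(2m+1)(2m+3) \le 4(m+1)^2$. *)
Lemma central_bin_bound (m : nat) : ('C(m + m, m) ^ 2 * (m + m).+1 <= 16 ^ m)%N.
Proof.
elim: m => [|m IH]; first by [].
have e := central_bin_step m.
rewrite -(@leq_pmul2l (m.+1 ^ 2)) ?expn_gt0 //.
set c' := 'C(m.+1 + m.+1, m.+1) in e *; set c := 'C(m + m, m) in e IH *.
have -> : (m.+1 ^ 2 * (c' ^ 2 * (m.+1 + m.+1).+1) = (m.+1 * c') ^ 2 * (2 * m + 3))%N.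
  by rewrite expnMn !mulnA; congr (_ * _)%N; lia.
rewrite e.
have -> : ((2 * (2 * m + 1) * c) ^ 2 * (2 * m + 3) =
  (4 * ((2 * m + 1) * (2 * m + 3))) * (c ^ 2 * (m + m).+1))%N.
  by rewrite !expnMn (_ : (m + m).+1 = 2 * m + 1)%N; [ring|lia].
have -> : (m.+1 ^ 2 * 16 ^ m.+1 = m.+1 ^ 2 * 16 * 16 ^ m)%N by rewrite [(16 ^ m.+1)%N]expnS mulnA.
by apply: leq_mul; [rewrite -mulnn; nia|exact: IH].
Qed.

Lemma central_bin_sqrt (n m : nat) : (n ^ 2 <= (m + m).+1)%N ->
  (n * 'C(m + m, m) <= 2 ^ (m + m))%N.
Proof.
move=> nm; rewrite -leq_sqr expnMn mulnC.
apply: leq_trans (_ : 'C(m + m, m) ^ 2 * (m + m).+1 <= _)%N; first by rewrite leq_mul2l nm orbT.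
apply: leq_trans (central_bin_bound m) _.
by rewrite -expnM (_ : 16 = 2 ^ 4)%N // -expnM leq_exp2l //; lia.
Qed.

Section LowPart.
Variables (R : realType) (V : finType) (f : (V -> bool) -> bool).
Hypothesis card_even : ~~ odd #|V|.
Let m := #|V|./2.
Variable nxt : {set V} -> {set V} -> option V.
Hypothesis nxt_new : forall K O v, nxt K O = Some v -> v \notin K.
Variable k : nat.
Let J (w : V -> bool) := run nxt k set0 set0 w.
Hypothesis f_det : forall w w' : V -> bool, (forall v, v \in J w -> w v = w' v) -> f w = f w'.

Lemma Ex_invol (t : (V -> bool) -> V -> bool) (H : (V -> bool) -> R) :
  involutive t -> Ex (fun w => H (t w)) = Ex H.
Proof.
move=> tK; rewrite !Ex_fin; congr (_ / _).
pose t' (w : {ffun V -> bool}) : {ffun V -> bool} := [ffun v => t w v].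
have tE (w : {ffun V -> bool}) : t' w = t w :> (V -> bool) by apply: funext => v; rewrite ffunE.
have t'K : involutive t'.
  by move=> w; apply/ffunP => v; rewrite ffunE tE tK.
by rewrite [RHS](reindex_inj (inv_inj t'K)); apply: eq_bigr => w _; rewrite tE.
Qed.

Definition reflip (w : V -> bool) : V -> bool := fun v => if v \in J w then w v else ~~ w v.

Lemma J_reflip w : J (reflip w) = J w.
Proof. by apply: run_loc => // v _ vJ; rewrite /reflip /J vJ. Qed.

Lemma reflipK : involutive reflip.
Proof.
move=> w; apply: funext => v; rewrite {1}/reflip J_reflip /reflip.
by case: (v \in J w) => //; rewrite negbK.
Qed.

Lemma cntE (w : V -> bool) : (cnt w)%:R = \sum_v (w v)%:R :> R.
Proof.
rewrite /cnt -sum1dep_card natr_sum big_mkcond /=.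
by apply: eq_bigr => v _; case: (w v).
Qed.

Lemma cnt_reflip w :
  (cnt w)%:R + (cnt (reflip w))%:R = (m + m)%:R + \sum_(v in J w) sgn R w v :> R.
Proof.
rewrite !cntE -big_split /= -(cardV card_even) -sum1_card natr_sum.
rewrite [\sum_(v in J w) _]big_mkcond -big_split /=; apply: eq_bigr => v _.
rewrite /reflip /sgn; case: (v \in J w); case: (w v); rewrite /= ?mulr1n ?mulr0n; lra.
Qed.

Definition near (X : nat) (w : V -> bool) : R := ((m <= cnt w) && (cnt w <= m + X))%N%:R.

Lemma Ex_near (X n : nat) : (0 < n)%N -> (n ^ 2 <= #|V|.+1)%N ->
  Ex (near X) <= X.+1%:R / n%:R.
Proof.
move=> n0 nV; rewrite Ex_fin (cardV card_even) -/m.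
have le1 (w : {ffun V -> bool}) : near X w <= \sum_(i < X.+1) (cnt w == m + i)%N%:R.
  rewrite /near; case: (boolP (_ && _)) => [/andP[h1 h2]|_]; last first.
    by apply: sumr_ge0 => i _; rewrite ler0n.
  have h : (cnt w - m < X.+1)%N by lia.
  rewrite (bigD1 (Ordinal h)) //= subnKC // eqxx lerDl.
  by apply: sumr_ge0 => i _; rewrite ler0n.
rewrite ler_pdivrMr ?exprn_gt0 // mulrAC ler_pdivlMr ?ltr0n //.
apply: le_trans (_ : (\sum_(i < X.+1) ('C(m + m, m))%:R) * n%:R <= _).
  rewrite ler_wpM2r ?ler0n //; apply: le_trans (ler_sum _ (fun w _ => le1 w)) _.
  rewrite exchange_big /=; apply: ler_sum => i _.
  rewrite -natr_sum ler_nat; apply: leq_trans (bin_center m i).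
  rewrite -(cardV card_even) -card_level -sum1dep_card [leqRHS]big_mkcond /=.
  by apply: leq_sum => w _; case: ifP.
rewrite sumr_const card_ord -[_ *+ _]mulr_natl -mulrA ler_wpM2l ?ler0n //.
rewrite -natrM -natrX ler_nat mulnC; apply: central_bin_sqrt.
by rewrite -(cardV card_even).
Qed.

(* Flipping the unqueried sites reflects the number of open sites about its
   mean up to the discrepancy on the queried set, while [f] is unchanged. *)
Lemma half_le_low (X n : nat) : (0 < n)%N -> (n ^ 2 <= #|V|.+1)%N ->
  Ex (fun w => (f w)%:R) <= 2 * Ex (low R f) + X.+1%:R / n%:R +
    (\sum_v reveal R nxt k set0 set0 v) / X.+1%:R ^+ 2.
Proof.
move=> n0 nV; pose D w := \sum_(v in J w) sgn R w v.
have x0 : 0 < (X.+1%:R : R) ^+ 2 by rewrite exprn_gt0 // ltr0n.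
(* If neither [w] nor its reflection has fewer than [m] open sites, then [w] is within [X] above
   [m], or the discrepancy [D w] is at least [X.+1], which is charged by Chebyshev. *)
have point w : (f w)%:R <= low R f w + low R f (reflip w) + near X w + D w ^+ 2 / X.+1%:R ^+ 2.
  have fr : f (reflip w) = f w.
    by apply/esym/f_det => v vJ; rewrite /reflip vJ.
  have d0 : 0 <= D w ^+ 2 / X.+1%:R ^+ 2 by rewrite divr_ge0 ?sqr_ge0 // ltW.
  have n0' : 0 <= near X w by rewrite ler0n.
  rewrite /low fr; case: (f w) => /=; last by rewrite !mulr0n !add0r addr_ge0.
  case: (ltnP (cnt w) m) => h1 /=.
    by rewrite -[leLHS]addr0 -!addrA lerD2l !addr_ge0 ?ler0n.
  case: (ltnP (cnt (reflip w)) m) => h2 /=.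
    by rewrite add0r -[leLHS]addr0 -!addrA lerD2l addr_ge0.
  rewrite !add0r /near h1 /=; case: (leqP (cnt w) (m + X)) => h3 /=.
    by rewrite lerDl.
  rewrite ?mulr0n add0r ler_pdivlMr // mul1r.
  have h3' : (m + X.+1)%:R <= (cnt w)%:R :> R by rewrite ler_nat addnS.
  have h2' : m%:R <= (cnt (reflip w))%:R :> R by rewrite ler_nat.
  have := cnt_reflip w; rewrite -/(D w) !natrD in h3' * => e.
  have xx := ler0n R X.+1.
  by rewrite ler_pXn2r ?nnegrE //; lra.
have : Ex (fun w => (f w)%:R) <=
    Ex (fun w => low R f w + low R f (reflip w) + near X w + D w ^+ 2 / X.+1%:R ^+ 2).
  by apply: Ex_leF => w; exact: point.
rewrite !ExD (Ex_invol _ reflipK).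
rewrite (_ : Ex (fun w => D w ^+ 2 / X.+1%:R ^+ 2) =
  (\sum_v reveal R nxt k set0 set0 v) / X.+1%:R ^+ 2); last first.
  rewrite (_ : (fun w => _) = fun w => (X.+1%:R ^+ 2)^-1 * (0 + \sum_(v in J w :\: set0) sgn R w v) ^+ 2).
    rewrite ExZ run_variance // expr0n add0r mulrC; congr (_ / _).
    rewrite -Ex_sumF; congr Ex; apply: funext => w.
    rewrite setD0 -sum1_card natr_sum big_mkcond /=; apply: eq_bigr => v _.
    by rewrite in_set0 andbT; case: ifP.
  by apply: funext => w; rewrite setD0 add0r mulrC.
by move=> h; apply: le_trans h _; rewrite lerD2r mulr_natl mulr2n lerD2l; exact: Ex_near.
Qed.

End LowPart.

(** * Comparison of consecutive levels *)

Section Russo.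
Variables (V : finType) (f : (V -> bool) -> bool).
Hypothesis f_mono : forall x y : V -> bool, (forall v, x v -> y v) -> f x -> f y.

Lemma sum_opened (x : {ffun V -> bool}) : (\sum_(v | ~~ x v) f (upd x v true) =
  #|[set v | piv f x v]| + #|[set v | ~~ x v]| * f x)%N.
Proof.
case fx : (f x).
  rewrite muln1 [X in (X + _)%N](_ : _ = 0%N) ?add0n; last first.
    by apply: eq_card0 => v; rewrite !inE /piv fx andbF.
  rewrite -sum1dep_card; apply: eq_bigr => v _.
  by rewrite (f_mono _ fx) // => u; rewrite /upd; case: eqP.
rewrite muln0 addn0 -sum1dep_card big_mkcond [RHS]big_mkcond /=.
by apply: eq_bigr => v _; rewrite /piv fx; case: (x v) => //=; case: (f _).
Qed.

(** Opening a site is a bijection between configurations at level [k] with a marked closed site and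
    those at level [k.+1] with a marked open site; [f] after opening is counted in both ways. *)
Lemma russo_count (k : nat) :
  (\sum_(x : {ffun V -> bool} | cnt x == k) #|[set v | piv f x v]| +
   (#|V| - k) * \sum_(x : {ffun V -> bool} | cnt x == k) f x =
   k.+1 * \sum_(x : {ffun V -> bool} | cnt x == k.+1) f x)%N.
Proof.
transitivity (\sum_(x : {ffun V -> bool} | cnt x == k) \sum_(v | ~~ x v) f (upd x v true))%N.
  rewrite big_distrr -big_split /=; apply: eq_bigr => x /eqP xk; rewrite sum_opened.
  by congr (_ + _ * _)%N; rewrite -xk -(cnt_neg x) addnK.
transitivity (\sum_(x : {ffun V -> bool} | cnt x == k.+1) \sum_(v | x v) f x)%N; last first.
  rewrite big_distrr; apply: eq_bigr => x /eqP xk.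
  by rewrite sum_nat_cond_const -xk /cnt.
rewrite !pair_big_dep /=.
pose h b (p : {ffun V -> bool} * V) : {ffun V -> bool} * V := (fupd p.1 p.2 b, p.2).
have hK b (p : {ffun V -> bool} * V) : p.1 p.2 = b -> h b (h (~~ b) p) = p.
  case: p => x v /= xv; congr pair; apply/ffunP => u; rewrite !ffunE.
  by case: eqP => // ->.
rewrite [RHS](reindex_onto (h true) (h false)) /=; last first.
  by move=> p /andP[_ pv]; apply: hK.
apply: eq_big => -[x v] /=; last by rewrite fupdE.
rewrite fupdE {1}[upd _ _ _ v]/upd eqxx andbT.
case xv : (x v) => /=.
  rewrite andbF; apply/esym/negbTE; rewrite negb_and; apply/orP; right.
  apply/negP => /eqP /(congr1 fst) /ffunP /(_ v) /=.
  by rewrite !ffunE eqxx xv.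
by rewrite cnt_upd ?xv // eqSS (hK false (x, v) xv) eqxx andbT.
Qed.

(** Move [x] towards [y] within the level: open a site of [y], and unless this already makes [f]
    true, close a site outside [y]. By monotonicity [f] stays false, so a pivotal site must appear
    before [y] is reached. *)
Lemma exists_piv (m : nat) (x y : V -> bool) : cnt x = m -> cnt y = m -> ~~ f x -> f y ->
  exists (z : {ffun V -> bool}) v, cnt z = m /\ piv f z v.
Proof.
move=> xm ym nfx fy.
have [d] := ubnP #|[set v | y v && ~~ x v]|.
elim: d x xm nfx => // d IH x xm nfx dle.
have [v /andP[yv xv]] : exists v, y v && ~~ x v.
  apply: contrapT => nex.
  have : f x; last by apply/negP.
  apply: f_mono fy => v yv; apply: contrapT => /negP xv.
  by apply: nex; exists v; rewrite yv.
have [u [xu yu]] : exists u, x u /\ ~~ y u.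
  apply: contrapT => nex.
  have xy : x = y.
    apply: cnt_sub_eq; last by rewrite xm ym.
    by move=> u xu; apply: contrapT => /negP yu; apply: nex; exists u.
  by rewrite xy yv in xv.
case: (boolP (f (upd x v true))) => fv.
  exists [ffun z => x z], v.
  have -> : [ffun z => x z] = x :> (V -> bool) by apply: funext => z; rewrite ffunE.
  by split=> //; rewrite /piv xv nfx.
pose x' := upd (upd x v true) u false.
have nuv : u != v by apply: contraNneq yu => ->.
apply: (IH x').
- apply: succn_inj; rewrite -xm -(cnt_upd xv).
  have <- : upd x' u true = upd x v true.
    rewrite /x' upd_upd; apply: funext => z; rewrite {1}/upd; case: eqP => // ->.
    by rewrite /upd (negbTE nuv) xu.
  by rewrite cnt_upd // /x' /upd eqxx.
- apply: contra fv; apply: f_mono => z; rewrite /x' {1}/upd; by case: eqP.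
apply: leq_trans (_ : #|[set v | y v && ~~ x v]| <= d)%N; last by rewrite -ltnS.
apply: proper_card; apply/properP; split.
  apply/subsetP => z; rewrite !inE => /andP[yz]; rewrite yz /=.
  rewrite /x' /upd; case: (eqVneq z u) => [e|_]; first by rewrite e (negbTE yu) in yz.
  by case: eqP.
by exists v; rewrite !inE ?yv ?xv // /x' /upd eq_sym (negbTE nuv) eqxx.
Qed.

End Russo.

(** A crude bound that serves the finitely many boxes below the asymptotic regime. *)
Lemma mean_piv_ge (R : realType) (V : finType) (f : (V -> bool) -> bool) :
  ~~ odd #|V| ->
  (forall x y : V -> bool, (forall v, x v -> y v) -> f x -> f y) ->
  \sum_(x : {ffun V -> bool} | cnt x == #|V|./2) ((f x)%:R : R) = ('C(#|V|, #|V|./2))%:R / 2 ->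
  (2 ^+ #|V|)^-1 <= mean_piv R f.
Proof.
move=> card_even f_mono half; set m := #|V|./2 in half *.
have C0 : 0 < ('C(#|V|, m))%:R :> R by rewrite ltr0n bin_gt0 (cardV card_even) leq_addr.
have [y [ym fy]] : exists y : {ffun V -> bool}, cnt y = m /\ f y.
  apply: contrapT => nex; move: half; rewrite big1; first by move=> h; lra.
  by move=> y /eqP ym; case fy: (f y) => //; exfalso; apply: nex; exists y.
have [x [xm nfx]] : exists x : {ffun V -> bool}, cnt x = m /\ ~~ f x.
  apply: contrapT => nex; move: half; rewrite (eq_bigr (fun=> 1)).
    by rewrite sumr_const -[X in _ *+ X]cardsE card_level => h; lra.
  by move=> x /eqP xm; case fx: (f x) => //; exfalso; apply: nex; exists x; rewrite fx.
have [z [v [zm zv]]] := exists_piv f_mono xm ym nfx fy.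
rewrite /mean_piv -/m; apply: le_trans (_ : 1 / ('C(#|V|, m))%:R <= _).
  rewrite div1r lef_pV2 ?posrE ?exprn_gt0 // -natrX ler_nat.
  rewrite -card_level; apply: leq_trans (max_card _) _.
  by rewrite card_ffun card_bool.
rewrite ler_wpM2r ?invr_ge0 ?ler0n // (bigD1 z) ?zm //=.
apply: le_trans (_ : (#|[set v | piv f z v]|)%:R <= _).
  by rewrite ler1n; apply/card_gt0P; exists v; rewrite inE.
by rewrite lerDl sumr_ge0 // => w _; rewrite ler0n.
Qed.

(** * Crossings of the box *)

Section Box.
Variables (R : realType) (n : nat).

Lemma cos_pi3 : cos (pi / 3) = 1 / 2 :> R.
Proof.
have pi0 := @pi_gt0 R.
have c0 : 0 < cos (pi / 3 : R) by apply: cos_gt0_pihalf; lra.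
have e : cos (pi / 3 + pi / 3 + pi / 3) = -1 :> R.
  by rewrite (_ : _ + _ = pi) ?cospi //; lra.
have s2 := sin2cos2 (pi / 3 : R).
rewrite cosD cosD sinD in e.
move: e s2 c0; set c := cos _; set s := sin _ => e s2 c0.
(* The triple angle formula at $\cos\pi = -1$ reads $4c^3 - 3c + 1 = 0$, which factors in this
   way. *)
have : (c + 1) * (2 * c - 1) ^+ 2 = 0.
  have : s * (s * c) = (1 - c ^+ 2) * c by rewrite mulrA -expr2 s2.
  move: e; rewrite !expr2; lra.
move=> /eqP; rewrite mulf_eq0 expf_eq0 /= => /orP[/eqP|/eqP]; lra.
Qed.

Lemma sin_pi3_sq : sin (pi / 3) ^+ 2 = 3 / 4 :> R.
Proof. by rewrite sin2cos2 cos_pi3; lra. Qed.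

Definition lat (v : box n) : site := (v.1%:Z, v.2%:Z).

Lemma lat_inj : injective lat.
Proof. by move=> [a b] [c d] [/val_inj -> /val_inj ->]. Qed.

Lemma norm_form_adj (a b : int) :
  (a ^+ 2 + a * b + b ^+ 2 == 1) = [|| (a == 1) && (b == 0), (a == -1) && (b == 0),
   (a == 0) && (b == 1), (a == 0) && (b == -1), (a == 1) && (b == -1) | (a == -1) && (b == 1)].
Proof.
apply/eqP/idP => [e|].
  have hb : -1 <= b <= 1 by rewrite !expr2 in e; nia.
  have ha : -1 <= a <= 1 by rewrite !expr2 in e; nia.
  have [ea|[ea|ea]] : a = -1 \/ a = 0 \/ a = 1 by lia.
  - by rewrite ea !expr2 in e *; lia.
  - by rewrite ea !expr2 in e *; nia.
  - by rewrite ea !expr2 in e *; lia.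
by move=> h; rewrite !expr2; case/or4P: h => [|||/or3P[]] /andP[/eqP -> /eqP ->].
Qed.

Lemma norm_formE (a b : int) :
  (a%:~R + b%:~R * (1 / 2)) ^+ 2 + b%:~R ^+ 2 * (3 / 4) =
    (a ^+ 2 + a * b + b ^+ 2)%:~R :> R.
Proof.
rewrite !intrD !expr2 !intrM; set x := a%:~R; set y := b%:~R; lra.
Qed.

Lemma tri_adjE (u v : box n) : tri_adj R u v = adj (lat u) (lat v).
Proof.
rewrite /tri_adj /= /tri_embed.
pose a : int := u.1%:Z - v.1%:Z; pose b : int := u.2%:Z - v.2%:Z.
have -> : (u.1)%:R + (u.2)%:R * (cos (pi / 3) +i* sin (pi / 3))%C -
    ((v.1)%:R + (v.2)%:R * (cos (pi / 3) +i* sin (pi / 3))%C) =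
    ((a%:~R + b%:~R * cos (pi / 3)) +i* (b%:~R * sin (pi / 3)))%C :> R[i].
  rewrite /a /b !rmorphB /= -!(rmorph_nat (real_complex R)) /=.
  by apply/eqP; rewrite eq_complex /=; apply/andP; split; apply/eqP; ring.
rewrite normc_def /= cos_pi3 exprMn sin_pi3_sq.
have -> : (a%:~R + b%:~R * (1 / 2)) ^+ 2 + b%:~R ^+ 2 * (3 / 4) =
    (a ^+ 2 + a * b + b ^+ 2)%:~R :> R.
  exact: norm_formE.
have q0 : 0 <= a ^+ 2 + a * b + b ^+ 2 by rewrite !expr2; nia.
rewrite eq_complex /= eqxx andbT.
rewrite -[X in _ == X](sqrtr1 R) eqr_sqrt ?ler01 ?ler0z // -[X in _ == X]/(1%:~R) eqr_int norm_form_adj.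
by rewrite [RHS]adj_sym.
Qed.

End Box.

Section Crossing.
Variables (R : realType) (n : nat).

Definition open_at (w : box n -> bool) (p : site) : Prop := exists x, p = lat x /\ w x.

Definition crossf (w : box n -> bool) : bool :=
  `[< exists u v : box n, [/\ conn (open_at w) (lat u) (lat v), u.1 = 0%N :> nat & v.1 = n.-1 :> nat] >].

Lemma open_atE w x : open_at w (lat x) <-> w x.
Proof. by split=> [[y [/lat_inj <-]]|wx]; last exists x. Qed.

Lemma crossing_eventE (w : config (box n)) : (w \in crossing_event R n) = crossf w.
Proof.
rewrite inE; apply: asbool_equiv_eq; split.
  move=> [u [p [up wp u0 vn]]]; exists u, (last u p); split=> //.
  elim: p u up wp {u0 vn} => [|y p IH] u /=.
    by move=> _ /andP[wu _]; apply: conn0; apply/open_atE.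
  move=> /andP[uy yp] /andP[wu wyp].
  apply: conn_trans (IH y yp wyp); apply: connS (conn0 _) _ (conn_l (IH y yp wyp)).
    exact/open_atE.
  by rewrite -(tri_adjE R).
move=> [u [v [uv u0 vn]]].
suff [p [up wp lp]] : exists p, [/\ path (tri_adj R (n := n)) u p, all w (u :: p) & last u p = v].
  by exists u, p; split=> //; rewrite lp.
have : forall q, conn (open_at w) (lat u) q -> forall v', lat v' = q ->
    exists p, [/\ path (tri_adj R (n := n)) u p, all w (u :: p) & last u p = v'].
  move=> q; elim=> [/open_atE wu|a b ua IH ab [x [bx wx]]] v' e.
    by exists [::]; split=> //=; [rewrite wu|apply: lat_inj].
  have [y [ay wy]] := conn_r ua.
  have [p [up wp lp]] := IH y (esym ay).
  have e' : v' = x by apply: lat_inj; rewrite e.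
  exists (rcons p x); split; last by rewrite last_rcons.
  - by rewrite rcons_path up lp tri_adjE -ay -bx.
  - by rewrite -rcons_cons all_rcons wx.
by move=> H; exact: H uv v erefl.
Qed.

Lemma crossf_mono (w w' : box n -> bool) : (forall v, w v -> w' v) -> crossf w -> crossf w'.
Proof.
move=> ww' /asboolP [u [v [uv u0 vn]]]; apply/asboolP; exists u, v; split=> //.
by apply: conn_mono uv => p [x [-> /ww' wx]]; exists x.
Qed.

Definition swapb (v : box n) : box n := (v.2, v.1).

Lemma swapb_inj : injective swapb.
Proof. by move=> [a b] [c d] [-> ->]. Qed.

Definition dual (w : box n -> bool) : box n -> bool := fun v => ~~ w (swapb v).

Hypothesis n_ge2 : (2 <= n)%N.
Let N : int := n.-1%:Z.

Lemma lat_rect (p : site) : rect false 0 (2 * N) 0 N p -> exists x : box n, p = lat x.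
Proof.
rewrite /rect /rows /sh /N => -[r1 r2].
have l1 : (absz p.1 < n)%N by lia.
have l2 : (absz p.2 < n)%N by lia.
by exists (Ordinal l1, Ordinal l2); apply: site_eq; rewrite /lat /=; lia.
Qed.

Lemma rect_lat (x : box n) : rect false 0 (2 * N) 0 N (lat x).
Proof.
by have := ltn_ord x.1; have := ltn_ord x.2; rewrite /rect /rows /sh /N /lat /=; lia.
Qed.

Lemma crossf_HC w : crossf w <-> HC false 0 (2 * N) 0 N (open_at w).
Proof.
split=> [/asboolP [u [v [uv u0 vn]]]|/HC_trim[]].
- have uv' : conn (HCz false 0 (2 * N) 0 N (open_at w)) (lat u) (lat v).
    apply: conn_mono uv => p op; split; last by left.
    by case: op => x [-> _]; case: (rect_lat x).
  have [ru _] := rect_lat u; have [rv _] := rect_lat v.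
  exists (-1, (lat u).2), (N + 1, (lat v).2).
  have a1 : sh false (-1, (lat u).2) < 0 by [].
  have a2 : 2 * N < sh false (N + 1, (lat v).2) by rewrite /sh /=; lia.
  split=> //; apply: (@connS _ _ (lat v)); last 2 first.
  + by rewrite /adj /lat /= vn /N; lia.
  + by split=> //; right; right.
  apply: conn_trans (uv'); apply: connS (conn0 _) _ (conn_l uv').
    by split=> //; right; left.
  by rewrite /adj /lat /= u0; lia.
- by rewrite /N; lia.
move=> u [v [uv su sv]]; apply/asboolP.
have [ru pu [x [ex wx]]] := conn_l uv; have [rv pv [y [ey wy]]] := conn_r uv.
exists x, y; rewrite -ex -ey; split.
- by apply: conn_mono uv => p [].
- by move: su pu; rewrite ex /sh /lat /=; lia.
- by move: sv pv; rewrite ey /sh /lat /N /=; lia.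
Qed.

Lemma crossf_dual_VC w : crossf (dual w) <-> VC false 0 (2 * N) 0 N (fun p => ~ open_at w p).
Proof.
pose sw (p : site) : site := (p.2, p.1).
have sw_adj p p' : adj p p' -> adj (sw p) (sw p') by rewrite /adj /=; lia.
split=> [/asboolP [u [v [uv u0 vn]]]|[u [v [uv u0 vn]]]].
  exists (sw (lat u)), (sw (lat v)); split; last 2 first.
  - by rewrite /= u0.
  - by rewrite /= vn.
  apply: conn_map uv => [p p' a|p [x [-> wx]]]; first by right; apply: sw_adj.
  have -> : sw (lat x) = lat (swapb x) by [].
  have [r1 r2] := rect_lat (swapb x); split=> //.
  by move=> /open_atE wx'; move: wx; rewrite /dual wx'.
have mem p : VCz false 0 (2 * N) 0 N (fun p => ~ open_at w p) p -> open_at (dual w) (sw p).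
  move=> [rp sp np]; have [x ex] := lat_rect (conj rp sp).
  exists (swapb x); split; first by rewrite ex.
  by apply/negP => wx; apply: np; rewrite ex; apply/open_atE; move: wx; case: (x).
have uv' : conn (open_at (dual w)) (sw u) (sw v).
  by apply: conn_map uv => // p p' a; right; apply: sw_adj.
have [x [ex _]] := conn_l uv'; have [y [ey _]] := conn_r uv'.
apply/asboolP; exists x, y; rewrite -ex -ey; split=> //.
- by move: (congr1 fst ex); rewrite /= u0; lia.
- by move: (congr1 fst ey); rewrite /= vn /N; lia.
Qed.

(** A missing crossing is a closed vertical crossing, which the exchange of coordinates and colours
    turns into an open horizontal one. *)
Lemma crossf_dual w : crossf (dual w) = ~~ crossf w.
Proof.
have N0 : 0 <= N by rewrite /N; lia.
apply/idP/negP => [/crossf_dual_VC V /crossf_HC H|nH].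
  exact: HC_VC_exclusive N0 H V.
have [/crossf_HC //|V] := HC_or_VC false 0 (2 * N) (open_at w) N0.
exact/crossf_dual_VC.
Qed.

Lemma crossf_half : Ex (fun w => (crossf w)%:R : R) = 1 / 2.
Proof.
have e : Ex (fun w => (crossf (dual w))%:R : R) = Ex (fun w => (crossf w)%:R).
  rewrite -(Ex_neg (fsupp_fin (fun w => (crossf w)%:R : R))).
  by rewrite -(Ex_map swapb_inj (fsupp_fin (fun w => (crossf (fun v => ~~ w v))%:R : R))).
have : Ex (fun w => (crossf (dual w))%:R + (crossf w)%:R : R) = 1.
  rewrite -[RHS](@Ex_cst R (box n)); congr Ex; apply: funext => w.
  by rewrite crossf_dual; case: (crossf w); rewrite /= ?mulr1n ?mulr0n; lra.
by rewrite ExD e; lra.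
Qed.

(** With an even number of sites [dual] preserves the middle level, so self-duality survives the
    conditioning. *)
Lemma crossf_half_level : ~~ odd #|box n| ->
  \sum_(x : {ffun box n -> bool} | cnt x == #|box n|./2) ((crossf x)%:R : R) =
  ('C(#|box n|, #|box n|./2))%:R / 2.
Proof.
move=> ev; set m := #|box n|./2.
pose d (x : {ffun box n -> bool}) : {ffun box n -> bool} := [ffun v => dual x v].
have dE x : d x = dual x :> (box n -> bool) by apply: funext => v; rewrite ffunE.
have dI : injective d.
  move=> x y /ffunP e; apply/ffunP => v; have := e (swapb v).
  by rewrite !ffunE /dual; case: (v) => a b /= /negb_inj.
have dc x : (cnt (d x) == m) = (cnt x == m).
  have -> : cnt (d x) = cnt (fun v => ~~ x v).
    have si := swapb_inj.
    rewrite dE /cnt -(card_imset _ si); congr #|pred_of_set _|; apply/setP => v.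
    rewrite inE; apply/imsetP/idP => [[u]|xv]; first by rewrite inE => h ->.
    by exists (swapb v); [rewrite inE /dual; move: xv; case: (v)|case: (v)].
  rewrite -(eqn_add2r (cnt x)) cnt_neg (cardV ev) -/m eqn_add2l; exact: eq_sym.
have e : \sum_(x : {ffun box n -> bool} | cnt x == m) ((crossf x)%:R : R) =
    \sum_(x : {ffun box n -> bool} | cnt x == m) (1 - (crossf x)%:R).
  rewrite [LHS](reindex_inj dI) /=; apply: eq_big => x; first exact: dc.
  by rewrite dE crossf_dual; case: (crossf x) => _; rewrite /= ?mulr1n ?mulr0n; lra.
have : \sum_(x : {ffun box n -> bool} | cnt x == m) (1 : R) = ('C(#|box n|, m))%:R.
  by rewrite sumr_const -card_level cardsE.
by move: e; rewrite sumrB => e1 e2; rewrite e2 in e1; lra.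
Qed.

End Crossing.

(** * Exploring the open clusters that meet a lattice line *)

Lemma run_closed (V : finType) (nxt : {set V} -> {set V} -> option V) :
  (forall K O v, nxt K O = Some v -> v \notin K) -> (forall O, nxt setT O = None) ->
  forall k (K O : {set V}) (w : V -> bool), O = [set v in K | w v] -> (#|V| <= #|K| + k)%N ->
  nxt (run nxt k K O w) [set v in run nxt k K O w | w v] = None.
Proof.
move=> nn nT; elim=> [|k IH] K O w eO Kk /=.
  have -> : K = setT by apply/eqP; rewrite eqEcard subsetT cardsT; rewrite addn0 in Kk.
  exact: nT.
case e: (nxt K O) => [v|]; last by rewrite -eO.
have vK := nn _ _ _ e.
apply: IH; last by rewrite cardsU1 vK; lia.
rewrite eO; apply/setP => u; rewrite !inE.
case wv: (w v); rewrite !inE; case: (eqVneq u v) => [->|]; rewrite ?wv ?andbT //.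
by rewrite (negbTE vK).
Qed.

Section LineExploration.
Variables (R : realType) (n : nat).
Hypothesis n_ge2 : (2 <= n)%N.
Implicit Types (w : box n -> bool) (K O : {set box n}) (L : 'I_n).

Definition line_next L K O : option (box n) :=
  [pick v | (v \notin K) && ((v.1 == L) || [exists u in O, adj (lat u) (lat v)])].

Lemma line_next_new L K O v : line_next L K O = Some v -> v \notin K.
Proof. by rewrite /line_next; case: pickP => // x /andP[h _] [<-]. Qed.

Lemma line_nextT L O : line_next L setT O = None.
Proof. by rewrite /line_next; case: pickP => // x; rewrite inE. Qed.

(** As many steps as there are sites suffice for the exploration to stop by itself. *)
Definition queried L w : {set box n} := run (line_next L) #|box n| set0 set0 w.

Lemma queried_closed L w v : v \notin queried L w ->
  (v.1 != L) /\ forall u, u \in queried L w -> w u -> ~~ adj (lat u) (lat v).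
Proof.
move=> vJ; have := run_closed (@line_next_new L) (@line_nextT L) (k := #|box n|) (K := set0)
  (O := set0) (w := w) _ (leq_addl _ _); rewrite -/(queried L w) => H.
have {}H : line_next L (queried L w) [set v in queried L w | w v] = None.
  by apply: H; apply/setP => u; rewrite !inE.
move: H; rewrite /line_next; case: pickP => // /(_ v); rewrite vJ /= => /negbT.
rewrite negb_or => /andP[vL /existsPn nu] _; split=> // u uJ wu.
by have := nu u; rewrite inE uJ wu.
Qed.

(** A crossing passes through column [L], so its whole cluster is queried and survives in [w']. *)
Lemma crossf_queried L w w' : (forall v, v \in queried L w -> w v = w' v) ->
  crossf w -> crossf w'.
Proof.
move=> ww' /asboolP [u [v [uv u0 vn]]].
have [z [uz zL]] : exists z, conn (open_at w) (lat u) z /\ z.1 = L%:Z.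
  have Ln := ltn_ord L.
  have [uz|[a [b [ua ab _ nb _]]]] := conn_exit (P := fun p : site => p.1 <= L%:Z) uv
    ltac:(rewrite /lat /= u0; lia).
    exists (lat v); split=> //; have [_] := conn_r uz.
    by rewrite /lat /= vn; lia.
  exists a; split; first by apply: conn_mono ua => p [].
  by have [_] := conn_r ua; move: ab nb; rewrite /adj; lia.
have inJ p : conn (open_at w) z p -> exists x, [/\ p = lat x, x \in queried L w & w x].
  elim=> [[x [ez wx]]|a b _ [x [ea xJ wx]] ab [y [eb wy]]].
    exists x; split=> //; apply: contrapT => /negP /queried_closed [/eqP xL _].
    by apply: xL; apply: val_inj => /=; move: zL; rewrite ez /lat /=; lia.
  exists y; split=> //; apply: contrapT => /negP /queried_closed [_ /(_ x xJ wx)].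
  by rewrite -ea -eb ab.
have tr p : conn (open_at w) z p -> conn (open_at w') z p.
  move=> zp; apply: conn_mono (conn_cluster zp) => q /inJ [x [-> xJ wx]].
  by exists x; rewrite -ww'.
apply/asboolP; exists u, v; split=> //.
exact: conn_trans (conn_sym (tr _ (conn_sym uz))) (tr _ (conn_trans (conn_sym uz) uv)).
Qed.

Lemma crossf_det L w w' : (forall v, v \in queried L w -> w v = w' v) -> crossf w = crossf w'.
Proof.
move=> ww'; apply/idP/idP; first exact: crossf_queried ww'.
apply: (@crossf_queried L) => v.
rewrite /queried (run_loc (@line_next_new L) (w := w)) => [vJ|u _ uJ]; first by rewrite ww'.
exact: ww'.
Qed.

Lemma queried_conn L w v : v \in queried L w -> v.1 = L \/
  exists u z : box n, [/\ z.1 = L, conn (open_at w) (lat z) (lat u) & adj (lat u) (lat v)].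
Proof.
pose linked (u : box n) := exists z : box n, z.1 = L /\ conn (open_at w) (lat z) (lat u).
have H k K O : (forall u, u \in O -> linked u) ->
    (forall v, v \in K -> v.1 = L \/ exists u, linked u /\ adj (lat u) (lat v)) ->
    forall v, v \in run (line_next L) k K O w -> v.1 = L \/
      exists u, linked u /\ adj (lat u) (lat v).
  elim: k K O => [|k IH] K O HO HK v' //=; first exact: HK.
  case e: (line_next L K O) => [x|]; last exact: HK.
  have gx : x.1 = L \/ exists u, linked u /\ adj (lat u) (lat x).
    move: e; rewrite /line_next; case: pickP => // y /andP[_ h] [<-].
    case/orP: h => [/eqP|/existsP [u /andP[uO a]]]; [by left|right].
    by exists u; split=> //; apply: HO.
  apply: IH => [u|u]; last by rewrite !inE => /predU1P[->|/HK].
  case wx: (w x); last exact: HO.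
  rewrite !inE => /predU1P[->|/HO //].
  case: gx => [xL|[u' [[z [zL zu]] a]]].
    by exists x; split=> //; apply: conn0; apply/open_atE.
  by exists z; split=> //; apply: connS zu a _; apply/open_atE.
have in0 (P : box n -> Prop) : forall u, u \in (set0 : {set box n}) -> P u.
  by move=> u; rewrite inE.
move=> /(H _ _ _ (in0 _) (in0 _)) [|[u [[z [zL zu]] a]]]; first by left.
by right; exists u, z.
Qed.

(** A queried site off the line is adjacent to an open cluster from the line but may itself be
    closed. Forcing it open creates an arm, at the cost of a factor 2. *)
Lemma reveal_arm (rho : R) (k : nat) L (v : box n) : 0 <= rho ->
  Pr R (fun w : box n -> bool => exists z : box n,
    conn (open_at w) (lat v) (lat z) /\
    2 * scale k <= `|(lat z).1 - (lat v).1|) <= rho ^+ k ->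
  2 * scale k <= `|(v.1 : nat)%:Z - L%:Z| ->
  reveal R (line_next L) #|box n| set0 set0 v <= 2 * rho ^+ k.
Proof.
move=> rho0; set E := fun w : box n -> bool => exists z : box n, _ => PE vL.
apply: le_trans (_ : Ex (fun w => ind R E (upd w v true)) <= _); last first.
  move: PE; rewrite PrE (Ex_split v (ind R E)).
  have : 0 <= Ex (fun w => ind R E (upd w v false)) by apply: Ex_ge0 => w; apply: ind_ge0.
  by lra.
apply: Ex_leF => w; rewrite in_set0 andbT.
case: (boolP (v \in _)) => [|_]; last exact: ind_ge0.
rewrite -/(queried L w) => /queried_conn [e|[u [z [zL zu uv]]]].
  by move: vL; have := scale_gt0 k; rewrite e; lia.
rewrite /ind asboolT //; exists z; split; last first.
  by move: vL; rewrite /lat /= zL; lia.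
apply: conn_sym; apply: connS _ uv _.
  apply: conn_mono zu => p [x [-> wx]]; exists x; split=> //.
  by rewrite /upd; case: eqP.
by exists v; rewrite /upd eqxx.
Qed.

Lemma reveal_le1 L (v : box n) : reveal R (line_next L) #|box n| set0 set0 v <= 1.
Proof.
rewrite -[leRHS](@Ex_cst R (box n)); apply: Ex_leF => w.
by rewrite lern1; case: (_ && _).
Qed.

Lemma card_close_lines (s : nat) (v : 'I_n) :
  (#|[set L : 'I_n | (L < v + s) && (v < L + s)]| <= 2 * s)%N.
Proof.
set A := [set L | _]; pose e := [seq (L + s - v)%N | L : 'I_n in A].
have Ai (L : 'I_n) : L \in A -> (L < v + s)%N /\ (v < L + s)%N by rewrite inE => /andP[].
have ue : uniq e.
  rewrite map_inj_in_uniq ?enum_uniq // => L L'; rewrite !mem_enum => /Ai [h1 h2] /Ai [h3 h4] e1.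
  by apply: val_inj => /=; lia.
rewrite -(size_image (fun L : 'I_n => (L + s - v)%N) A) -/e -(size_iota 0 (2 * s)).
apply: uniq_leq_size => // x /mapP [L]; rewrite mem_enum => /Ai [h1 h2] ->.
by rewrite mem_iota; lia.
Qed.

Lemma sum_reveal (rho : R) (k : nat) (v : box n) : 0 <= rho ->
  Pr R (fun w : box n -> bool => exists z : box n,
    conn (open_at w) (lat v) (lat z) /\
    2 * scale k <= `|(lat z).1 - (lat v).1|) <= rho ^+ k ->
  \sum_(L : 'I_n) reveal R (line_next L) #|box n| set0 set0 v <=
  (56 * 4 ^ k)%N%:R + n%:R * (2 * rho ^+ k).
Proof.
(* This is [2 * scale k]. The at most [2 * s] closer lines are bounded by 1, the others by the arm
   estimate. *)
move=> rho0 PE; pose s := (28 * 4 ^ k)%N.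
pose close (L : 'I_n) := (L < v.1 + s)%N && (v.1 < L + s)%N.
apply: le_trans (_ : \sum_(L : 'I_n) ((close L)%:R + 2 * rho ^+ k) <= _).
  apply: ler_sum => L _; case: (boolP (close L)) => cL.
    apply: le_trans (reveal_le1 _ _) _; rewrite mulr1n lerDl.
    by rewrite mulr_ge0 // exprn_ge0.
  rewrite mulr0n add0r; apply: reveal_arm => //.
  by move: cL; rewrite /close /s /scale; lia.
rewrite big_split /= sumr_const card_ord -[_ *+ n]mulr_natl lerD2r -natr_sum ler_nat.
apply: leq_trans (_ : 2 * s <= _)%N; last by rewrite /s; lia.
apply: leq_trans (card_close_lines s v.1); rewrite -sum1dep_card [leqRHS]big_mkcond /=.
by apply: leq_sum => L _; rewrite /close; case: ifP.
Qed.

End LineExploration.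

Lemma div16_bounds (n : nat) : (56 <= n)%N ->
  (n <= 16 * (n %/ 16).+1)%N /\ (16 * (n %/ 16).+1 <= 2 * n)%N.
Proof. lia. Qed.

(** * Lower bound for the mean number of pivotal sites *)

Section Assembly.
Variables (R : realType) (n : nat).
Hypotheses (n_ge2 : (2 <= n)%N) (n_even : ~~ odd n).
Local Notation f := (@crossf n).
Let m := #|box n|./2.

Lemma card_box : #|box n| = (n ^ 2)%N.
Proof. by rewrite card_prod card_ord mulnn. Qed.

Lemma box_even : ~~ odd #|box n|.
Proof. by rewrite card_box oddX negb_or n_even. Qed.

Lemma half_box_gt0 : (0 < m)%N.
Proof. by rewrite /m card_box half_gt0; nia. Qed.

Lemma sum_pmf (k : nat) (X : config (box n) -> R) :
  \sum_w unif_pmf R k w * X w =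
  (\sum_(w : config (box n) | cnt w == k) X w) / ('C(#|box n|, k))%:R.
Proof.
rewrite mulr_suml [RHS]big_mkcond /=; apply: eq_bigr => w _.
by rewrite /unif_pmf cnt_ffun; case: ifP; rewrite ?mul0r // mulrC.
Qed.

Lemma pivotal0E (w : config (box n)) v : pivotal0 (crossing_event R n) w v = piv f w v.
Proof.
rewrite /pivotal0 /piv !crossing_eventE; case wv: (w v) => //=.
have -> : flip w v = upd w v true :> (box n -> bool).
  by apply: funext => u; rewrite ffunE /upd; case: eqP => // ->; rewrite wv.
have : f w -> f (upd w v true) by apply: crossf_mono => u; rewrite /upd; case: eqP.
by case: (f w) => [->|].
Qed.

Lemma expect_mean_piv :
  unif_expect m (fun w : config (box n) => (num_pivotal0 R w)%:R : R) = mean_piv R f.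
Proof.
rewrite /unif_expect sum_pmf /mean_piv; congr (_ / _); apply: eq_bigr => w _.
congr (_%:R); rewrite /num_pivotal0; congr #|pred_of_set _|.
by apply/setP => v; rewrite !inE pivotal0E.
Qed.

Lemma probE (k : nat) : unif_prob R k (crossing_event R n) =
  (\sum_(w : config (box n) | cnt w == k) (f w)%:R) / ('C(#|box n|, k))%:R.
Proof.
rewrite -sum_pmf /unif_prob big_mkcond /=; apply: eq_bigr => w _.
by rewrite crossing_eventE; case: (f w); rewrite ?mulr1 ?mulr0.
Qed.

(** On [2 m] sites $(m+1)\binom{2m}{m+1} = m\binom{2m}{m}$, so the count of marked configurations
    becomes an increment of [mean_piv / m]; multiplying by [2 m] leaves the factor 2. *)
Lemma russo : (unif_prob R m.+1 (crossing_event R n) - unif_prob R m (crossing_event R n)) /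
  (1 / #|box n|%:R) = 2 * mean_piv R f.
Proof.
rewrite !probE /mean_piv -/m -!natr_sum.
have := russo_count (@crossf_mono n) m.
have := mul_bin_left #|box n| m.
have m0 := half_box_gt0; have eV := cardV box_even; rewrite -/m in eV.
rewrite eV addnK -eV.
set S := (\sum_(x : {ffun _} | cnt x == m) #|_|)%N.
 set a := (\sum_(x : {ffun _} | cnt x == m) nat_of_bool _)%N.
set a' := (\sum_(x : {ffun _} | cnt x == m.+1) nat_of_bool _)%N.
have C0 : (0 < 'C(#|box n|, m))%N by rewrite bin_gt0 eV leq_addr.
have C1 : (0 < 'C(#|box n|, m.+1))%N by rewrite bin_gt0 eV; lia.
set c := 'C(_, m) in C0 *; set c' := 'C(_, m.+1) in C1 *.
rewrite eV => /(congr1 (fun k => k%:R : R)) e1 /(congr1 (fun k => k%:R : R)) e2.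
rewrite !natrM in e1; rewrite natrD !natrM in e2; rewrite (natrD _ m m).
have cR : c%:R != 0 :> R by rewrite pnatr_eq0 -lt0n.
have c'R : c'%:R != 0 :> R by rewrite pnatr_eq0 -lt0n.
have mR : m%:R != 0 :> R by rewrite pnatr_eq0 -lt0n.
have m1R : m.+1%:R != 0 :> R by rewrite pnatr_eq0.
have -> : a'%:R / c'%:R = (m.+1%:R * a'%:R) / (m%:R * c%:R) :> R.
  by rewrite -e1; move: (m.+1%:R : R) m1R => y y0; field; rewrite c'R y0.
rewrite -e2; field; rewrite cR mR /=.
by rewrite -natrD pnatr_eq0; lia.
Qed.

Variables (rho : R) (k : nat).
Hypotheses (rho0 : 0 < rho) (rho4 : 1 / 4 <= rho).
Hypothesis arm : forall v : box n, Pr R (fun w : box n -> bool => exists z : box n,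
    conn (open_at w) (lat v) (lat z) /\
    2 * scale k <= `|(lat z).1 - (lat v).1|) <= rho ^+ k.
Hypothesis n_large : (56 * 16 ^ k <= n)%N.

Let rev (L : 'I_n) (v : box n) : R := reveal R (line_next L) #|box n| set0 set0 v.

Lemma mean_reveal v : (\sum_(L : 'I_n) rev L v) / n%:R <= 3 * rho ^+ k.
Proof.
have n0 : 0 < n%:R :> R by rewrite ltr0n; exact: ltnW.
have h := sum_reveal n_ge2 (ltW rho0) (arm v).
rewrite ler_pdivrMr //; apply: le_trans h _.
(* Close lines number of order $4^k$ in a box of side at least of order $16^k$; their share is at
   most $4^{-k}$, which [rho4] absorbs. *)
have : (56 * 4 ^ k)%N%:R <= rho ^+ k * n%:R :> R.
  apply: le_trans (_ : (1 / 4) ^+ k * (56 * 16 ^ k)%N%:R <= _).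
    rewrite (_ : 16 = 4 * 4)%N // expnMn !natrM !natrX expr_div_n expr1n.
    have p0 : (4%:R : R) ^+ k != 0 by rewrite expf_neq0 // pnatr_eq0.
    move: (4%:R ^+ k) p0 => p p0; rewrite le_eqVlt; apply/orP; left; apply/eqP.
    by field.
  apply: ler_pM; [by apply: exprn_ge0; lra|exact: ler0n| |by rewrite ler_nat].
  by apply: lerXn2r; rewrite ?nnegrE ?(ltW rho0) //; apply: divr_ge0.
lra.
Qed.

Lemma low_le : Ex (low R f) <= 3 * rho ^+ k * mean_piv R f.
Proof.
have n0 : 0 < n%:R :> R by rewrite ltr0n; exact: ltnW.
apply: (low_le_mean_piv box_even (@crossf_mono n) half_box_gt0 (crossf_half R n_ge2)
  (crossf_half_level R n_ge2 box_even) _ mean_reveal).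
  by rewrite mulr_ge0 // exprn_ge0 // ltW.
move=> g; set c := _ - _.
have H (L : 'I_n) : c <= (\sum_v rev L v * infl g v) / 4.
  apply: osss; [exact: line_next_new|by move=> w; rewrite ler0n lern1; case: (f w)|].
  move=> w w' ww'; congr (nat_of_bool _)%:R; apply: (@crossf_det n n_ge2 L) => v vJ.
  by apply: ww'; rewrite ?inE.
have : n%:R * c <= \sum_(L : 'I_n) (\sum_v rev L v * infl g v) / 4.
  rewrite mulr_natl -[n in c *+ n]card_ord -sumr_const.
  by apply: ler_sum => L _; exact: H.
rewrite -mulr_suml exchange_big /= => h.
rewrite -(ler_pM2l n0); apply: le_trans h _; rewrite mulrA ler_pM2r ?invr_gt0 // mulr_sumr.
apply: ler_sum => v _; rewrite -mulr_suml le_eqVlt; apply/orP; left; apply/eqP.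
by field; rewrite lt0r_neq0.
Qed.

Lemma mean_piv_lower : 3 * rho ^+ k <= 1 / 2048 -> 1 / (24 * rho ^+ k) <= mean_piv R f.
Proof.
move=> small.
have n0 : 0 < n%:R :> R by rewrite ltr0n; exact: ltnW.
have n56 : (56 <= n)%N by apply: leq_trans n_large; rewrite leq_pmulr // expn_gt0.
(* As [16 * X.+1] lies between [n] and [2 * n], the window term is at most 1/8 and the variance term
   at most 256/2048 = 1/8. Hence [1 / 2 <= 2 * Ex low + 1 / 4], and 24 is 8 times 3. *)
pose X := (n %/ 16)%N.
have X1 : n%:R <= 16 * X.+1%:R :> R.
  by rewrite -natrM ler_nat; case: (div16_bounds n56).
have X2 : 16 * X.+1%:R <= 2 * n%:R :> R.
  by rewrite -!natrM ler_nat; case: (div16_bounds n56).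
have S4 : X.+1%:R / n%:R <= 1 / 8 :> R.
  by rewrite ler_pdivrMr; [lra|exact: n0].
have nV : (n ^ 2 <= #|box n|.+1)%N by rewrite card_box.
have n_gt0 : (0 < n)%N by apply: ltnW.
pose c : R := 2 * Ex (low R f) + X.+1%:R / n%:R.
have H (L : 'I_n) : 1 / 2 <= c + (\sum_v rev L v) / X.+1%:R ^+ 2.
  rewrite -(crossf_half R n_ge2); apply: half_le_low; [exact: box_even|exact: line_next_new| |exact: n_gt0|exact: nV].
  by move=> w w' ww'; apply: (@crossf_det n n_ge2 L); exact: ww'.
have S : \sum_(L : 'I_n) (1 / 2 : R) <= \sum_(L : 'I_n) (c + (\sum_v rev L v) / X.+1%:R ^+ 2).
  by apply: ler_sum => L _.
rewrite big_split /= !sumr_const card_ord -[X in X <= _]mulr_natl -[c *+ _]mulr_natl in S.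
rewrite -mulr_suml exchange_big /= in S.
have x0 : 0 < X.+1%:R :> R by rewrite ltr0n.
have S2 : \sum_v \sum_(L : 'I_n) rev L v <= n%:R ^+ 3 / 2048.
  apply: le_trans (_ : \sum_(v : box n) (n%:R / 2048) <= _).
    apply: ler_sum => v _; have := mean_reveal v; rewrite ler_pdivrMr // => h.
    by apply: le_trans h _; rewrite mulrC; nra.
  rewrite sumr_const card_box -[leLHS]mulr_natr natrX [X in _ <= X / _]exprS.
  by rewrite mulrAC.
have S3 : (\sum_v \sum_(L : 'I_n) rev L v) / X.+1%:R ^+ 2 <= n%:R / 8.
  rewrite ler_pdivrMr ?exprn_gt0 //; apply: le_trans S2 _.
  have h2 : n%:R ^+ 2 <= (16 * X.+1%:R) ^+ 2 :> R by rewrite ler_pXn2r ?nnegrE //; lra.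
  have := ler_wpM2l (ltW n0) h2; rewrite exprMn !exprS !expr0; lra.
have low8 : 1 / 8 <= Ex (low R f).
  have : n%:R * (1 / 2) <= n%:R * (c + 1 / 8).
    by apply: le_trans S _; rewrite [leRHS]mulrDr lerD2l; apply: le_trans S3 _; lra.
  rewrite ler_pM2l // /c; move: S4; set y := X.+1%:R / n%:R; lra.
have := low_le; have r0 : 0 < rho ^+ k by rewrite exprn_gt0.
move=> h; rewrite ler_pdivrMr ?mulr_gt0 //; lra.
Qed.

End Assembly.

Lemma expr_small (R : realType) (rho eps : R) : 0 < rho -> rho < 1 -> 0 < eps ->
  exists k0, forall k, (k0 <= k)%N -> rho ^+ k <= eps.
Proof.
move=> r0 r1 e0; pose x := rho^-1 - 1.
have x0 : 0 < x by rewrite subr_gt0 invf_gt1.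
have bern k : 1 + k%:R * x <= (1 + x) ^+ k.
  elim: k => [|k IH]; first by rewrite expr0 mul0r addr0.
  rewrite exprS -natr1; have := ler_wpM2l (ltW (addr_gt0 ltr01 x0)) IH.
  have : 0 <= k%:R * (x * x) by rewrite !mulr_ge0 ?ler0n // ltW.
  lra.
pose y := eps^-1 / x; exists (Num.truncn y).+1 => k kk.
have yk : y <= k%:R.
  apply: ltW; apply: lt_le_trans (truncnS_gt y) _; by rewrite ler_nat.
rewrite -[rho]invrK -[eps]invrK exprVn lef_pV2 ?posrE ?invr_gt0 ?exprn_gt0 ?invr_gt0 //.
have -> : rho^-1 = 1 + x by rewrite /x; lra.
apply: le_trans (bern k); move: yk; rewrite /y ler_pdivrMr //; lra.
Qed.

Lemma mean_piv_growth (R : realType) : exists alpha C : R, [/\ 0 < alpha, 0 < C &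
  forall n : nat, (2 <= n)%N -> ~~ odd n -> C * (n%:R `^ alpha) <= mean_piv R (@crossf n)].
Proof.
have [rho1 [r10 r11 Harm]] := arm_decay R.
pose rho := Num.max rho1 (1 / 4).
have r0 : 0 < rho by rewrite lt_max r10.
have r1 : rho < 1 by rewrite gt_max r11 /=; lra.
have r4 : 1 / 4 <= rho by rewrite le_max lexx orbT.
have [k0 Hk0] := expr_small r0 r1 (ltac:(lra) : 0 < (1 / 6144 : R)).
have ln16 : 0 < ln (16 : R) by rewrite ln_gt0 //; lra.
(* Chosen so that $16^\alpha = 1/\rho$, since the box side grows by 16 when the bound gains a factor
   $1/\rho$. *)
pose alpha := ln rho^-1 / ln 16.
have a0 : 0 < alpha by rewrite divr_gt0 // ln_gt0 // invf_gt1.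
have a16 : (16 : R) `^ alpha = rho^-1.
  rewrite /powR ifF; last by apply/negbTE; rewrite pnatr_eq0.
  by rewrite /alpha divfK ?lt0r_neq0 // lnK // posrE invr_gt0.
have [n0 en0] : exists n0, n0 = (56 * 16 ^ k0)%N by eexists.
(* 896 is 56 times 16: for the largest [k] with [56 * 16 ^ k <= n], [n] is below 56 times the next
   power. *)
have [M eM] : exists M, M = 896%N by eexists.
have n0_gt0 : (0 < n0)%N by rewrite en0 muln_gt0 expn_gt0.
have pM : 0 < (M%:R : R) `^ alpha by apply: powR_gt0; rewrite ltr0n eM.
have pn0 : 0 < (n0%:R : R) `^ alpha by apply: powR_gt0; rewrite ltr0n.
pose C1 : R := 1 / (24 * M%:R `^ alpha).
pose C2 : R := (2 ^+ (n0 ^ 2))^-1 / (n0%:R `^ alpha).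
have C10 : 0 < C1 by rewrite divr_gt0 // mulr_gt0.
have C20 : 0 < C2 by rewrite divr_gt0 // invr_gt0 exprn_gt0.
exists alpha, (Num.min C1 C2); split=> //; first by rewrite lt_min C10.
move=> n n2 ne; have pn : 0 <= n%:R `^ alpha :> R by apply: powR_ge0.
have ev := box_even ne.
case: (leqP n0 n) => nn0; last first.
  apply: le_trans (_ : C2 * (n0%:R `^ alpha) <= _).
    apply: ler_pM => //; first by rewrite le_min !ltW.
      by rewrite ge_min lexx orbT.
    by apply: ge0_ler_powR; [exact: ltW|rewrite nnegrE ler0n|rewrite nnegrE ler0n|rewrite ler_nat ltnW].
  rewrite divfK ?lt0r_neq0 //.
  apply: le_trans (mean_piv_ge ev (@crossf_mono n) (crossf_half_level R n2 ev)).
  rewrite lef_pV2 ?posrE ?exprn_gt0 //.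
  by apply: ler_weXn2l; [rewrite ler1n|rewrite card_box leq_sqr ltnW].
have [k [k0k nk nk']] : exists k, [/\ (k0 <= k)%N, (56 * 16 ^ k <= n)%N & (n <= M * 16 ^ k)%N].
  have n56 : (0 < n %/ 56)%N.
    by rewrite divn_gt0 //; apply: leq_trans nn0; rewrite en0 leq_pmulr // expn_gt0.
  have /andP[h1 h2] := trunc_log_bounds (isT : (1 < 16)%N) n56.
  exists (trunc_log 16 (n %/ 56)); split.
  - by apply: trunc_log_max => //; rewrite leq_divRL // mulnC -en0.
  - by rewrite mulnC -leq_divRL.
  - by move: h2; rewrite ltn_divLR // expnS mulnAC eM => /ltnW.
have Harm' (v : box n) : Pr R (fun w : box n -> bool => exists z : box n,
    conn (open_at w) (lat v) (lat z) /\
    2 * scale k <= `|(lat z).1 - (lat v).1|) <= rho ^+ k.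
  apply: le_trans (Harm _ (@lat n) v k (@lat_inj n)) _.
  by apply: lerXn2r; [rewrite nnegrE ltW|rewrite nnegrE ltW|rewrite le_max lexx].
have rk0 : 0 < rho ^+ k by rewrite exprn_gt0.
apply: le_trans (mean_piv_lower n2 ne r0 r4 Harm' nk _); last by have := Hk0 k k0k; lra.
apply: le_trans (_ : C1 * (M%:R `^ alpha * rho^-1 ^+ k) <= _).
  apply: ler_pM => //; first by rewrite le_min !ltW.
    by rewrite ge_min lexx.
  apply: le_trans (_ : (M * 16 ^ k)%N%:R `^ alpha <= _).
    by apply: ge0_ler_powR; [exact: ltW|rewrite nnegrE ler0n|rewrite nnegrE ler0n|rewrite ler_nat].
  rewrite natrM natrX powRM ?ler0n // ?exprn_ge0 ?ler0n //.
  by rewrite -powR_mulrn ?ler0n // -powRrM [k%:R * _]mulrC [16 `^ _]powRrM a16 powR_mulrn // invr_ge0 ltW.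
rewrite /C1 exprVn le_eqVlt; apply/orP; left; apply/eqP.
by field; rewrite !lt0r_neq0.
Qed.

Theorem corollary3p4 (R : realType) :
  exists alpha C : R,
    [/\ 0 < alpha,
        0 < C,
        forall n : nat, (2 <= n)%N -> ~~ odd n ->
          C * (n%:R `^ alpha) <=
            unif_expect (n ^ 2)./2 (fun w : config (box n) => (num_pivotal0 R w)%:R : R) &
        forall n : nat, (2 <= n)%N -> ~~ odd n ->
          2 * C * (n%:R `^ alpha) <=
            (unif_prob R (n ^ 2)./2.+1 (crossing_event R n) -
             unif_prob R (n ^ 2)./2 (crossing_event R n)) / (1 / (n ^ 2)%:R)].
Proof.
have [alpha [C [a0 C0 H]]] := mean_piv_growth R.
exists alpha, C; split=> // n n2 ne; rewrite -card_box.
  by rewrite expect_mean_piv; exact: H.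
by rewrite russo // -mulrA ler_pM2l //; exact: H.
Qed.
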